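(* Let $\mathcal{D}$ be a unitary multifusion category. The tube algebra $\mathbf{Tube}({}_{\mathcal{D}}\mathcal{D}_{\mathcal{D}})$, with the multiplication, unit, comultiplication and counit recalled in the context, is a weak Hopf algebra with antipode $$S(v\otimes w)=\frac{d_f}{d_h}\;w^{\flat}\otimes v^{\sharp}$$ for $v\in\mathrm{Hom}(c,a\otimes e\otimes b)$, $w\in\mathrm{Hom}(a\otimes f\otimes b,h)$, where $w^\flat\in\mathrm{Hom}(f,\bar a\otimes h\otimes\bar b)$ and $v^\sharp\in\mathrm{Hom}(\bar a\otimes c\otimes\bar b,e)$ are obtained by bending the $a$- and $b$-legs.
   Context: A unitary multifusion category (UMFC) $\mathcal{D}$ is a finite semisimple $\mathbb{C}$-linear rigid monoidal category with compatible unitary dagger structure; $\mathbf{1}=\bigoplus_{i\in I}\mathbf{1}_i$ with $\mathbf{1}_i$ simple, $\mathcal{D}=\bigoplus\mathcal{D}_{i,j}$, $\mathcal{D}_{i,j}=\mathbf{1}_i\otimes\mathcal{D}\otimes\mathbf{1}_j$. $\mathrm{Irr}(\mathcal{D})$ is a set of representatives of simple objects, containing all $\mathbf{1}_i$. Associators are suppressed. $\mathcal{D}$ carries a spherical structure: for simple $x\in\mathcal{D}_{i,j}$ with dual $\bar x$ there are $\mathrm{coev}_x:\mathbf{1}\to x\otimes\bar x$, $\mathrm{ev}_x:\bar x\otimes x\to\mathbf{1}$ satisfying the zig-zag equations, the other pair of duality maps is given by $\mathrm{ev}_x^\dagger,\mathrm{coev}_x^\dagger$, and $\mathrm{coev}_x^\dagger\mathrm{coev}_x=d_x\mathrm{id}_{\mathbf{1}_i}$,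 $\mathrm{ev}_x\mathrm{ev}_x^\dagger=d_x\mathrm{id}_{\mathbf{1}_j}$ (on the relevant summands of $\mathbf{1}$) with the same number $d_x>0$ (quantum dimension); diagrams are invariant under planar isotopy. Tube space: $\mathbf{Tube}({}_{\mathcal{D}}\mathcal{D}_{\mathcal{D}})=\bigoplus_{a,b,c,e,f,h\in\mathrm{Irr}(\mathcal{D})}\mathrm{Hom}(c,a\otimes e\otimes b)\otimes\mathrm{Hom}(a\otimes f\otimes b,h)$. For arbitrary objects $A,B$ and $v\in\mathrm{Hom}(c,A\otimes e\otimes B)$, $w\in\mathrm{Hom}(A\otimes f\otimes B,h)$, put $\langle\!\langle v,w\rangle\!\rangle=\sum_{k,s\in\mathrm{Irr}(\mathcal{D})}\sum_{p,q}((p^*\otimes\mathrm{id}_e\otimes q^* )v)\otimes(w(p\otimes\mathrm{id}_f\otimes q))$, with $p$ over a basis of $\mathrm{Hom}(k,A)$, $p^*$ the dual basis of $\mathrm{Hom}(A,k)$ ($p^*p'=\delta_{p,p'}\mathrm{id}_k$), and $q,q^*$ likewise for $s,B$. Multiplication: $(v\otimes w)(v'\otimes w')=\delta_{f,h'}\delta_{e,c'}\langle\!\langle(\mathrm{id}_a\otimes v'\otimes\mathrm{id}_b)v,\;w(\mathrm{id}_a\otimes w'\otimes\mathrm{id}_b)\rangle\!\rangle$, with $A=a\otimes a'$, $B=b'\otimes b$. Unit: $1=\sum_{x,y}\mathrm{id}_y\otimes\mathrm{id}_x$ over pairs of simples in the same $\mathcal{D}_{i,j}$, the summand having $a=\mathbf{1}_i$,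 $b=\mathbf{1}_j$, $c=e=y$, $f=h=x$. Counit: $\varepsilon(v\otimes w)=0$ unless $e=f$, $c=h$, and then $\varepsilon(v\otimes w)\mathrm{id}_h=w\circ v$. Comultiplication: $\Delta(v\otimes w)=\sum_{i,k}\sum_p(v_p\otimes w)\otimes(v\otimes w_p)$, with $v_p$ a basis of $\mathrm{Hom}(k,a\otimes i\otimes b)$ and $w_p$ the dual basis of $\mathrm{Hom}(a\otimes i\otimes b,k)$, $w_pv_q=\delta_{p,q}\mathrm{id}_k$. Bending: $w^\flat=(\mathrm{id}_{\bar a}\otimes w\otimes\mathrm{id}_{\bar b})(\mathrm{ev}_a^\dagger\otimes\mathrm{id}_f\otimes\mathrm{coev}_b)$ and $v^\sharp=(\mathrm{ev}_a\otimes\mathrm{id}_e\otimes\mathrm{coev}_b^\dagger)(\mathrm{id}_{\bar a}\otimes v\otimes\mathrm{id}_{\bar b})$; $w^\flat\otimes v^\sharp$ is the tube element with arcs $\bar a,\bar b$, lower labels $f$ (outside), $h$ (inside) and upper labels $c$ (inside), $e$ (outside). A weak bialgebra is an algebra and coalgebra with $\Delta$ multiplicative, $(\Delta\otimes\mathrm{id})\Delta(1)=(\Delta(1)\otimes1)(1\otimes\Delta(1))=(1\otimes\Delta(1))(\Delta(1)\otimes1)$ and $\varepsilon(xyz)=\sum\varepsilon(xy^{(1)})\varepsilon(y^{(2)}z)=\sum\varepsilon(xy^{(2)})\varepsilon(y^{(1)}z)$. It is a weak Hopf algebra with antipode $S$ if $\sum x^{(1)}S(x^{(2)})=\sum\varepsilon(1^{(1)}x)1^{(2)}$,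 $\sum S(x^{(1)})x^{(2)}=\sum1^{(1)}\varepsilon(x1^{(2)})$, $\sum S(x^{(1)})x^{(2)}S(x^{(3)})=S(x)$. *)

(* Defs.v *)
From HB Require Import structures.
From mathcomp Require Import all_boot all_order all_algebra.
From mathcomp Require Import complex.
From mathcomp Require Import boolp classical_sets reals.

Set Implicit Arguments.
Unset Strict Implicit.
Unset Printing Implicit Defensive.

Import GRing.Theory Num.Theory.

Local Open Scope ring_scope.
Local Open Scope complex_scope.

Reserved Notation "g ∘ f" (at level 40, left associativity).
Reserved Notation "x ⊗ y" (at level 39, left associativity).
Reserved Notation "f ⊠ g" (at level 39, left associativity).
Reserved Notation "v ⨂ w" (at level 39, left associativity).
Reserved Notation "f ^†" (at level 2, left associativity, format "f ^†").

Section DirectSum.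
Variables (K : fieldType) (J : finType) (V : J -> vectType K).
Import VectorInternalTheory.

Definition dsum : Type := {dffun forall j, V j}.

HB.instance Definition _ := Choice.on dsum.

Implicit Types (s t : dsum) (k : K).

Definition dsum0 : dsum := [ffun j => 0].
Definition dsum_opp s : dsum := [ffun j => - s j].
Definition dsum_add s t : dsum := [ffun j => s j + t j].
Definition dsum_scale k s : dsum := [ffun j => k *: s j].

Fact dsum_addA : associative dsum_add.
Proof. by move=> s t r; apply/ffunP=> j; rewrite !ffunE addrA. Qed.
Fact dsum_addC : commutative dsum_add.
Proof. by move=> s t; apply/ffunP=> j; rewrite !ffunE addrC. Qed.
Fact dsum_add0 : left_id dsum0 dsum_add.
Proof. by move=> s; apply/ffunP=> j; rewrite !ffunE add0r. Qed.
Fact dsum_addN : left_inverse dsum0 dsum_opp dsum_add.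
Proof. by move=> s; apply/ffunP=> j; rewrite !ffunE addNr. Qed.

HB.instance Definition _ :=
  GRing.isZmodule.Build dsum dsum_addA dsum_addC dsum_add0 dsum_addN.

Fact dsum_scaleA k l s : dsum_scale k (dsum_scale l s) = dsum_scale (k * l) s.
Proof. by apply/ffunP=> j; rewrite !ffunE scalerA. Qed.
Fact dsum_scale1 : left_id 1 dsum_scale.
Proof. by move=> s; apply/ffunP=> j; rewrite !ffunE scale1r. Qed.
Fact dsum_scaleDr : right_distributive dsum_scale +%R.
Proof. by move=> k s t; apply/ffunP=> j; rewrite !ffunE scalerDr. Qed.
Fact dsum_scaleDl s : {morph dsum_scale^~ s : k l / k + l}.
Proof. by move=> k l; apply/ffunP=> j; rewrite !ffunE scalerDl. Qed.

HB.instance Definition _ :=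
  GRing.Zmodule_isLmodule.Build K dsum dsum_scaleA dsum_scale1 dsum_scaleDr
    dsum_scaleDl.

Local Notation coord_idx := {j : J & 'I_(dim (V j))}.

Fact dsum_vect_iso : Vector.axiom #|{: coord_idx}| dsum.
Proof.
pose coords (s : dsum) : 'rV[K]_#|{: coord_idx}| :=
  \row_k v2r (s (tag (enum_val k))) ord0 (tagged (enum_val k)).
exists coords.
  by move=> k s t; apply/rowP=> i; rewrite !mxE !ffunE linearP !mxE.
pose decode (r : 'rV[K]_#|{: coord_idx}|) : dsum := [ffun j =>
  r2v (\row_l r ord0 (enum_rank (Tagged (fun j => 'I_(dim (V j))) l)))].
exists decode.
  move=> s; apply/ffunP=> j; rewrite ffunE -[RHS]v2rK; congr r2v.
  by apply/rowP=> l; rewrite !mxE enum_rankK.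
move=> r; apply/rowP=> k; rewrite mxE ffunE r2vK mxE.
by rewrite -[in RHS](enum_valK k); case: (enum_val k).
Qed.

HB.instance Definition _ := Lmodule_hasFinDim.Build K dsum dsum_vect_iso.

Definition dsum_inj (j : J) (v : V j) : dsum :=
  [ffun i => dfwith (fun i => 0 : V i) v i].

End DirectSum.

(* The tensor product of two finite-dimensional spaces, modelled as matrices  *)
(* of coordinates in their canonical bases; [tlift] is its universal property *)
(* (see [tlift_pure]), and serves to write Sweedler-style sums.               *)
Section TensorProduct.
Variable K : fieldType.
Implicit Types U V W : vectType K.

Definition tprod V W : Type := 'M[K]_(\dim {:V}, \dim {:W}).
HB.instance Definition _ V W := Vector.on (tprod V W).

Definition tpure V W (v : V) (w : W) : tprod V W :=
  \matrix_(i, j) (coord (vbasis {:V}) i v * coord (vbasis {:W}) j w).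

Definition tlift V W U (B : V -> W -> U) (t : tprod V W) : U :=
  \sum_i \sum_j t i j *: B (vbasis {:V})`_i (vbasis {:W})`_j.

Definition bilin V W U (B : V -> W -> U) : Prop :=
  (forall v, linear (B v)) /\ (forall w, linear (B^~ w)).

Lemma tlift_pure V W U (B : V -> W -> U) v w :
  bilin B -> tlift B (tpure v w) = B v w.
Proof.
move=> [Blin Blin'].
pose Bv x : {linear W -> U} :=
  HB.pack (B x) (GRing.isLinear.Build _ _ _ _ _ (Blin x)).
pose Bw y : {linear V -> U} :=
  HB.pack (B^~ y) (GRing.isLinear.Build _ _ _ _ _ (Blin' y)).
rewrite [in RHS](coord_vbasis (memvf v)) -[RHS]/(Bw w _) linear_sum.
apply: eq_bigr => i _; rewrite linearZ /= [in RHS](coord_vbasis (memvf w)).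
rewrite -[B _ (\sum_j _)]/(Bv _ _) linear_sum scaler_sumr.
by apply: eq_bigr => j _; rewrite linearZ /= scalerA mxE.
Qed.

Lemma tpure_bilin V W : bilin (@tpure V W).
Proof.
by split=> [v|w] k x y; apply/matrixP=> i j; rewrite !mxE linearP /=;
  [rewrite mulrDr mulrCA | rewrite mulrDl mulrA].
Qed.

Definition tassoc U V W : tprod U (tprod V W) -> tprod (tprod U V) W :=
  tlift (fun u => tlift (fun v w => tpure (tpure u v) w)).

Definition tmul V W (mulV : V -> V -> V) (mulW : W -> W -> W)
    (s t : tprod V W) : tprod V W :=
  tlift (fun v w => tlift (fun v' w' => tpure (mulV v v') (mulW w w')) t) s.

End TensorProduct.

Notation "v ⨂ w" := (tpure v w).

Section WeakHopf.
Variables (K : fieldType) (A : vectType K).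
Variables (mul : A -> A -> A) (one : A).
Variables (Delta : A -> tprod A A) (eps : A -> K) (S : A -> A).

Record is_algebra : Prop := IsAlgebra {
  alg_bilin : bilin mul;
  alg_assoc : associative mul;
  alg_unitl : left_id one mul;
  alg_unitr : right_id one mul }.

Definition Delta_id (t : tprod A A) : tprod (tprod A A) A :=
  tlift (fun x y => Delta x ⨂ y) t.
Definition id_Delta (t : tprod A A) : tprod A (tprod A A) :=
  tlift (fun x y => x ⨂ Delta y) t.

Record is_coalgebra : Prop := IsCoalgebra {
  coalg_linear : linear Delta;
  coalg_counit_linear : scalar eps;
  coalg_coassoc : forall x, Delta_id (Delta x) = tassoc (id_Delta (Delta x));
  coalg_counitl : forall x, tlift (fun x1 x2 => eps x1 *: x2) (Delta x) = x;
  coalg_counitr : forall x, tlift (fun x1 x2 => eps x2 *: x1) (Delta x) = x }.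

Definition mul3 : tprod (tprod A A) A -> tprod (tprod A A) A ->
    tprod (tprod A A) A :=
  tmul (tmul mul mul) mul.

Record is_weak_bialgebra : Prop := IsWeakBialgebra {
  wba_algebra : is_algebra;
  wba_coalgebra : is_coalgebra;
  wba_mult : forall x y, Delta (mul x y) = tmul mul mul (Delta x) (Delta y);
  wba_unit12 :
    Delta_id (Delta one) = mul3 (Delta one ⨂ one) (tassoc (one ⨂ Delta one));
  wba_unit21 :
    Delta_id (Delta one) = mul3 (tassoc (one ⨂ Delta one)) (Delta one ⨂ one);
  wba_counit12 : forall x y z, eps (mul (mul x y) z) =
    tlift (fun y1 y2 => eps (mul x y1) * eps (mul y2 z) : K^o) (Delta y);
  wba_counit21 : forall x y z, eps (mul (mul x y) z) =
    tlift (fun y1 y2 => eps (mul x y2) * eps (mul y1 z) : K^o) (Delta y) }.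

Record is_weak_Hopf_algebra : Prop := IsWeakHopf {
  wha_weak_bialgebra : is_weak_bialgebra;
  wha_linear : linear S;
  wha_target : forall x,
    tlift (fun x1 x2 => mul x1 (S x2)) (Delta x) =
    tlift (fun u1 u2 => eps (mul u1 x) *: u2) (Delta one);
  wha_source : forall x,
    tlift (fun x1 x2 => mul (S x1) x2) (Delta x) =
    tlift (fun u1 u2 => eps (mul x u2) *: u1) (Delta one);
  wha_antipode : forall x,
    tlift (fun x12 x3 =>
      tlift (fun x1 x2 => mul (mul (S x1) x2) (S x3)) x12)
      (Delta_id (Delta x)) = S x }.

End WeakHopf.

Record cat_data (R : realType) := CatData {
  ob :> Type;
  hom : ob -> ob -> vectType R[i];
  idm : forall x, hom x x;
  comp : forall x y z, hom y z -> hom x y -> hom x z;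
  dag : forall x y, hom x y -> hom y x }.

Arguments hom {R c}.
Arguments idm {R c}.

Notation "g ∘ f" := (comp g f).
Notation "f ^†" := (dag f).

(* With finite-dimensional Hom spaces the last two conditions are equivalent  *)
(* to the existence of a C*-category structure.                               *)
Record is_cstar_category (R : realType) (C : cat_data R) : Prop :=
    IsCstarCategory {
  comp_idl : forall (x y : C) (f : hom x y), idm y ∘ f = f;
  comp_idr : forall (x y : C) (f : hom x y), f ∘ idm x = f;
  compA : forall (x y z t : C) (h : hom z t) (g : hom y z) (f : hom x y),
    h ∘ (g ∘ f) = h ∘ g ∘ f;
  comp_bilin : forall x y z : C, bilin (@comp R C x y z);
  dagK : forall (x y : C) (f : hom x y), f^†^† = f;
  dag_comp : forall (x y z : C) (g : hom y z) (f : hom x y),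
    (g ∘ f)^† = f^† ∘ g^†;
  dag_antilinear : forall (x y : C) (k : R[i]) (f g : hom x y),
    (k *: f + g)^† = conjc k *: f^† + g^†;
  dag_definite : forall (x y : C) (f : hom x y), f^† ∘ f = 0 -> f = 0;
  dag_positive : forall (x y : C) (f : hom x y),
    exists g : hom x x, f^† ∘ f = g^† ∘ g }.

Section CategoryNotions.
Variables (R : realType) (C : cat_data R).

Definition isomorphic (x y : C) : Prop :=
  exists (f : hom x y) (g : hom y x), g ∘ f = idm x /\ f ∘ g = idm y.

Definition unitary (x y : C) (f : hom x y) : Prop :=
  f^† ∘ f = idm x /\ f ∘ f^† = idm y.

(* End(x) is one-dimensional, i.e. equal to C id_x and nonzero *)
Definition simple (x : C) : Prop := \dim {: hom x x} = 1%N.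

Definition is_direct_sum (J : finType) (s : J -> C) (x : C)
    (u : forall j, hom (s j) x) (p : forall j, hom x (s j)) : Prop :=
  [/\ forall j, p j ∘ u j = idm (s j),
      forall i j, i != j -> p i ∘ u j = 0
    & \sum_j u j ∘ p j = idm x].

Definition has_direct_sums : Prop :=
  forall (n : nat) (s : 'I_n -> C), exists x u p, @is_direct_sum 'I_n s x u p.

Definition semisimple : Prop :=
  forall x : C, exists (n : nat) (s : 'I_n -> C) u p,
    (forall j, simple (s j)) /\ @is_direct_sum 'I_n s x u p.

End CategoryNotions.

Record monoidal_data (R : realType) := MonoidalData {
  mcat :> cat_data R;
  tens : mcat -> mcat -> mcat;
  unit_ob : mcat;
  tensm : forall x x' y y' : mcat,
    hom x x' -> hom y y' -> hom (tens x y) (tens x' y');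
  assoc : forall x y z : mcat, hom (tens (tens x y) z) (tens x (tens y z));
  lunit : forall x : mcat, hom (tens unit_ob x) x;
  runit : forall x : mcat, hom (tens x unit_ob) x }.

Arguments unit_ob {R}.
Arguments assoc {R m}.
Arguments lunit {R m}.
Arguments runit {R m}.

Notation "x ⊗ y" := (tens x y).
Notation "f ⊠ g" := (tensm f g).

Record is_dagger_monoidal (R : realType) (M : monoidal_data R) : Prop :=
    IsDaggerMonoidal {
  tensm_bilin : forall x x' y y' : M, bilin (@tensm R M x x' y y');
  tensm_id : forall x y : M, idm x ⊠ idm y = idm (x ⊗ y);
  tensm_comp : forall (x x' x'' y y' y'' : M) (f' : hom x' x'') (f : hom x x')
      (g' : hom y' y'') (g : hom y y'),
    (f' ∘ f) ⊠ (g' ∘ g) = (f' ⊠ g') ∘ (f ⊠ g);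
  tensm_dag : forall (x x' y y' : M) (f : hom x x') (g : hom y y'),
    (f ⊠ g)^† = f^† ⊠ g^†;
  assoc_unitary : forall x y z : M, unitary (assoc x y z);
  lunit_unitary : forall x : M, unitary (lunit x);
  runit_unitary : forall x : M, unitary (runit x);
  assoc_nat : forall (x x' y y' z z' : M) (f : hom x x') (g : hom y y')
      (h : hom z z'),
    assoc x' y' z' ∘ (f ⊠ g ⊠ h) = (f ⊠ (g ⊠ h)) ∘ assoc x y z;
  lunit_nat : forall (x x' : M) (f : hom x x'),
    lunit x' ∘ (idm (unit_ob M) ⊠ f) = f ∘ lunit x;
  runit_nat : forall (x x' : M) (f : hom x x'),
    runit x' ∘ (f ⊠ idm (unit_ob M)) = f ∘ runit x;
  pentagon : forall x y z t : M,
    assoc x y (z ⊗ t) ∘ assoc (x ⊗ y) z t =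
    (idm x ⊠ assoc y z t) ∘ assoc x (y ⊗ z) t ∘ (assoc x y z ⊠ idm t);
  triangle : forall x y : M,
    (idm x ⊠ lunit y) ∘ assoc x (unit_ob M) y = runit x ⊠ idm y }.

Record dual_data (R : realType) := DualData {
  dmon :> monoidal_data R;
  bar : dmon -> dmon;
  ev : forall x : dmon, hom (bar x ⊗ x) (unit_ob dmon);
  coev : forall x : dmon, hom (unit_ob dmon) (x ⊗ bar x) }.

Arguments ev {R d}.
Arguments coev {R d}.

Section Duality.
Variables (R : realType) (D : dual_data R).
Local Notation "1" := (unit_ob D).

Definition zigzag (x : D) : hom x x :=
  runit x ∘ (idm x ⊠ ev x) ∘ assoc x (bar x) x ∘ (coev x ⊠ idm x)
    ∘ (lunit x)^†.

Definition zagzig (x : D) : hom (bar x) (bar x) :=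
  lunit (bar x) ∘ (ev x ⊠ idm (bar x)) ∘ (assoc (bar x) x (bar x))^†
    ∘ (idm (bar x) ⊠ coev x) ∘ (runit (bar x))^†.

(* bends the leg x of a pairing z ⊗ x -> 1 *)
Definition bend (z x : D) (e : hom (z ⊗ x) 1) : hom z (bar x) :=
  lunit (bar x) ∘ (e ⊠ idm (bar x)) ∘ (assoc z x (bar x))^†
    ∘ (idm z ⊠ coev x) ∘ (runit z)^†.

Definition dual_mor (x y : D) (f : hom x y) : hom (bar y) (bar x) :=
  bend (ev y ∘ (idm (bar y) ⊠ f)).

Definition nested_ev (x y : D) : hom ((bar y ⊗ bar x) ⊗ (x ⊗ y)) 1 :=
  ev y ∘ (idm (bar y) ⊠ (lunit y ∘ (ev x ⊠ idm y) ∘ (assoc (bar x) x y)^†))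
    ∘ assoc (bar y) (bar x) (x ⊗ y).

End Duality.

Section Components.
Variables (R : realType) (M : monoidal_data R).

Definition in_component (p q x : M) : Prop :=
  exists y : M, isomorphic x (p ⊗ y ⊗ q).

End Components.

(* A unitary multifusion category with its spherical structure. Duality data  *)
(* is carried by all objects. Given the zig-zag equations, invariance of      *)
(* diagrams under planar isotopy amounts to [umfc_pivotal] (taking the dual   *)
(* of a morphism with (ev, coev) or with the adjoint pair (coev^†, ev^†)      *)
(* gives the same result) and [umfc_tensorator] (the nested duality maps of a *)
(* tensor product agree up to a unitary with the chosen ones).                *)
Record UMFC (R : realType) := MkUMFC {
  udata :> dual_data R;
  Irr : finType;
  irr : Irr -> udata;
  unit_idx : finType;
  unit_irr : unit_idx -> Irr;
  unit_inc : forall i, hom (irr (unit_irr i)) (unit_ob udata);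
  qdim : udata -> R;
  umfc_cstar : is_cstar_category udata;
  umfc_monoidal : is_dagger_monoidal udata;
  umfc_direct_sums : has_direct_sums udata;
  umfc_semisimple : semisimple udata;
  umfc_irr_simple : forall a, simple (irr a);
  umfc_irr_repr : forall x : udata, simple x ->
    exists! a, isomorphic x (irr a);
  umfc_unit : is_direct_sum unit_inc (fun i => (unit_inc i)^†);
  umfc_zigzag : forall x : udata, zigzag x = idm x;
  umfc_zagzig : forall x : udata, zagzig x = idm (bar x);
  umfc_pivotal : forall (x y : udata) (f : hom x y),
    dual_mor f^† = (dual_mor f)^†;
  umfc_tensorator : forall x y : udata, unitary (bend (nested_ev x y));
  umfc_qdim_gt0 : forall x : udata, simple x -> 0 < qdim x;
  umfc_spherical : forall (i j : unit_idx) (x : udata), simple x ->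
    in_component (irr (unit_irr i)) (irr (unit_irr j)) x ->
    (coev x)^† ∘ coev x = (qdim x)%:C *: (unit_inc i ∘ (unit_inc i)^†) /\
    ev x ∘ (ev x)^† = (qdim x)%:C *: (unit_inc j ∘ (unit_inc j)^†) }.

Arguments irr {R u}.
Arguments unit_irr {R u}.
Arguments unit_inc {R u}.
Arguments qdim {R u}.

Section Tube.
Variables (R : realType) (D : UMFC R).
Local Notation C := R[i].
Local Notation I := (Irr D).
Local Notation "1" := (unit_ob D).

Definition tube_idx : finType := (I * I * I * I * I * I)%type.

Definition ix_a (t : tube_idx) : I := t.1.1.1.1.1.
Definition ix_b (t : tube_idx) : I := t.1.1.1.1.2.
Definition ix_c (t : tube_idx) : I := t.1.1.1.2.
Definition ix_e (t : tube_idx) : I := t.1.1.2.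
Definition ix_f (t : tube_idx) : I := t.1.2.
Definition ix_h (t : tube_idx) : I := t.2.

Definition hom_in (A B : D) (c e : I) : vectType C :=
  hom (irr c) (A ⊗ irr e ⊗ B).
Definition hom_out (A B : D) (f h : I) : vectType C :=
  hom (A ⊗ irr f ⊗ B) (irr h).

Definition tube_summand (t : tube_idx) : vectType C :=
  tprod (hom_in (irr (ix_a t)) (irr (ix_b t)) (ix_c t) (ix_e t))
        (hom_out (irr (ix_a t)) (irr (ix_b t)) (ix_f t) (ix_h t)).

Definition Tube : vectType C := dsum tube_summand.

Definition tube_elt (a b c e f h : I)
    (v : hom_in (irr a) (irr b) c e) (w : hom_out (irr a) (irr b) f h) : Tube :=
  @dsum_inj _ _ tube_summand (a, b, c, e, f, h) (v ⨂ w).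

Definition tube_lift (U : vectType C)
    (B : forall a b c e f h : I,
      hom_in (irr a) (irr b) c e -> hom_out (irr a) (irr b) f h -> U)
    (x : Tube) : U :=
  \sum_(t : tube_idx)
    tlift (B (ix_a t) (ix_b t) (ix_c t) (ix_e t) (ix_f t) (ix_h t)) (x t).

Lemma tube_lift_elt (U : vectType C)
    (B : forall a b c e f h : I,
      hom_in (irr a) (irr b) c e -> hom_out (irr a) (irr b) f h -> U)
    (a b c e f h : I) (v : hom_in (irr a) (irr b) c e)
    (w : hom_out (irr a) (irr b) f h) :
  (forall a b c e f h, bilin (B a b c e f h)) ->
  tube_lift B (tube_elt v w) = B a b c e f h v w.
Proof.
move=> Blin; rewrite /tube_lift (bigD1 ((a, b, c, e, f, h) : tube_idx)) //=.
rewrite big1 ?addr0 => [|t /negPf neq_t].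
  rewrite /tube_elt /dsum_inj ffunE dfwith_in; exact: tlift_pure.
rewrite /tube_elt /dsum_inj ffunE dfwith_out; last by rewrite eq_sym neq_t.
by rewrite /tlift big1 // => i _; rewrite big1 // => j _; rewrite mxE scale0r.
Qed.

(* the canonical isomorphism, elided when associators are suppressed *)
Definition rebracket (a a' e b' b : D) :
    hom (a ⊗ (a' ⊗ e ⊗ b') ⊗ b) ((a ⊗ a') ⊗ e ⊗ (b' ⊗ b)) :=
  ((assoc a a' e)^† ⊠ idm (b' ⊗ b)) ∘ assoc (a ⊗ (a' ⊗ e)) b' b
    ∘ ((assoc a (a' ⊗ e) b')^† ⊠ idm b).

Definition unit_in (e : D) : hom e (1 ⊗ e ⊗ 1) :=
  (runit (1 ⊗ e))^† ∘ (lunit e)^†.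
Definition unit_out (e : D) : hom (1 ⊗ e ⊗ 1) e :=
  lunit e ∘ runit (1 ⊗ e).

(* [irr_delta a b] is the identity when a = b and 0 otherwise. *)
Definition irr_delta (a b : I) : hom (@irr R D a) (irr b) :=
  match a =P b with
  | ReflectT E => ecast z (hom (irr a) (irr z)) E (idm (irr a))
  | ReflectF _ => 0
  end.

Definition irr_scalar (h : I) (f : hom (@irr R D h) (irr h)) : C :=
  coord [tuple idm (irr h)] ord0 f.

Definition irr_basis (k : I) (A : D) := vbasis (fullv : {vspace hom (irr k) A}).
Definition bvec (k : I) (A : D) p : hom (irr k) A := tnth (irr_basis k A) p.
Definition bdual (k : I) (A : D) p : hom A (irr k) :=
  xget 0 [set g : hom A (irr k) |
    forall q, g ∘ bvec q = (p == q)%:R *: idm (irr k)]%classic.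

Definition tube_bracket (A B : D) (c e f h : I)
    (v : hom_in A B c e) (w : hom_out A B f h) : Tube :=
  \sum_(k : I) \sum_(s : I) \sum_p \sum_q
    tube_elt ((@bdual k A p ⊠ idm (irr e) ⊠ @bdual s B q) ∘ v)
             (w ∘ (@bvec k A p ⊠ idm (irr f) ⊠ @bvec s B q)).

(* The deltas of f, h' and of e, c' enter through [irr_delta], which also     *)
(* makes the compositions typecheck.                                          *)
Definition tube_mul (x y : Tube) : Tube :=
  tube_lift (fun a b c e f h v w =>
    tube_lift (fun a' b' c' e' f' h' v' w' =>
      tube_bracket (A := irr a ⊗ irr a') (B := irr b' ⊗ irr b)
                   (c := c) (e := e') (f := f') (h := h)
        (rebracket (irr a) (irr a') (irr e') (irr b') (irr b)
          ∘ (idm (irr a) ⊠ (v' ∘ irr_delta e c') ⊠ idm (irr b)) ∘ v)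
        (w ∘ (idm (irr a) ⊠ (irr_delta h' f ∘ w') ⊠ idm (irr b))
          ∘ (rebracket (irr a) (irr a') (irr f') (irr b') (irr b))^†)) y) x.

Definition in_comp (i j : unit_idx D) (x : I) : Prop :=
  in_component (@irr R D (unit_irr i)) (irr (unit_irr j)) (irr x).

Definition tube_one : Tube :=
  \sum_(i : unit_idx D) \sum_(j : unit_idx D)
    \sum_(x : I | `[< in_comp i j x >]) \sum_(y : I | `[< in_comp i j y >])
      @tube_elt (unit_irr i) (unit_irr j) y y x x
        (((unit_inc i)^† ⊠ idm (irr y) ⊠ (unit_inc j)^†) ∘ unit_in (irr y))
        (unit_out (irr x) ∘ (unit_inc i ⊠ idm (irr x) ⊠ unit_inc j)).

Definition tube_counit : Tube -> C :=
  tube_lift (U := C^o) (fun a b c e f h v w =>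
    irr_scalar (w ∘ (idm (irr a) ⊠ irr_delta e f ⊠ idm (irr b)) ∘ v
                  ∘ irr_delta h c)).

Definition tube_comul : Tube -> tprod Tube Tube :=
  tube_lift (fun a b c e f h v w =>
    \sum_(i : I) \sum_(k : I) \sum_p
      tube_elt (@bvec k (irr a ⊗ irr i ⊗ irr b) p : hom_in (irr a) (irr b) k i) w ⨂
      tube_elt v
        (@bdual k (irr a ⊗ irr i ⊗ irr b) p : hom_out (irr a) (irr b) i k)).

Definition flat (a b : D) (f h : I) (w : hom_out a b f h) :
    hom_in (bar a) (bar b) f h :=
  (idm (bar a) ⊠ w ⊠ idm (bar b))
    ∘ (rebracket (bar a) a (irr f) b (bar b))^†
    ∘ ((ev a)^† ⊠ idm (irr f) ⊠ coev b) ∘ unit_in (irr f).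

Definition sharp (a b : D) (c e : I) (v : hom_in a b c e) :
    hom_out (bar a) (bar b) c e :=
  unit_out (irr e) ∘ (ev a ⊠ idm (irr e) ⊠ (coev b)^†)
    ∘ rebracket (bar a) a (irr e) b (bar b)
    ∘ (idm (bar a) ⊠ v ⊠ idm (bar b)).

(* The duals of the simples irr a, irr b need not be chosen representatives,  *)
(* so that the tube element with these arcs is read through [tube_bracket].   *)
Definition tube_antipode : Tube -> Tube :=
  tube_lift (fun a b c e f h v w =>
    (qdim (irr f) / qdim (irr h))%:C *: tube_bracket (flat w) (sharp v)).

End Tube.

(* Main.v *)
(* The pairs of arcs (A, B) act on D by the functors e |-> A e B, and the tube *)
(* space is the direct sum over (c, e, f, h) of the coends                     *)
(*   int^(A, B) Hom(c, A e B) (x) Hom(A f B, h),                               *)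
(* the brackets <<v, w>> being the universal dinatural family.  On brackets    *)
(* the structure maps are compositions, so that, by dinaturality, coherence    *)
(* gives the algebra axioms, while Delta is the insertion of the canonical     *)
(* element of Hom(k, A i B) (x) Hom(A i B, k), whose naturality gives the      *)
(* remaining bialgebra axioms.  For the antipode, the arcs bent by flat and    *)
(* sharp cancel by the zig-zag equations; what is left is the identity         *)
(*   d_i <zig (v w) zig^dagger> = d_k <w v>,  v : k -> A i B,  w : A i B -> k, *)
(* which compares the two ways of closing a diagram on the sphere.             *)
(* Diagrams are computed in a strictification of D: an object acts on D by     *)
(* tensoring on the left, and a morphism is a natural transformation between   *)
(* such endofunctors, for which all the associators are identities.            *)

From HB Require Import structures.
From mathcomp Require Import all_boot all_order all_algebra.
From mathcomp Require Import complex.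
From mathcomp Require Import boolp classical_sets reals.
Require Import Defs.

Set Implicit Arguments.
Unset Strict Implicit.
Unset Printing Implicit Defensive.

Import GRing.Theory Num.Theory.

Local Open Scope ring_scope.

(** * Finite sums and linear maps *)

(** Everything is computed on brackets with arbitrary arcs. By [bracket_univ], a linear map that
    agrees with a dinatural family on tube elements agrees with it on all brackets. This gives
    [tube_mul_bracket], [tube_comul_bracket] and [tube_counit_bracket], where a product is a
    composition of legs. Coherence isomorphisms between the arcs pass from one leg to the other by
    [bracket_dinat] and cancel there.

    Multiplicativity of the comultiplication holds because composing the canonical elements of two
    pairs of arcs gives the canonical element of the composite pair ([comp_canonical]). The counit
    of a product is a diagram nested inside another ([comp_mid]); the two weak counit identities
    expand a morphism through the middle diagram in a basis or in a dual basis. The unit is a sum of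
    orthogonal idempotents [unit_bracket y x], and the comultiplication of the unit is a sum of
    tensors of these, so the weak unit identities reduce to Kronecker deltas.

    For the antipode, [flat] and [sharp] are transposes for the adjunction between the two-sided
    actions of the dual arcs and of the arcs, with counit [zig] and unit [cozig]. The ratio of
    dimensions comes from [trace_zig], the comparison of the left and right closures of a diagram.
    It evaluates a closed bubble in [antipode_source], and through [sum_flat_bdual] it turns a
    transposed canonical element into [cozig] in [antipode_target]. Since the unit object need not
    be simple, the two traces are compared by [unit_tr], which is determined by its values on simple
    objects. *)

Section FiniteSums.
Variables (I : finType) (V : nmodType).
Implicit Types (i j k s x y : I).

Lemma sum_only1 k (F : I -> V) :
  (forall j, j != k -> F j = 0) -> \sum_j F j = F k.
Proof. by move=> F0; apply: big_only1 => // j /F0. Qed.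

(** The range of the last index depends on the two before it, as for bases of Hom(k, A i B), so the
    outer sum has to be moved past all three together. *)
Lemma exchange_sum3 (J : finType) (n : I -> I -> nat)
    (F : J -> forall i k, 'I_(n i k) -> V) :
  \sum_j \sum_i \sum_k \sum_p F j i k p = \sum_i \sum_k \sum_p \sum_j F j i k p.
Proof.
rewrite exchange_big; apply: eq_bigr => i _; rewrite exchange_big.
by apply: eq_bigr => k _; rewrite exchange_big.
Qed.

Lemma exchange_sum33 (n : I -> I -> nat)
    (F : forall i k, 'I_(n i k) -> forall i' k', 'I_(n i' k') -> V) :
  \sum_i \sum_k \sum_p \sum_i' \sum_k' \sum_p' F i k p i' k' p' =
  \sum_i' \sum_k' \sum_p' \sum_i \sum_k \sum_p F i k p i' k' p'.
Proof.
transitivity (\sum_i \sum_i' \sum_k' \sum_p' \sum_k \sum_p F i k p i' k' p').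
  apply: eq_bigr => i _; rewrite -exchange_sum3; apply: eq_bigr => k _.
  exact: exchange_sum3.
exact: exchange_sum3.
Qed.

Lemma sum_if2 (k s : I) (F : I -> I -> V) :
  \sum_x \sum_y (if (y == k) && (x == s) then F x y else 0) = F s k.
Proof.
rewrite (sum_only1 (k := s)) => [|x /negPf xs]; last first.
  by rewrite big1 // => y _; rewrite xs andbF.
rewrite (sum_only1 (k := k)) => [|y /negPf yk]; last by rewrite yk.
by rewrite !eqxx.
Qed.

(** The contraction of indices in the middle factor of the product of [Delta 1 ⨂ 1] and
    [1 ⨂ Delta 1]. *)
Lemma sum_if_contract (T : I -> I -> I -> I -> V) :
  \sum_x \sum_y \sum_i \sum_x' \sum_y' \sum_i'
    (if (y == i') && (i == x') then T x i y' i' else 0) =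
  \sum_x \sum_i \sum_y' \sum_i' T x i y' i'.
Proof.
apply: eq_bigr => x _; rewrite exchange_big; apply: eq_bigr => i _ /=.
rewrite exchange_big (sum_only1 (k := i)) => [|x' ne]; last first.
  by do 3 (rewrite big1 // => ? _); rewrite [i == _]eq_sym (negPf ne) andbF.
rewrite exchange_big; apply: eq_bigr => y' _ /=.
rewrite exchange_big; apply: eq_bigr => i' _ /=.
rewrite (sum_only1 (k := i')) ?eqxx // => y /negPf ->.
by [].
Qed.

End FiniteSums.

(** * Linear and bilinear maps as propositions; tensors and direct sums *)

Section LinearMaps.
Variable K : fieldType.
Implicit Types U V W X Y : vectType K.

Lemma lin_sumZ U V (f : U -> V) (lf : linear f) (J : Type) (r : seq J)
    (P : pred J) (c : J -> K) (u : J -> U) :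
  f (\sum_(j <- r | P j) c j *: u j) = \sum_(j <- r | P j) c j *: f (u j).
Proof.
pose F : {linear U -> V} := HB.pack f (GRing.isLinear.Build _ _ _ _ _ lf).
rewrite -[LHS]/(F _) linear_sum; apply: eq_bigr => j _; exact: linearZ.
Qed.

Lemma lin_sum U V (f : U -> V) (lf : linear f) (J : Type) (r : seq J)
    (P : pred J) (u : J -> U) :
  f (\sum_(j <- r | P j) u j) = \sum_(j <- r | P j) f (u j).
Proof.
have := lin_sumZ lf r P (fun=> 1) u.
by under eq_bigr do rewrite scale1r; under [in RHS]eq_bigr do rewrite scale1r.
Qed.

Lemma lin_scale U V (f : U -> V) (lf : linear f) c u : f (c *: u) = c *: f u.
Proof. by have := lin_sumZ lf [:: tt] xpredT (fun=> c) (fun=> u); rewrite !big_seq1. Qed.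

Lemma lin_zero U V (f : U -> V) (lf : linear f) : f 0 = 0.
Proof. by rewrite -(scale0r (0 : U)) (lin_scale lf) scale0r. Qed.

Lemma linear_id U : linear (fun u : U => u).
Proof. by []. Qed.

Lemma linear_comp U V W (f : V -> W) (g : U -> V) :
  linear f -> linear g -> linear (fun u => f (g u)).
Proof. by move=> lf lg k x y; rewrite lg lf. Qed.

Lemma linear_big U V (J : Type) (r : seq J) (P : pred J) (f : J -> U -> V) :
  (forall j, linear (f j)) -> linear (fun u => \sum_(j <- r | P j) f j u).
Proof.
move=> lf k x y; rewrite scaler_sumr -big_split /=.
by apply: eq_bigr => j _; rewrite lf.
Qed.

Lemma linear_scaler U V (c : K) (f : U -> V) :
  linear f -> linear (fun u => c *: f u).
Proof. by move=> lf k x y; rewrite lf scalerDr !scalerA mulrC. Qed.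

Lemma linear_scalel U V (f : U -> K) (v : V) :
  scalar f -> linear (fun u => f u *: v).
Proof. by move=> lf k x y; rewrite lf scalerDl scalerA. Qed.

Lemma bilinl U V W (B : U -> V -> W) (bB : bilin B) v : linear (B^~ v).
Proof. by case: bB. Qed.

Lemma bilinr U V W (B : U -> V -> W) (bB : bilin B) u : linear (B u).
Proof. by case: bB. Qed.

Lemma bilin_comp U U' V V' W (B : U -> V -> W) (f : U' -> U) (g : V' -> V) :
  bilin B -> linear f -> linear g -> bilin (fun u v => B (f u) (g v)).
Proof.
move=> bB lf lg; split=> z k x y; first by rewrite lg (bilinr bB).
by rewrite lf (bilinl bB).
Qed.

Lemma linear_bilin U V W W' (B : U -> V -> W) (f : W -> W') :
  bilin B -> linear f -> bilin (fun u v => f (B u v)).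
Proof. by move=> bB lf; split=> z k x y; rewrite ?(bilinl bB) ?(bilinr bB) lf. Qed.

Lemma bilin_big U V W (J : Type) (r : seq J) (P : pred J) (B : J -> U -> V -> W) :
  (forall j, bilin (B j)) -> bilin (fun u v => \sum_(j <- r | P j) B j u v).
Proof.
move=> bB; split=> z; apply: linear_big => j; last exact: bilinl.
exact: bilinr.
Qed.

Lemma tlift_linear U V W (B : U -> V -> W) : linear (tlift B).
Proof.
move=> k s t; rewrite /tlift scaler_sumr -big_split; apply: eq_bigr => i _.
rewrite scaler_sumr -big_split; apply: eq_bigr => j _ /=.
by rewrite !mxE scalerDl scalerA.
Qed.

Lemma linear_tlift U V W W' (f : W -> W') (B : U -> V -> W) t : linear f ->
  f (tlift B t) = tlift (fun u v => f (B u v)) t.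
Proof.
move=> lf; rewrite /tlift (lin_sum lf); apply: eq_bigr => i _.
exact: (lin_sumZ lf).
Qed.

Lemma coord_vbasis_nth V (i j : 'I_(\dim {:V})) :
  coord (vbasis {:V}) i (vbasis {:V})`_j = (j == i)%:R.
Proof. by rewrite coord_free ?(basis_free (vbasisP _)). Qed.

(** Pure tensors span: this is the uniqueness half of the universal property of [tprod]. *)
Lemma tlift_tpure U V (t : tprod U V) : tlift (@tpure K U V) t = t.
Proof.
apply/matrixP=> i j; rewrite /tlift summxE (bigD1 i) //= summxE (bigD1 j) //=.
rewrite !mxE !coord_vbasis_nth !eqxx !mulr1 !big1 ?addr0 // => l nl.
  rewrite summxE big1 // => m _; rewrite !mxE !coord_vbasis_nth.
  by rewrite (negPf nl) mul0r mulr0.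
by rewrite !mxE !coord_vbasis_nth (negPf nl) !mulr0.
Qed.

Lemma tprod_ext U V W (f g : tprod U V -> W) : linear f -> linear g ->
  (forall u v, f (u ⨂ v) = g (u ⨂ v)) -> forall t, f t = g t.
Proof.
move=> lf lg fg t; rewrite -(tlift_tpure t) (linear_tlift _ _ lf).
rewrite (linear_tlift _ _ lg) /tlift; apply: eq_bigr => i _.
by apply: eq_bigr => j _; rewrite fg.
Qed.

Lemma tlift_param_linear U V W X (B : U -> V -> X -> W) s :
  (forall u v, linear (B u v)) -> linear (fun x => tlift (fun u v => B u v x) s).
Proof.
move=> lB; apply: linear_big => i; apply: linear_big => j.
exact: linear_scaler.
Qed.

Lemma tlift_bilin U V W X Y (B : U -> V -> X -> Y -> W) s :
  (forall u v, bilin (B u v)) ->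
  bilin (fun x y => tlift (fun u v => B u v x y) s).
Proof.
move=> bB; split=> z; apply: tlift_param_linear => u v; first exact: bilinr.
exact: (bilinl (bB u v)).
Qed.

Lemma bilin_tlift U V W X Y (B : U -> V -> X -> Y -> W) t :
  (forall x y, bilin (fun u v => B u v x y)) ->
  bilin (fun u v => tlift (B u v) t).
Proof. move=> bB; exact: (@tlift_bilin _ _ _ _ _ (fun x y u v => B u v x y)). Qed.

Lemma tlift_sum U V W (B : U -> V -> W) (J : Type) (r : seq J) (P : pred J) f g :
  bilin B -> tlift B (\sum_(j <- r | P j) f j ⨂ g j) =
  \sum_(j <- r | P j) B (f j) (g j).
Proof.
move=> bB; rewrite (lin_sum (tlift_linear B)); apply: eq_bigr => j _.
exact: tlift_pure.
Qed.

Lemma tmul_pure U V mulU mulV u u' v v' : bilin mulU -> bilin mulV ->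
  tmul mulU mulV (u ⨂ v) (u' ⨂ v') = mulU u u' ⨂ mulV v v' :> tprod U V.
Proof.
move=> bU bV; rewrite /tmul tlift_pure.
  rewrite tlift_pure //.
  exact: bilin_comp (tpure_bilin U V) (bilinr bU _) (bilinr bV _).
apply: bilin_tlift => x y.
exact: bilin_comp (tpure_bilin U V) (bilinl bU _) (bilinl bV _).
Qed.

Lemma tmul_bilin U V mulU mulV : bilin (@tmul K U V mulU mulV).
Proof.
split=> z; last exact: tlift_linear.
by apply: tlift_param_linear => u v; apply: tlift_linear.
Qed.

Lemma tassoc_pure U V W (u : U) (v : V) (w : W) :
  tassoc (u ⨂ (v ⨂ w)) = (u ⨂ v) ⨂ w.
Proof.
rewrite /tassoc tlift_pure.
  rewrite tlift_pure //.
  exact: bilin_comp (tpure_bilin _ _) (bilinr (tpure_bilin _ _) _) (@linear_id _).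
split=> z; first exact: tlift_linear.
apply: tlift_param_linear => x y.
exact: linear_comp (bilinl (tpure_bilin _ _) y) (bilinl (tpure_bilin _ _) x).
Qed.

Lemma tassoc_linear U V W : linear (@tassoc K U V W).
Proof. exact: tlift_linear. Qed.

Lemma dsum_inj_linear (J : finType) (V : J -> vectType K) (j : J) :
  linear (@dsum_inj K J V j).
Proof.
move=> k u v; apply/ffunP=> i; rewrite !ffunE.
case: dfwithP => [|i' ne]; first by rewrite !dfwith_in.
by rewrite !dfwith_out // scaler0 addr0.
Qed.

Lemma dsum_decomp (J : finType) (V : J -> vectType K) (x : dsum V) :
  x = \sum_j dsum_inj (x j).
Proof.
apply/ffunP=> i; rewrite (bigD1 i) //= ffunE ffunE dfwith_in.
have -> : (\sum_(j | j != i) dsum_inj (x j)) i = 0 :> V i.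
  elim/big_rec: _ => [|j y ji IH]; rewrite ffunE // IH addr0 ffunE.
  by rewrite dfwith_out.
by rewrite addr0.
Qed.

Lemma bilin_swap U V W (B : U -> V -> W) :
  bilin B -> bilin (fun v u => B u v).
Proof. by case. Qed.

Lemma scale_bilin U V (F : U -> K) :
  scalar F -> bilin (fun (u : U) (v : V) => F u *: v).
Proof.
move=> lF; split=> z k x y; first by rewrite scalerDr !scalerA mulrC.
by rewrite lF scalerDl scalerA.
Qed.

Lemma scalar_mul_bilin U V (F : U -> K) (G : V -> K) :
  scalar F -> scalar G -> bilin (fun u v => F u * G v : K^o).
Proof.
move=> lF lG; split=> z k u v.
  by rewrite lG mulrDr mulrCA.
by rewrite lF mulrDl -mulrA.
Qed.

End LinearMaps.

(** * Dual bases in a semisimple category *)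

Section Semisimplicity.
Variables (R : realType) (D : UMFC R).
Local Notation C := R[i].
Local Notation I := (Irr D).
Implicit Types (x y z : D) (k s : I).

Lemma idl x y (f : hom x y) : idm y ∘ f = f.
Proof. exact: comp_idl (umfc_cstar D) _ _ f. Qed.

Lemma idr x y (f : hom x y) : f ∘ idm x = f.
Proof. exact: comp_idr (umfc_cstar D) _ _ f. Qed.

Lemma compoA x y z t (h : @hom R D z t) (g : hom y z) (f : hom x y) :
  h ∘ (g ∘ f) = h ∘ g ∘ f.
Proof. exact: compA (umfc_cstar D) _ _ _ _ h g f. Qed.

Lemma comp_bil x y z : bilin (@comp R D x y z).
Proof. exact: comp_bilin (umfc_cstar D) x y z. Qed.

Lemma dag_dag x y (f : @hom R D x y) : f^†^† = f.
Proof. exact: dagK (umfc_cstar D) _ _ f. Qed.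

Lemma dagM x y z (g : @hom R D y z) (f : hom x y) : (g ∘ f)^† = f^† ∘ g^†.
Proof. exact: dag_comp (umfc_cstar D) _ _ _ g f. Qed.

Lemma compZl x y z c (g : @hom R D y z) (f : hom x y) :
  (c *: g) ∘ f = c *: (g ∘ f).
Proof. exact: lin_scale (bilinl (comp_bil x y z) f) c g. Qed.

Lemma compZr x y z c (g : @hom R D y z) (f : hom x y) :
  g ∘ (c *: f) = c *: (g ∘ f).
Proof. exact: lin_scale (bilinr (comp_bil x y z) g) c f. Qed.

Lemma comp0l x y z (f : @hom R D x y) : (0 : hom y z) ∘ f = 0.
Proof. exact: lin_zero (bilinl (comp_bil x y z) f). Qed.

Lemma comp0r x y z (g : @hom R D y z) : g ∘ (0 : hom x y) = 0.
Proof. exact: lin_zero (bilinr (comp_bil x y z) g). Qed.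

Lemma comp_suml x y z (J : Type) (r : seq J) (P : pred J)
    (g : J -> @hom R D y z) (f : hom x y) :
  (\sum_(j <- r | P j) g j) ∘ f = \sum_(j <- r | P j) g j ∘ f.
Proof. by rewrite (lin_sum (bilinl (comp_bil x y z) f)). Qed.

Lemma comp_sumr x y z (J : Type) (r : seq J) (P : pred J)
    (g : @hom R D y z) (f : J -> hom x y) :
  g ∘ (\sum_(j <- r | P j) f j) = \sum_(j <- r | P j) g ∘ f j.
Proof. by rewrite (lin_sum (bilinr (comp_bil x y z) g)). Qed.

Lemma compBl x y z (g g' : @hom R D y z) (f : hom x y) :
  (g - g') ∘ f = g ∘ f - g' ∘ f.
Proof.
rewrite -scaleN1r addrC (bilinl (comp_bil x y z) f) scaleN1r addrC.
by [].
Qed.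

Lemma dagD x y (f g : @hom R D x y) : (f + g)^† = f^† + g^†.
Proof.
have := dag_antilinear (umfc_cstar D) 1 f g.
by rewrite conjc1 !scale1r.
Qed.

Lemma dag0 x y : (0 : @hom R D x y)^† = 0.
Proof.
apply: (@addrI _ ((0 : hom x y)^†)); rewrite -dagD !addr0.
by [].
Qed.

Lemma dagZ x y c (f : @hom R D x y) : (c *: f)^† = conjc c *: f^†.
Proof.
have := dag_antilinear (umfc_cstar D) c f 0.
by rewrite addr0 dag0 addr0.
Qed.

Lemma dag_sum x y (J : Type) (r : seq J) (P : pred J) (f : J -> @hom R D x y) :
  (\sum_(j <- r | P j) f j)^† = \sum_(j <- r | P j) (f j)^†.
Proof. by apply: (big_morph (@dag R D x y)) => [g h|]; [exact: dagD|exact: dag0]. Qed.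

Lemma dag_idm x : (idm x)^† = idm x :> @hom R D x x.
Proof. by rewrite -[LHS]idr -{2}[idm x]dag_dag -dagM idr dag_dag. Qed.

Lemma dag_comp_eq0 x y (f : @hom R D x y) : f^† ∘ f = 0 -> f = 0.
Proof. exact: dag_definite (umfc_cstar D) _ _ f. Qed.

Lemma simple_neq0 x : simple x -> idm x != 0 :> @hom R D x x.
Proof.
rewrite /simple => dx; apply/eqP=> id0.
suff: ({: @hom R D x x} <= 0)%VS by move/dimvS; rewrite dx dimv0.
by apply/subvP=> f _; rewrite memv0 -[f]idr id0 comp0r.
Qed.

Lemma simple_idm x (f : @hom R D x x) : simple x -> exists c, f = c *: idm x.
Proof.
move=> sx.
have: (<[idm x]> == {: @hom R D x x})%VS.
  by rewrite eqEdim subvf sx dim_vline simple_neq0.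
move/eqP=> E; have: f \in <[idm x]>%VS by rewrite E memvf.
by case/vlineP=> c ->; exists c.
Qed.

Lemma irrS k : simple (@irr R D k).
Proof. exact: umfc_irr_simple. Qed.

Lemma irr_scalarE k (f : hom (@irr R D k) (irr k)) : f = irr_scalar f *: idm (irr k).
Proof.
have [c ->] := simple_idm f (irrS k).
have fr : free [tuple @idm R D (irr k)].
  by rewrite seq1_free simple_neq0 //; apply: irrS.
by rewrite /irr_scalar linearZ /= -[idm _]/([tuple idm (irr k)]`_(@ord0 0))
   coord_free //= mulr1.
Qed.

Lemma irr_scalar_compE k x (v : hom (irr k) x) (w : @hom R D x (irr k)) :
  w ∘ v = irr_scalar (w ∘ v) *: idm (irr k).
Proof. exact: irr_scalarE. Qed.

Lemma irr_scalar_id k : irr_scalar (@idm R D (irr k)) = 1.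
Proof.
have:= irr_scalarE (idm (irr k)); rewrite -{1}[idm _]scale1r => /eqP.
rewrite -subr_eq0 -scalerBl scaler_eq0 (negPf (simple_neq0 (irrS k))) orbF.
by rewrite subr_eq0 => /eqP.
Qed.

Lemma irr_scalar_linear k : scalar (@irr_scalar R D k).
Proof. by move=> c f g; rewrite /irr_scalar linearP. Qed.

Lemma irr_scalarZ k c (f : hom (@irr R D k) (irr k)) :
  irr_scalar (c *: f) = c * irr_scalar f.
Proof. by rewrite /irr_scalar linearZ. Qed.

Lemma irr_scalarZ_id k c : irr_scalar (c *: @idm R D (irr k)) = c.
Proof. by rewrite irr_scalarZ irr_scalar_id mulr1. Qed.

Lemma irr_scalar0 k : irr_scalar (0 : hom (@irr R D k) (irr k)) = 0.
Proof. by rewrite /irr_scalar linear0. Qed.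

(** Both [f^† ∘ f] and [f ∘ f^†] are scalars. If [f] is nonzero, definiteness makes the first one
    nonzero, and computing [f ∘ f^† ∘ f] in two ways makes them equal. Then [f] is invertible, and
    uniqueness of representatives forces [k = s]. *)
Lemma schur k s (f : hom (@irr R D k) (irr s)) : k != s -> f = 0.
Proof.
apply: contraNeq => f0.
have iE := irr_scalarE (f^† ∘ f); have jE := irr_scalarE (f ∘ f^†).
have l0 : irr_scalar (f^† ∘ f) != 0.
  apply: contra_neq f0 => l0; apply: dag_comp_eq0.
  by rewrite iE l0 scale0r.
have lE : irr_scalar (f^† ∘ f) = irr_scalar (f ∘ f^†).
  apply/eqP; rewrite -subr_eq0; apply: contraNT f0 => nz.
  have fffE : irr_scalar (f^† ∘ f) *: f = irr_scalar (f ∘ f^†) *: f.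
    rewrite -[LHS]idr compZl -compZr -iE compoA {1}jE.
    by rewrite compZl idl.
  have /eqP: (irr_scalar (f^† ∘ f) - irr_scalar (f ∘ f^†)) *: f = 0.
    by rewrite scalerBl fffE subrr.
  by rewrite scaler_eq0 (negPf nz).
have [t [_ tU]] := umfc_irr_repr (irrS k).
have <- : t = k by apply: tU; exists (idm _), (idm _); rewrite idl.
apply/eqP; apply: tU; exists f, ((irr_scalar (f^† ∘ f))^-1 *: f^†).
rewrite compZl compZr iE jE -lE !scalerA irr_scalarZ_id mulVf // !scale1r.
by [].
Qed.

Lemma irr_delta_id k : irr_delta k k = idm (@irr R D k).
Proof. by rewrite /irr_delta; case: eqP => // E; rewrite eq_axiomK. Qed.

Lemma irr_delta_neq k s : k != s -> irr_delta k s = 0 :> hom (@irr R D k) (irr s).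
Proof. by move=> ks; apply: schur. Qed.

Local Notation n_ k A := (\dim (fullv : {vspace hom (@irr R D k) A})).

Lemma bvec_coord k x (v : hom (irr k) x) :
  v = \sum_p coord (irr_basis k x) p v *: bvec p.
Proof.
rewrite {1}(coord_vbasis (memvf v)); apply: eq_bigr => p _.
by rewrite /bvec (tnth_nth 0).
Qed.

(* The Gram matrix of a basis is invertible, because v^† v = 0 forces v = 0.  *)
Lemma dual_basis_exists k x : exists g : 'I_(n_ k x) -> hom x (irr k),
  forall p q, g p ∘ bvec q = (p == q)%:R *: idm (irr k).
Proof.
pose G := \matrix_(p, q < n_ k x) irr_scalar ((bvec p)^† ∘ bvec q).
have Gfree : row_free G^T.
  apply/inj_row_free=> u; move/rowP=> uG.
  pose v : hom (irr k) x := \sum_p u ord0 p *: bvec p.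
  have vp (p : 'I_(n_ k x)) : (bvec p)^† ∘ v = 0.
    rewrite /v comp_sumr; under eq_bigr do rewrite compZr irr_scalar_compE scalerA.
    rewrite -scaler_suml -[RHS](scale0r (idm (irr k))); congr (_ *: _).
    have E := uG p; rewrite !mxE in E; rewrite -[RHS]E.
    by apply: eq_bigr => q _; rewrite !mxE.
  have v0 : v = 0.
    apply: dag_comp_eq0; rewrite {1}/v dag_sum comp_suml big1 // => p _.
    by rewrite dagZ compZl vp scaler0.
  have /freeP fr := basis_free (vbasisP {: @hom R D (irr k) x}).
  apply/rowP=> p; rewrite mxE; apply: (fr (fun q => u ord0 q)).
  rewrite -[RHS]v0; apply: eq_bigr => q _; rewrite /bvec (tnth_nth 0).
  by [].
have Gu : G \in unitmx by rewrite -unitmx_tr -row_free_unit.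
exists (fun p => \sum_r (invmx G) p r *: (bvec r)^†) => p q.
rewrite comp_suml; under eq_bigr do rewrite compZl irr_scalar_compE scalerA.
rewrite -scaler_suml; congr (_ *: _).
have /matrixP/(_ p q) := mulVmx Gu; rewrite !mxE => <-.
by apply: eq_bigr => r _; rewrite !mxE.
Qed.

(** The adjoint of [g] lies in the span of the basis that [g] kills, so [g ∘ g^†] vanishes and
    definiteness applies. *)
Lemma hom_irr_eq0 k x (g : hom x (irr k)) :
  (forall p : 'I_(n_ k x), g ∘ bvec p = 0) -> g = 0.
Proof.
move=> gp; rewrite -[g]dag_dag; suff -> : g^† = 0 by rewrite dag0.
apply: dag_comp_eq0; rewrite dag_dag [X in _ ∘ X]bvec_coord comp_sumr big1 // => p _.
by rewrite compZr gp scaler0.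
Qed.

(** [bdual] is picked by [xget] with default 0; the existence of a dual basis excludes the
    default. *)
Lemma bdual_bvec k x p q :
  bdual p ∘ @bvec R D k x q = (p == q)%:R *: idm (irr k).
Proof.
have [g gP] := dual_basis_exists k x.
rewrite /bdual; case: xgetP => [h -> //|/(_ (g p))[]].
exact: gP.
Qed.

Lemma bvec_expand k x (v : hom (irr k) x) :
  v = \sum_p irr_scalar (bdual p ∘ v) *: bvec p.
Proof.
rewrite {1}[v]bvec_coord; apply: eq_bigr => p _; congr (_ *: _).
rewrite {2}[v]bvec_coord comp_sumr.
under eq_bigr do rewrite compZr bdual_bvec scalerA.
rewrite -scaler_suml irr_scalarZ_id (bigD1 p) //= eqxx mulr1 big1 ?addr0 // => q.
by rewrite eq_sym => /negPf ->; rewrite mulr0.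
Qed.

Lemma bdual_expand k x (w : hom x (irr k)) :
  w = \sum_p irr_scalar (w ∘ bvec p) *: bdual p.
Proof.
apply/eqP; rewrite -subr_eq0; apply/eqP/hom_irr_eq0 => p.
rewrite compBl comp_suml (bigD1 p) //= compZl bdual_bvec eqxx scale1r.
rewrite -irr_scalarE big1 ?addr0 ?subrr // => q /negPf qp.
by rewrite compZl bdual_bvec qp scale0r scaler0.
Qed.

(** A decomposition of [x] into simples is transported to the chosen representatives, so morphisms
    are tested on maps out of some [irr k]. *)
Lemma semisimple_eq0 x y (f : hom x y) :
  (forall k (v : hom (irr k) x), f ∘ v = 0) -> f = 0.
Proof.
move=> fv; have [n [s [u [p [sS [_ _ up]]]]]] := umfc_semisimple x.
rewrite -[f]idr -up comp_sumr big1 // => j _.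
have [a [[g [h [hg _]]] _]] := umfc_irr_repr (sS j).
by rewrite compoA -[u j]idr -hg (compoA (u j)) (compoA f) fv comp0l comp0l.
Qed.

Lemma irr_decomp x : \sum_k \sum_(p < n_ k x) bvec p ∘ bdual p = idm x.
Proof.
apply/eqP; rewrite eq_sym -subr_eq0; apply/eqP/semisimple_eq0 => k v.
rewrite compBl idl comp_suml (bigD1 k) //= [X in _ - (_ + X)]big1 ?addr0.
  rewrite {1}[v]bvec_expand comp_suml; apply/eqP; rewrite subr_eq0; apply/eqP.
  apply: eq_bigr => p _; rewrite -compoA [bdual p ∘ v]irr_scalarE.
  by rewrite compZr idr irr_scalarZ_id.
move=> s sk; rewrite comp_suml big1 // => p _.
by rewrite -compoA [bdual p ∘ v]schur ?comp0r // eq_sym.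
Qed.

(* [\sum_p v_p (x) w_p] is the canonical element of the pairing of Hom(k, x)  *)
(* with Hom(x, k).                                                            *)
Lemma dual_bases_nat (W : vectType C) k x y (g : hom x y)
    (B : hom (irr k) y -> hom x (irr k) -> W) : bilin B ->
  \sum_(p < n_ k x) B (g ∘ bvec p) (bdual p) =
  \sum_(q < n_ k y) B (bvec q) (bdual q ∘ g).
Proof.
move=> bB.
under eq_bigr do rewrite [g ∘ _]bvec_expand (lin_sumZ (bilinl bB _)) /=.
rewrite exchange_big; apply: eq_bigr => q _ /=.
rewrite [X in B _ X]bdual_expand (lin_sumZ (bilinr bB _)).
by apply: eq_bigr => p _; rewrite compoA.
Qed.

End Semisimplicity.

(** * Coherence by strictification *)

Section Strictification.
Variables (R : realType) (D : UMFC R).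
Implicit Types (a b n x y z : D).
Local Notation "1" := (unit_ob D).

Let MD := umfc_monoidal D.

Lemma tens_bil x x' y y' : bilin (@tensm R D x x' y y').
Proof. exact: tensm_bilin MD x x' y y'. Qed.

Lemma tensM x x' x'' y y' y'' (f' : @hom R D x' x'') (f : hom x x')
    (g' : @hom R D y' y'') (g : hom y y') :
  (f' ⊠ g') ∘ (f ⊠ g) = (f' ∘ f) ⊠ (g' ∘ g).
Proof. by rewrite (tensm_comp MD). Qed.

Lemma tens_idm x y : idm x ⊠ idm y = idm (x ⊗ y) :> @hom R D _ _.
Proof. exact: tensm_id MD x y. Qed.

Lemma dag_tens x x' y y' (f : @hom R D x x') (g : hom y y') :
  (f ⊠ g)^† = f^† ⊠ g^†.
Proof. exact: tensm_dag MD _ _ _ _ f g. Qed.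

Lemma unitaryM x y z (g : @hom R D y z) (f : hom x y) :
  unitary g -> unitary f -> unitary (g ∘ f).
Proof.
move=> [gg gg'] [ff ff']; split; rewrite dagM -compoA.
  by rewrite (compoA _ g) gg idl.
by rewrite (compoA f) ff' idl.
Qed.

Lemma unitary_idm x : unitary (@idm R D x).
Proof. by split; rewrite dag_idm idl. Qed.

Lemma unitary_tens x x' y y' (f : @hom R D x x') (g : hom y y') :
  unitary f -> unitary g -> unitary (f ⊠ g).
Proof.
by move=> [ff ff'] [gg gg']; split; rewrite dag_tens tensM ?ff ?gg ?ff' ?gg' tens_idm.
Qed.

Lemma unitary_dag x y (f : @hom R D x y) : unitary f -> unitary f^†.
Proof. by case=> ff ff'; split; rewrite dag_dag. Qed.

Lemma unitary_epi x y z (u : @hom R D x y) (f g : hom y z) :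
  unitary u -> f ∘ u = g ∘ u -> f = g.
Proof. by case=> _ uu E; rewrite -[f]idr -[g]idr -uu !compoA E. Qed.

Lemma unitary_mono x y z (u : @hom R D y z) (f g : hom x y) :
  unitary u -> u ∘ f = u ∘ g -> f = g.
Proof. by case=> uu _ E; rewrite -[f]idl -[g]idl -uu -!compoA E. Qed.

Lemma assocU x y z : unitary (@assoc R D x y z).
Proof. exact: assoc_unitary MD x y z. Qed.

Lemma lunitU x : unitary (@lunit R D x).
Proof. exact: lunit_unitary MD x. Qed.

Lemma runitU x : unitary (@runit R D x).
Proof. exact: runit_unitary MD x. Qed.

Lemma assocN x x' y y' z z' (f : @hom R D x x') (g : hom y y') (h : hom z z') :
  assoc x' y' z' ∘ (f ⊠ g ⊠ h) = (f ⊠ (g ⊠ h)) ∘ assoc x y z.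
Proof. exact: assoc_nat MD _ _ _ _ _ _ f g h. Qed.

Lemma idm_tens_inj x y (f g : @hom R D x y) : idm 1 ⊠ f = idm 1 ⊠ g -> f = g.
Proof.
move=> E; apply: (unitary_epi (lunitU x)).
by rewrite -!(lunit_nat MD) E.
Qed.

Lemma tens_idm_inj x y (f g : @hom R D x y) : f ⊠ idm 1 = g ⊠ idm 1 -> f = g.
Proof.
move=> E; apply: (unitary_epi (runitU x)).
by rewrite -!(runit_nat MD) E.
Qed.

(** Kelly's argument: this unit law follows from the pentagon and the triangle. Both sides are
    tensored with the unit object on the left, which is faithful, and the associators are
    cancelled. *)
Lemma lunit_tens x y :
  lunit (x ⊗ y) ∘ assoc 1 x y = lunit x ⊠ idm y :> @hom R D _ _.
Proof.
apply: idm_tens_inj; apply: (unitary_epi (assocU 1 (1 ⊗ x) y)).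
apply: (unitary_epi (unitary_tens (assocU 1 1 x) (unitary_idm y))).
rewrite -assocN -[RHS]compoA tensM (triangle MD) idl assocN tens_idm.
rewrite -(triangle MD) -[RHS]compoA (pentagon MD) !compoA.
by rewrite tensM idl.
Qed.

Lemma compKU x y z (u : @hom R D y z) (f : hom x y) :
  unitary u -> u^† ∘ (u ∘ f) = f.
Proof. by case=> uu _; rewrite compoA uu idl. Qed.

Lemma compUK x y z (u : @hom R D y z) (f : hom z x) :
  unitary u -> f ∘ u ∘ u^† = f.
Proof. by case=> _ uu; rewrite -compoA uu idr. Qed.

Lemma compKV x y z (u : @hom R D y z) (f : hom y x) :
  unitary u -> f ∘ u^† ∘ u = f.
Proof. by case=> uu _; rewrite -compoA uu idr. Qed.

(* Objects are represented by endofunctors of [D], so that the composition of *)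
(* representatives is strictly associative: [sN] is the action on objects of  *)
(* a functor isomorphic to [so (x) -] through [siso].                         *)
Record sob := Sob {
  so : D;
  sN : D -> D;
  siso : forall n, hom (so ⊗ n) (sN n);
  sisoU : forall n, unitary (siso n) }.

Implicit Types X Y Z : sob.

Fact str_key : unit. Proof. exact: tt. Qed.

(* Locked, as otherwise rewriting unfolds them to expose compositions. *)
Definition sF X n n' (f : hom n n') : hom (sN X n) (sN X n') :=
  locked_with str_key (siso X n' ∘ (idm (so X) ⊠ f) ∘ (siso X n)^†).

Definition str X Y (f : hom (so X) (so Y)) n : hom (sN X n) (sN Y n) :=
  locked_with str_key (siso Y n ∘ (f ⊠ idm n) ∘ (siso X n)^†).

Lemma sF_def X n n' (f : hom n n') :
  sF X f = siso X n' ∘ (idm (so X) ⊠ f) ∘ (siso X n)^†.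
Proof. by rewrite /sF unlock. Qed.

Lemma str_def X Y (f : hom (so X) (so Y)) n :
  str f n = siso Y n ∘ (f ⊠ idm n) ∘ (siso X n)^†.
Proof. by rewrite /str unlock. Qed.

(** With [sunit] and [stens], unification reads off the functor of an object from its expression: a
    tensor product acts by composition, the unit by the identity functor, and any other object is a
    leaf acting by tensoring. *)
Canonical sleaf a := Sob (fun n => unitary_idm (a ⊗ n)).
Canonical sunit := @Sob 1 _ _ lunitU.

Definition stens_iso X Y n :
    hom (so X ⊗ so Y ⊗ n) (sN X (sN Y n)) :=
  siso X (sN Y n) ∘ (idm (so X) ⊠ siso Y n) ∘ assoc (so X) (so Y) n.

Fact stens_isoU X Y n : unitary (stens_iso X Y n).
Proof.
apply/unitaryM; last exact: assocU.
by apply/unitaryM; [exact: sisoU|apply/unitary_tens; [exact: unitary_idm|exact: sisoU]].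
Qed.

Canonical stens X Y := @Sob (so X ⊗ so Y) _ _ (stens_isoU X Y).

Lemma sF_id X n : sF X (idm n) = idm (sN X n).
Proof. by rewrite sF_def tens_idm idr; case: (sisoU X n). Qed.

Lemma sF_comp X n n' n'' (g : hom n' n'') (f : hom n n') :
  sF X (g ∘ f) = sF X g ∘ sF X f.
Proof.
rewrite !sF_def !compoA compKV; last exact: sisoU.
by rewrite -[_ ∘ (idm _ ⊠ g) ∘ _]compoA tensM idl.
Qed.

Lemma sF_dag X n n' (f : hom n n') : sF X f^† = (sF X f)^†.
Proof. by rewrite !sF_def !dagM dag_dag dag_tens dag_idm compoA. Qed.

Lemma str_id X n : str (idm (so X)) n = idm (sN X n).
Proof. by rewrite !str_def tens_idm idr; case: (sisoU X n). Qed.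

Lemma str_comp X Y Z (g : hom (so Y) (so Z)) (f : hom (so X) (so Y)) n :
  str (g ∘ f) n = str g n ∘ str f n.
Proof.
rewrite !str_def !compoA compKV; last exact: sisoU.
by rewrite -[_ ∘ (g ⊠ _) ∘ _]compoA tensM idl.
Qed.

Lemma str_dag X Y (f : hom (so X) (so Y)) n : str f^† n = (str f n)^†.
Proof. by rewrite !str_def !dagM dag_dag dag_tens dag_idm compoA. Qed.

Lemma str_nat X Y (f : hom (so X) (so Y)) n n' (g : hom n n') :
  str f n' ∘ sF X g = sF Y g ∘ str f n.
Proof.
rewrite !str_def !sF_def !compoA !compKV; try exact: sisoU.
by rewrite -[_ ∘ (f ⊠ _) ∘ _]compoA -[_ ∘ _ ∘ (f ⊠ _)]compoA !tensM !idl !idr.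
Qed.

Lemma sF_unit n n' (f : hom n n') : sF sunit f = f.
Proof.
rewrite sF_def /= (lunit_nat MD); apply: (compUK f); exact: lunitU.
Qed.

Lemma sF_tens X Y n n' (f : hom n n') : sF (stens X Y) f = sF X (sF Y f).
Proof.
rewrite sF_def /= /stens_iso !dagM !compoA -tens_idm.
rewrite -[_ ∘ assoc _ _ _ ∘ _]compoA assocN compoA.
rewrite compUK; last exact: assocU.
rewrite dag_tens dag_idm -[_ ∘ _ ∘ (idm _ ⊠ (idm _ ⊠ f))]compoA tensM.
by rewrite -[_ ∘ _ ∘ (idm _ ⊠ (siso Y n)^†)]compoA tensM !idl !sF_def.
Qed.

Lemma str_tens X X' Y Y' (f : hom (so X) (so X')) (g : hom (so Y) (so Y')) n :
  @str (stens X Y) (stens X' Y') (f ⊠ g) n = str f (sN Y' n) ∘ sF X (str g n).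
Proof.
rewrite str_def /= /stens_iso !dagM !compoA.
rewrite -[_ ∘ assoc _ _ _ ∘ _]compoA assocN compoA.
rewrite compUK; last exact: assocU.
rewrite dag_tens dag_idm -[_ ∘ _ ∘ (f ⊠ _)]compoA tensM.
rewrite -[_ ∘ _ ∘ (idm _ ⊠ (siso Y n)^†)]compoA tensM idl.
rewrite -(str_def g n) [str f _]str_def sF_def !compoA compKV; last exact: sisoU.
by rewrite -[_ ∘ (f ⊠ _) ∘ _]compoA tensM !idl !idr.
Qed.

Lemma str_siso X Y (f : hom (so X) (so Y)) n (g : hom (sN X n) (sN Y n)) :
  siso Y n ∘ (f ⊠ idm n) = g ∘ siso X n -> str f n = g.
Proof. by rewrite !str_def => ->; apply: compUK; apply: sisoU. Qed.

(** Both bracketings act by the same composite functor, so the identity is well typed here; that the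
    associator acts by it is the pentagon. *)
Lemma str_assoc X Y Z n :
  @str (stens (stens X Y) Z) (stens X (stens Y Z)) (assoc (so X) (so Y) (so Z)) n =
  idm (sN X (sN Y (sN Z n))).
Proof.
apply: str_siso; rewrite idl /= /stens_iso /=.
rewrite [stens_iso Y Z _]/stens_iso [stens_iso X Y _]/stens_iso.
rewrite -tens_idm -[in RHS](compoA _ (assoc _ _ _)) assocN !compoA.
have whisk a x y z (f : @hom R D y z) (g : hom x y) :
  idm a ⊠ (f ∘ g) = (idm a ⊠ f) ∘ (idm a ⊠ g) by rewrite tensM idl.
rewrite !whisk -!compoA; congr (_ ∘ (_ ∘ (_ ∘ _))).
by rewrite (pentagon MD) !compoA.
Qed.

Lemma str_lunit X n : @str (stens sunit X) X (lunit (so X)) n = idm (sN X n).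
Proof.
apply: str_siso; rewrite idl /= /stens_iso /= (lunit_nat MD) -compoA.
by rewrite lunit_tens.
Qed.

Lemma str_runit X n : @str (stens X sunit) X (runit (so X)) n = idm (sN X n).
Proof.
apply: str_siso; rewrite idl /= /stens_iso /= -compoA.
by rewrite (triangle MD).
Qed.

(** Strictification is faithful: at the unit object, [str f] is [f ⊠ idm 1] up to unitaries. *)
Lemma str_inj X Y (f g : hom (so X) (so Y)) :
  (forall n, str f n = str g n) -> f = g.
Proof.
move=> fg; apply: tens_idm_inj; have := fg 1.
rewrite !str_def => /(unitary_epi (unitary_dag (sisoU _ _))).
exact: (unitary_mono (sisoU _ _)).
Qed.

End Strictification.

(** * Coherence of the two-sided action of a pair of arcs *)

Section Coherence.
Variables (R : realType) (D : UMFC R).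
Implicit Types (a b e x y z n : D).
Local Notation "1" := (unit_ob D).

(** [strE] pushes [str] through a diagram and turns the associators and unitors into identities;
    [simplE] erases these and flattens whiskering by tensor products. Pure coherence statements are
    closed by the two. *)
Definition strE := (@str_comp R D, @str_tens R D, @str_dag R D, @str_assoc R D,
  @str_lunit R D, @str_runit R D, @str_id R D).
Definition simplE := (@sF_id R D, @sF_tens R D, @sF_unit R D, @dag_idm R D,
  @idl R D, @idr R D).

Lemma rebracketU a a' e b' b : unitary (@rebracket R D a a' e b' b).
Proof.
by do 2?apply: unitaryM; try apply: unitary_tens;
  try apply: unitary_dag; rewrite /=; first [exact: assocU | exact: unitary_idm].
Qed.

Lemma rebracket_nat a a1 a' a1' e e1 b' b1' b b1 (f : @hom R D a a1)
    (f' : hom a' a1') (g : hom e e1) (h' : hom b' b1') (h : hom b b1) :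
  rebracket a1 a1' e1 b1' b1 ∘ (f ⊠ (f' ⊠ g ⊠ h') ⊠ h) =
  (f ⊠ f' ⊠ g ⊠ (h' ⊠ h)) ∘ rebracket a a' e b' b.
Proof.
apply: str_inj => n; rewrite !strE /= !simplE.
by rewrite !sF_comp ?simplE !compoA.
Qed.

Lemma rebracketA a a' a'' e b'' b' b :
  (assoc a a' a'' ⊠ idm e ⊠ (assoc b'' b' b)^†) ∘
    rebracket (a ⊗ a') a'' e b'' (b' ⊗ b) ∘ rebracket a a' (a'' ⊗ e ⊗ b'') b' b =
  rebracket a (a' ⊗ a'') e (b'' ⊗ b') b ∘
    (idm a ⊠ rebracket a' a'' e b'' b' ⊠ idm b) :> @hom R D _ _.
Proof.
by apply: str_inj => n; rewrite !strE /= !simplE.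
Qed.

Lemma unit_in_rebracket a e b :
  (lunit a ⊠ idm e ⊠ runit b) ∘ rebracket 1 a e b 1 ∘ unit_in (a ⊗ e ⊗ b) =
  idm (a ⊗ e ⊗ b) :> @hom R D _ _.
Proof.
by apply: str_inj => n; rewrite /unit_in !strE /= !simplE.
Qed.

Lemma rebracket_unit_in a e b :
  (runit a ⊠ idm e ⊠ lunit b) ∘ rebracket a 1 e 1 b ∘
    (idm a ⊠ unit_in e ⊠ idm b) = idm (a ⊗ e ⊗ b) :> @hom R D _ _.
Proof.
by apply: str_inj => n; rewrite /unit_in !strE /= !simplE.
Qed.

End Coherence.

(** * Duality and traces *)

Section Duality.
Variables (R : realType) (D : UMFC R).
Implicit Types (a b e x y z n : D).
Local Notation "1" := (unit_ob D).

Lemma str_zigzag (a : sob D) n :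
  sF a (str (ev (so a)) n) ∘ str (coev (so a)) (sN a n) = idm (sN a n).
Proof.
have := congr1 (fun f => @str R D a a f n) (umfc_zigzag (so a)).
by rewrite /zigzag !strE /= !simplE.
Qed.

Lemma str_zagzig (a : sob D) n :
  str (ev (so a)) (bar (so a) ⊗ n) ∘ sF (sleaf (bar (so a))) (str (coev (so a)) n) =
  idm (bar (so a) ⊗ n).
Proof.
have := congr1 (fun f => @str R D _ _ f n) (umfc_zagzig (so a)).
by rewrite /zagzig !strE /= !simplE.
Qed.

Lemma str_ev_nat (a : sob D) n n' (g : hom n n') :
  str (ev (so a)) n' ∘ sF (sleaf (bar (so a))) (sF a g) = g ∘ str (ev (so a)) n.
Proof.
have := @str_nat _ _ (stens (sleaf (bar (so a))) a) (sunit D) (ev (so a)) _ _ g.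
by rewrite sF_unit sF_tens.
Qed.

Lemma str_coev_nat (a : sob D) n n' (g : hom n n') :
  str (coev (so a)) n' ∘ g = sF a (sF (sleaf (bar (so a))) g) ∘ str (coev (so a)) n.
Proof.
have := @str_nat _ _ (sunit D) (stens a (sleaf (bar (so a)))) (coev (so a)) _ _ g.
by rewrite sF_unit sF_tens.
Qed.

Lemma wh_comp a n n' n'' (g : @hom R D n' n'') (f : hom n n') :
  sF (sleaf a) (g ∘ f) = sF (sleaf a) g ∘ sF (sleaf a) f.
Proof. exact: sF_comp. Qed.

Lemma wh_dag a n n' (f : @hom R D n n') :
  sF (sleaf a) f^† = (sF (sleaf a) f)^†.
Proof. exact: sF_dag. Qed.

Lemma wh_nat x y (f : @hom R D x y) n n' (g : hom n n') :
  @str _ _ (sleaf x) (sleaf y) f n' ∘ sF (sleaf x) g =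
  sF (sleaf y) g ∘ @str _ _ (sleaf x) (sleaf y) f n.
Proof. exact: str_nat. Qed.

(** The counit of the adjunction in which the action of the dual arcs is left adjoint to the action
    of [(a, b)]; [cozig] is the unit. The right-hand arcs use the adjoint duality maps. *)
Definition zig a b y : hom (bar a ⊗ (a ⊗ y ⊗ b) ⊗ bar b) y :=
  unit_out y ∘ (ev a ⊠ idm y ⊠ (coev b)^†) ∘ rebracket (bar a) a y b (bar b).

Definition cozig a b y : hom y (a ⊗ (bar a ⊗ y ⊗ bar b) ⊗ b) :=
  (rebracket a (bar a) y (bar b) b)^† ∘ (coev a ⊠ idm y ⊠ (ev b)^†) ∘ unit_in y.

Lemma unit_in_nat x y (f : @hom R D x y) :
  unit_in y ∘ f = (idm 1 ⊠ f ⊠ idm 1) ∘ unit_in x.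
Proof.
by apply: str_inj => n; rewrite /unit_in !strE /= !simplE.
Qed.

Lemma unit_inU y : unitary (@unit_in R D y).
Proof.
by apply: unitaryM; apply: unitary_dag; [exact: runitU|exact: lunitU].
Qed.

Lemma dag_unit_in y : (unit_in y)^† = unit_out y :> @hom R D _ _.
Proof. by rewrite /unit_in dagM !dag_dag. Qed.

Lemma zig_nat a b x y (f : hom x y) :
  zig a b y ∘ (idm (bar a) ⊠ (idm a ⊠ f ⊠ idm b) ⊠ idm (bar b)) = f ∘ zig a b x.
Proof.
apply: str_inj => n; rewrite /zig /unit_out !strE /= !simplE.
rewrite [RHS]compoA -(@str_ev_nat (sleaf a)) -!compoA -!wh_comp.
by rewrite wh_nat.
Qed.

(** One triangle identity of the adjunction, [cozig_zig] being the other: the zig-zag equation on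
    the left arc, its adjoint on the right arc. *)
Lemma zig_cozig a b y :
  (idm a ⊠ zig a b y ⊠ idm b) ∘ cozig a b (a ⊗ y ⊗ b) = idm (a ⊗ y ⊗ b).
Proof.
apply: str_inj => n; rewrite /zig /cozig /unit_out /unit_in !strE /= !simplE.
rewrite !wh_comp !compoA -[_ ∘ _ ∘ str (coev a) _]compoA -(@str_coev_nat (sleaf a)) compoA.
rewrite (@str_zigzag (sleaf a)) idl -!wh_comp sF_dag -dagM.
by rewrite (@str_zigzag (sleaf b)) dag_idm !sF_id.
Qed.

Lemma cozig_zig a b y :
  zig a b (bar a ⊗ y ⊗ bar b) ∘ (idm (bar a) ⊠ cozig a b y ⊠ idm (bar b)) =
  idm (bar a ⊗ y ⊗ bar b).
Proof.
apply: str_inj => n; rewrite /zig /cozig /unit_out /unit_in !strE /= !simplE.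
rewrite -compoA -wh_comp compoA -(@str_coev_nat (sleaf a)) !wh_comp !compoA.
rewrite (@str_zagzig (sleaf a)) idl -!wh_comp sF_dag -dagM.
by rewrite (@str_zagzig (sleaf b)) dag_idm !sF_id.
Qed.
End Duality.

(** * Left and right traces, and their factorization through partial traces *)

Section Trace.
Variables (R : realType) (D : UMFC R).
Implicit Types (a b e x y z n : D).
Local Notation "1" := (unit_ob D).

Lemma dual_mor_coev x y (f : hom x y) :
  (f ⊠ idm (bar x)) ∘ coev x = (idm y ⊠ dual_mor f) ∘ coev y.
Proof.
apply: str_inj => n; rewrite /dual_mor /bend !strE /= !simplE.
rewrite -compoA -wh_comp [sF (sleaf y) _]wh_comp -compoA -(@str_coev_nat _ _ (sleaf y)).
rewrite compoA. by rewrite (@str_zigzag _ _ (sleaf y)) idl.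
Qed.

Lemma dual_mor_ev x y (f : hom x y) :
  ev x ∘ (dual_mor f ⊠ idm x) = ev y ∘ (idm (bar y) ⊠ f).
Proof.
apply: str_inj => n; rewrite /dual_mor /bend !strE /= !simplE.
rewrite !compoA -(@str_ev_nat _ _ (sleaf y)) -!compoA -!wh_comp.
by rewrite !compoA -wh_nat -!compoA (@str_zigzag _ _ (sleaf x)) idr.
Qed.

Definition trR x (f : hom x x) : hom 1 1 :=
  (coev x)^† ∘ (f ⊠ idm (bar x)) ∘ coev x.

Definition trL x (f : hom x x) : hom 1 1 :=
  ev x ∘ (idm (bar x) ⊠ f) ∘ (ev x)^†.

(** [f] slides over the cup as [dual_mor f] and back over the cap. The cap is the adjoint of the
    cup, so the second slide is the adjoint of the first one for [f^†], and matching them is what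
    [umfc_pivotal] provides. *)
Lemma trR_cyclic x y (f : hom x y) (g : hom y x) : trR (f ∘ g) = trR (g ∘ f).
Proof.
have dag_coev : (coev y)^† ∘ (f ⊠ idm _) = (coev x)^† ∘ (idm _ ⊠ dual_mor f).
  apply: (can_inj (@dag_dag _ _ _ _)); rewrite !dagM !dag_dag !dag_tens !dag_idm.
  by rewrite dual_mor_coev umfc_pivotal.
rewrite /trR -[idm (bar y)]idl -tensM compoA dag_coev.
rewrite -[_ ∘ _ ∘ (g ⊠ _)]compoA tensM idl idr.
rewrite -[idm (bar x)]idl -tensM compoA -[RHS]compoA dual_mor_coev compoA.
by rewrite -[_ ∘ _ ∘ (_ ⊠ dual_mor f)]compoA tensM idl idr.
Qed.

Lemma trL_cyclic x y (f : hom x y) (g : hom y x) : trL (f ∘ g) = trL (g ∘ f).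
Proof.
have dag_ev : (dual_mor f ⊠ idm y) ∘ (ev y)^† = (idm _ ⊠ f) ∘ (ev x)^†.
  apply: (can_inj (@dag_dag _ _ _ _)); rewrite !dagM !dag_dag !dag_tens !dag_idm.
  by rewrite -umfc_pivotal dual_mor_ev.
rewrite /trL -[idm (bar y)]idl -tensM compoA -dual_mor_ev.
rewrite -[_ ∘ _ ∘ (_ ⊠ g)]compoA tensM idl idr.
rewrite -[idm (bar x)]idl -tensM -!compoA -dag_ev !compoA.
by rewrite -[_ ∘ _ ∘ (dual_mor f ⊠ _)]compoA tensM idl idr.
Qed.

Lemma str_nat_tens x y x' y' (f : @hom R D (x ⊗ y) (x' ⊗ y')) n n' (g : hom n n') :
  str f n' ∘ sF (sleaf x) (sF (sleaf y) g) =
  sF (sleaf x') (sF (sleaf y') g) ∘ str f n.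
Proof.
have := @str_nat _ _ (stens (sleaf x) (sleaf y)) (stens (sleaf x') (sleaf y')) f _ _ g.
by rewrite !sF_tens.
Qed.

Local Notation tensorator x y := (bend (nested_ev x y)).

Lemma str_nested_ev x y n :
  str (nested_ev x y) n =
  str (ev y) n ∘ sF (sleaf (bar y)) (str (ev x) (y ⊗ n)).
Proof. by rewrite /nested_ev !strE /= !simplE. Qed.

Lemma str_tensorator x y n : str (tensorator x y) n =
  str (nested_ev x y) (bar (x ⊗ y) ⊗ n) ∘
    sF (sleaf (bar y)) (sF (sleaf (bar x)) (str (coev (x ⊗ y)) n)).
Proof. by rewrite /bend !strE /= !simplE. Qed.

(** The tensorator is the nested evaluation bent by [coev (x ⊗ y)]; placed against the nested
    coevaluation, its legs [y] and [x] straighten by two zig-zags. *)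
Lemma coev_tens x y n :
  str (coev (x ⊗ y)) n =
  sF (sleaf x) (sF (sleaf y) (str (tensorator x y) n)) ∘
    (sF (sleaf x) (str (coev y) (bar x ⊗ n)) ∘ str (coev x) n).
Proof.
rewrite str_tensorator str_nested_ev -[_ ∘ _ ∘ sF (sleaf (bar y)) _]compoA -wh_comp.
rewrite compoA -wh_comp [sF (sleaf y) _]wh_comp -compoA.
rewrite -(@str_coev_nat _ _ (sleaf y)) [sF (sleaf y) _ ∘ _]compoA.
rewrite (@str_zigzag _ _ (sleaf y)) idl wh_comp -compoA.
by rewrite -(@str_coev_nat _ _ (sleaf x)) compoA (@str_zigzag _ _ (sleaf x)) idl.
Qed.

Lemma ev_tens x y n :
  str (ev (x ⊗ y)) n ∘ str (tensorator x y) (x ⊗ (y ⊗ n)) =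
  str (nested_ev x y) n.
Proof.
rewrite str_tensorator !str_nested_ev -[_ ∘ _ ∘ sF (sleaf (bar y)) (sF _ _)]compoA.
rewrite -wh_comp compoA -(@str_ev_nat _ _ (sleaf y)) -compoA -wh_comp.
rewrite compoA -(@str_ev_nat _ _ (sleaf x)) -compoA -wh_comp.
have /= := @str_zigzag _ _ (stens (sleaf x) (sleaf y)) n.
by rewrite sF_tens => ->; rewrite sF_id idr.
Qed.

Lemma tensoratorU x y : unitary (tensorator x y).
Proof. exact: umfc_tensorator. Qed.

Lemma str_unitary (X Y : sob D) (f : hom (so X) (so Y)) n :
  unitary f -> unitary (str f n).
Proof. by case=> ff ff'; split; rewrite -str_dag -str_comp ?ff ?ff' str_id. Qed.

Definition ptrR y b (f : @hom R D (y ⊗ b) (y ⊗ b)) : hom y y :=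
  runit y ∘ (idm y ⊠ (coev b)^†) ∘ assoc y b (bar b) ∘ (f ⊠ idm (bar b)) ∘
  (assoc y b (bar b))^† ∘ (idm y ⊠ coev b) ∘ (runit y)^†.

Definition ptrL a y (f : @hom R D (a ⊗ y) (a ⊗ y)) : hom y y :=
  lunit y ∘ (ev a ⊠ idm y) ∘ (assoc (bar a) a y)^† ∘ (idm (bar a) ⊠ f) ∘
  assoc (bar a) a y ∘ ((ev a)^† ⊠ idm y) ∘ (lunit y)^†.

(** By [coev_tens], the cup and the cap contribute the tensorator and its adjoint, which cancel
    because the tensorator is unitary. *)
Lemma trR_tens y b (f : hom (y ⊗ b) (y ⊗ b)) : trR f = trR (ptrR f).
Proof.
apply: str_inj => n; rewrite /trR /ptrR !strE /= !simplE.
rewrite coev_tens dagM; set U := str (tensorator y b) n; set c := _ ∘ str (coev y) n.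
rewrite -compoA [str f _ ∘ _]compoA str_nat_tens -!compoA [in LHS](compoA (sF _ _)^†).
have uU : unitary U by apply: str_unitary; apply: tensoratorU.
rewrite -wh_dag -wh_comp -wh_dag -wh_comp; case: uU => -> _.
by rewrite !sF_id idl /c dagM -wh_dag !compoA.
Qed.

Lemma trL_tens a y (f : hom (a ⊗ y) (a ⊗ y)) : trL f = trL (ptrL f).
Proof.
apply: str_inj => n; rewrite /trL /ptrL !strE /= !simplE.
have uU m := str_unitary (X := stens (sleaf (bar y)) (sleaf (bar a)))
  (Y := sleaf (bar (a ⊗ y))) m (tensoratorU a y).
have -> : str (ev (a ⊗ y)) n =
    str (nested_ev a y) n ∘ (str (tensorator a y) (a ⊗ (y ⊗ n)))^†.
  by rewrite -ev_tens compUK //; apply: uU.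
have nat := @str_nat _ _ (stens (sleaf (bar y)) (sleaf (bar a)))
  (sleaf (bar (a ⊗ y))) (tensorator a y) _ _ (str f n).
rewrite dagM dag_dag -!compoA [sF (sleaf (bar (_ ⊗ _))) _ ∘ _]compoA -nat.
rewrite -!compoA compKU; last exact: uU.
rewrite sF_tens str_nested_ev dagM -wh_dag !wh_comp.
by rewrite -!compoA.
Qed.

Lemma zig_ptr a b y (f : hom (a ⊗ y ⊗ b) (a ⊗ y ⊗ b)) :
  zig a b y ∘ (idm (bar a) ⊠ f ⊠ idm (bar b)) ∘ (zig a b y)^† = ptrL (ptrR f).
Proof.
apply: str_inj => n; rewrite /zig /ptrR /ptrL /unit_out !strE /= !simplE.
by rewrite dagM -!wh_dag dag_dag !wh_comp !compoA.
Qed.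

End Trace.

(** * Sphericality when the unit object is not simple *)

Section Sphericality.
Variables (R : realType) (D : UMFC R).
Local Notation C := R[i].
Local Notation I := (Irr D).
Implicit Types (a b x y : D) (k s : I) (i j : unit_idx D).
Local Notation "1" := (unit_ob D).

Lemma unit_inc_dag i : (unit_inc i)^† ∘ unit_inc i = idm (@irr R D (unit_irr i)).
Proof. by case: (umfc_unit D) => + _ _; apply. Qed.

Lemma unit_inc_dag_neq i j : i != j ->
  (unit_inc i)^† ∘ unit_inc j = 0 :> hom (@irr R D (unit_irr j)) _.
Proof. by case: (umfc_unit D) => _ + _; apply. Qed.

Lemma unit_inc_sum : \sum_i unit_inc i ∘ (unit_inc i)^† = idm 1.
Proof. by case: (umfc_unit D). Qed.

Lemma tensZl x x' y y' c (f : @hom R D x x') (g : hom y y') :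
  (c *: f) ⊠ g = c *: (f ⊠ g).
Proof. exact: lin_scale (bilinl (tens_bil _ _ _ _) g) c f. Qed.

Lemma tensZr x x' y y' c (f : @hom R D x x') (g : hom y y') :
  f ⊠ (c *: g) = c *: (f ⊠ g).
Proof. exact: lin_scale (bilinr (tens_bil _ _ _ _) f) c g. Qed.

Lemma tens0l x x' y y' (g : @hom R D y y') : (0 : hom x x') ⊠ g = 0.
Proof. exact: lin_zero (bilinl (tens_bil _ _ _ _) g). Qed.

Lemma tens0r x x' y y' (f : @hom R D x x') : f ⊠ (0 : hom y y') = 0.
Proof. exact: lin_zero (bilinr (tens_bil _ _ _ _) f). Qed.

Lemma tens_suml x x' y y' (J : Type) (r : seq J) (P : pred J)
    (f : J -> @hom R D x x') (g : hom y y') :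
  (\sum_(t <- r | P t) f t) ⊠ g = \sum_(t <- r | P t) f t ⊠ g.
Proof. by rewrite (lin_sum (bilinl (tens_bil _ _ _ _) g)). Qed.

Lemma tens_sumr x x' y y' (J : Type) (r : seq J) (P : pred J)
    (f : @hom R D x x') (g : J -> hom y y') :
  f ⊠ (\sum_(t <- r | P t) g t) = \sum_(t <- r | P t) f ⊠ g t.
Proof. by rewrite (lin_sum (bilinr (tens_bil _ _ _ _) f)). Qed.

Definition comp_proj i j x :
    hom x (irr (unit_irr i) ⊗ x ⊗ irr (unit_irr j)) :=
  ((unit_inc i)^† ⊠ idm x ⊠ (unit_inc j)^†) ∘ unit_in x.

Lemma comp_proj_sum x : \sum_i \sum_j (comp_proj i j x)^† ∘ comp_proj i j x = idm x.
Proof.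
transitivity ((unit_in x)^† ∘ ((idm 1 ⊠ idm x ⊠ idm 1) ∘ unit_in x)); last first.
  by rewrite !tens_idm idl; case: (unit_inU x).
rewrite -unit_inc_sum !tens_suml comp_suml comp_sumr; apply: eq_bigr => i _.
rewrite tens_sumr comp_suml comp_sumr; apply: eq_bigr => j _.
rewrite /comp_proj dagM !dag_tens !dag_dag dag_idm -!compoA; congr (_ ∘ _).
by rewrite compoA !tensM !idl.
Qed.

Lemma comp_proj_dag i j x : comp_proj i j x ∘ (comp_proj i j x)^† = idm _.
Proof.
rewrite /comp_proj dagM compoA compUK; last exact: unit_inU.
by rewrite !dag_tens !dag_dag dag_idm !tensM !unit_inc_dag idl !tens_idm.
Qed.

(** The map [p = comp_proj i j x] satisfies [p ∘ p^† = idm _], and [p^† ∘ p] is a scalar [c] with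
    [(c - 1) *: p = 0]. So a nonzero [p] is unitary and exhibits [x] as an object of the
    component. *)
Lemma comp_proj_eq0 i j x : simple x ->
  ~ in_component (irr (unit_irr i)) (irr (unit_irr j)) x -> comp_proj i j x = 0.
Proof.
move=> sx; apply: contra_notP => /eqP p0; exists x.
set p := comp_proj i j x in p0 *.
have pp : p ∘ p^† = idm _ by exact: comp_proj_dag.
exists p, p^†; split=> //.
have [c pE] := simple_idm (p^† ∘ p) sx; rewrite pE.
suff -> : c = 1%R by rewrite scale1r.
apply/eqP; rewrite -subr_eq0; apply: contraNT p0 => c1.
have /eqP : (c - 1) *: p = 0.
  by rewrite scalerBl scale1r -{1}[p]idr -compZr -pE compoA pp idl subrr.
by rewrite scaler_eq0 (negPf c1).
Qed.

Lemma exists_component x : simple x ->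
  exists i j, in_component (irr (unit_irr i)) (irr (unit_irr j)) x.
Proof.
move=> sx; apply: contrapT => nex.
have := simple_neq0 sx; rewrite -comp_proj_sum big1 ?eqxx // => i _.
rewrite big1 // => j _; rewrite comp_proj_eq0 ?comp0r // => ij.
by apply: nex; exists i, j.
Qed.

(* The left and right traces of an endomorphism may lie in different summands *)
(* of End(1), so that only the sums of their coefficients can be compared.    *)
Definition unit_tr (f : @hom R D 1 1) : C :=
  \sum_i irr_scalar ((unit_inc i)^† ∘ f ∘ unit_inc i).

Lemma unit_tr_linear : scalar unit_tr.
Proof.
move=> c f g; rewrite /unit_tr big_distrr -big_split /=; apply: eq_bigr => i _.
rewrite (bilinr (comp_bil _ _ _)) (bilinl (comp_bil _ _ _)).
by rewrite irr_scalar_linear.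
Qed.

Lemma unit_trZ c (f : hom 1 1) : unit_tr (c *: f) = c * unit_tr f.
Proof. exact: (lin_scale (V := C^o) unit_tr_linear). Qed.

Lemma unit_tr_sum (J : Type) (r : seq J) (P : pred J) (f : J -> hom 1 1) :
  unit_tr (\sum_(t <- r | P t) f t) = \sum_(t <- r | P t) unit_tr (f t).
Proof. by rewrite (lin_sum (V := C^o) unit_tr_linear). Qed.

Lemma unit_tr_inc i : unit_tr (unit_inc i ∘ (unit_inc i)^†) = 1%R.
Proof.
rewrite /unit_tr (bigD1 i) //= -!compoA unit_inc_dag compoA unit_inc_dag idl.
rewrite irr_scalar_id big1 ?addr0 // => j ji.
by rewrite compoA unit_inc_dag_neq // !comp0l irr_scalar0.
Qed.

Local Notation d x := ((qdim x)%:C)%C.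

Lemma unit_tr_trR k : unit_tr (trR (idm (@irr R D k))) = d (irr k).
Proof.
have [i [j ij]] := exists_component (irrS k).
have [E _] := umfc_spherical (irrS k) ij.
by rewrite /trR tens_idm idr E unit_trZ unit_tr_inc mulr1.
Qed.

Lemma unit_tr_trL k : unit_tr (trL (idm (@irr R D k))) = d (irr k).
Proof.
have [i [j ij]] := exists_component (irrS k).
have [_ E] := umfc_spherical (irrS k) ij.
by rewrite /trL tens_idm idr E unit_trZ unit_tr_inc mulr1.
Qed.

Lemma trR_linear x : linear (@trR R D x).
Proof.
move=> c f g; rewrite /trR (bilinl (tens_bil _ _ _ _)).
by rewrite (bilinr (comp_bil _ _ _)) (bilinl (comp_bil _ _ _)).
Qed.

Lemma trL_linear x : linear (@trL R D x).
Proof.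
move=> c f g; rewrite /trL (bilinr (tens_bil _ _ _ _)).
by rewrite (bilinr (comp_bil _ _ _)) (bilinl (comp_bil _ _ _)).
Qed.

(** A linear cyclic trace is determined by its values on simple objects: insert the resolution of
    the identity of [x] and rotate. Applied to [trL] and [trR], whose values on simples agree, it
    yields [unit_tr_spherical]. *)
Lemma unit_tr_decomp (tr : forall x, hom x x -> hom 1 1)
    (tr_lin : forall x, linear (tr x))
    (trC : forall x y (f : hom x y) (g : hom y x), tr _ (f ∘ g) = tr _ (g ∘ f))
    (tr1 : forall k, unit_tr (tr _ (idm (irr k))) = d (irr k)) x (f : hom x x) :
  unit_tr (tr _ f) =
  \sum_k \sum_p d (irr k) * irr_scalar (bdual p ∘ f ∘ @bvec R D k x p).
Proof.
rewrite -[in LHS](idr f) -irr_decomp comp_sumr (lin_sum (tr_lin x)) unit_tr_sum.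
apply: eq_bigr => k _.
rewrite comp_sumr (lin_sum (tr_lin x)) unit_tr_sum; apply: eq_bigr => p _.
rewrite compoA trC compoA [in LHS]irr_scalar_compE (lin_scale (tr_lin _)) unit_trZ tr1.
by rewrite mulrC.
Qed.

Lemma unit_tr_spherical x (f : hom x x) : unit_tr (trR f) = unit_tr (trL f).
Proof.
rewrite (unit_tr_decomp trL_linear (@trL_cyclic R D) unit_tr_trL).
by rewrite (unit_tr_decomp trR_linear (@trR_cyclic R D) unit_tr_trR).
Qed.

(** The left side is the left trace of [v ∘ w] with its right arc already closed, the right side its
    right trace. They agree by sphericality on [a ⊗ irr s], followed by cyclicity. *)
Lemma trace_zig k s a b (v : hom (irr k) (a ⊗ irr s ⊗ b)) (w : hom _ (irr k)) :
  d (irr s) * irr_scalar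
    (zig a b (irr s) ∘ (idm (bar a) ⊠ (v ∘ w) ⊠ idm (bar b)) ∘ (zig a b (irr s))^†) =
  d (irr k) * irr_scalar (w ∘ v).
Proof.
set f := _ ∘ (zig _ _ _)^†.
transitivity (unit_tr (trL f)).
  rewrite [in RHS](irr_scalarE f) (lin_scale (@trL_linear _)) unit_trZ unit_tr_trL.
  by rewrite mulrC.
rewrite /f zig_ptr -trL_tens -unit_tr_spherical -trR_tens trR_cyclic.
rewrite [in LHS]irr_scalar_compE (lin_scale (@trR_linear _)) unit_trZ unit_tr_trR.
by rewrite mulrC.
Qed.

End Sphericality.

(** * Tube spaces as coends *)

Section TubeSpace.
Variables (R : realType) (D : UMFC R).
Local Notation C := R[i].
Local Notation I := (Irr D).
Local Notation "1" := (unit_ob D).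
Implicit Types (a b c e f h k s : I) (A B : D).

Lemma tube_elt_bilin a b c e f h : bilin (@tube_elt R D a b c e f h).
Proof.
apply: (linear_bilin (f := @dsum_inj _ _ (@tube_summand R D) (a, b, c, e, f, h))).
  exact: tpure_bilin.
exact: dsum_inj_linear.
Qed.

Lemma tube_ext (W : vectType C) (F G : Tube D -> W) : linear F -> linear G ->
  (forall a b c e f h (v : hom_in (irr a) (irr b) c e)
     (w : hom_out (irr a) (irr b) f h), F (tube_elt v w) = G (tube_elt v w)) ->
  forall x, F x = G x.
Proof.
move=> lF lG FG x; rewrite [x]dsum_decomp (lin_sum lF) (lin_sum lG).
apply: eq_bigr => t _.
apply: (tprod_ext (f := fun y => F (dsum_inj y)) (g := fun y => G (dsum_inj y))).
- exact: linear_comp lF (@dsum_inj_linear _ _ _ _).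
- exact: linear_comp lG (@dsum_inj_linear _ _ _ _).
by case: t => [[[[[a b] c] e] f] h] v w; apply: FG.
Qed.

Lemma tube_lift_linear (W : vectType C) F : linear (@tube_lift R D W F).
Proof.
move=> k x y; rewrite /tube_lift scaler_sumr -big_split; apply: eq_bigr => t _ /=.
by rewrite !ffunE tlift_linear.
Qed.

Lemma tube_lift_param_linear (V W : vectType C)
    (F : V -> forall a b c e f h : I,
      hom_in (irr a) (irr b) c e -> hom_out (irr a) (irr b) f h -> W) x :
  (forall a b c e f h v w, linear (fun z => @F z a b c e f h v w)) ->
  linear (fun z => tube_lift (F z) x).
Proof. by move=> lB; apply: linear_big => t; apply: tlift_param_linear => v w. Qed.

Lemma comp_linearr x y z (g : @hom R D y z) : linear (fun u : hom x y => g ∘ u).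
Proof. exact: bilinr (comp_bil x y z) g. Qed.

Lemma comp_linearl x y z (g : @hom R D x y) : linear (fun u : hom y z => u ∘ g).
Proof. exact: bilinl (comp_bil x y z) g. Qed.

Lemma tens_linearr x y z t (g : @hom R D x y) : linear (fun u : hom z t => g ⊠ u).
Proof. exact: bilinr (tens_bil _ _ _ _) g. Qed.

Lemma tens_linearl x y z t (g : @hom R D x y) : linear (fun u : hom z t => u ⊠ g).
Proof. exact: bilinl (tens_bil _ _ _ _) g. Qed.

Lemma tube_bracket_bilin A B c e f h : bilin (@tube_bracket R D A B c e f h).
Proof.
do 2 apply: bilin_big => ?; do 2 apply: bilin_big => ?.
apply: bilin_comp (tube_elt_bilin _ _ _ _ _ _) _ _; first exact: comp_linearr.
exact: comp_linearl.
Qed.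

(** By Schur's lemma the canonical element of a simple object reduces to the pair of identities. *)
Lemma canonical_irr (W : vectType C) a
    (F : forall k, hom (irr k) (irr a) -> hom (irr a) (@irr R D k) -> W) :
  (forall k, bilin (F k)) ->
  \sum_k \sum_p F k (bvec p) (bdual p) = F a (idm _) (idm _).
Proof.
move=> bF; rewrite (sum_only1 (k := a)) => [|k ka].
  rewrite [X in F a X]bvec_expand (lin_sumZ (bilinl (bF a) _)).
  apply: eq_bigr => p _; rewrite idr -(lin_scale (bilinr (bF a) _)).
  by rewrite -irr_scalarE.
rewrite big1 // => p _; rewrite (schur (bvec p) ka).
exact: lin_zero (bilinl (bF k) _).
Qed.

Lemma act_in_linearl x x' y z z' t (f : @hom R D y y) (g : hom z z')
    (v : hom t (x ⊗ y ⊗ z)) : linear (fun u : hom x x' => (u ⊠ f ⊠ g) ∘ v).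
Proof. by move=> k u u'; rewrite tens_linearl tens_linearl comp_linearl. Qed.

Lemma act_in_linearr x x' y z z' t (f : @hom R D y y) (g : hom x x')
    (v : hom t (x ⊗ y ⊗ z)) : linear (fun u : hom z z' => (g ⊠ f ⊠ u) ∘ v).
Proof. by move=> k u u'; rewrite tens_linearr comp_linearl. Qed.

Lemma act_out_linearl x x' y z z' t (f : @hom R D y y) (g : hom z z')
    (w : hom (x' ⊗ y ⊗ z') t) : linear (fun u : hom x x' => w ∘ (u ⊠ f ⊠ g)).
Proof. by move=> k u u'; rewrite tens_linearl tens_linearl comp_linearr. Qed.

Lemma act_out_linearr x x' y z z' t (f : @hom R D y y) (g : hom x x')
    (w : hom (x' ⊗ y ⊗ z') t) : linear (fun u : hom z z' => w ∘ (g ⊠ f ⊠ u)).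
Proof. by move=> k u u'; rewrite tens_linearr comp_linearr. Qed.

Lemma bracket_term_bilinl A A' k s B B' c e f h (g : hom B (irr s)) (g' : hom (irr s) B')
    (v : hom_in A B c e) (w : hom_out A' B' f h) :
  bilin (fun (u : hom (irr k) A') (u' : hom A (irr k)) =>
    tube_elt ((u' ⊠ idm (irr e) ⊠ g) ∘ v) (w ∘ (u ⊠ idm (irr f) ⊠ g'))).
Proof.
apply: bilin_swap; apply: bilin_comp (tube_elt_bilin _ _ _ _ _ _) _ _.
  exact: act_in_linearl.
exact: act_out_linearl.
Qed.

Lemma bracket_term_bilinr A A' k s B B' c e f h (g : hom A (irr k)) (g' : hom (irr k) A')
    (v : hom_in A B c e) (w : hom_out A' B' f h) :
  bilin (fun (u : hom (irr s) B') (u' : hom B (irr s)) =>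
    tube_elt ((g ⊠ idm (irr e) ⊠ u') ∘ v) (w ∘ (g' ⊠ idm (irr f) ⊠ u))).
Proof.
apply: bilin_swap; apply: bilin_comp (tube_elt_bilin _ _ _ _ _ _) _ _.
  exact: act_in_linearr.
exact: act_out_linearr.
Qed.

Lemma tube_bracket_irr a b c e f h (v : hom_in (irr a) (irr b) c e)
    (w : hom_out (irr a) (irr b) f h) : tube_bracket v w = tube_elt v w.
Proof.
rewrite /tube_bracket; under eq_bigr => k _ do (rewrite exchange_big /=;
  under eq_bigr => p _ do rewrite (canonical_irr (F := fun s u u' => tube_elt
    ((bdual p ⊠ idm (irr e) ⊠ u') ∘ v) (w ∘ (bvec p ⊠ idm (irr f) ⊠ u)))
      (fun s => bracket_term_bilinr _ _ _ v w))).
rewrite (canonical_irr (F := fun k u u' => tube_elt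
  ((u' ⊠ idm (irr e) ⊠ idm (irr b)) ∘ v) (w ∘ (u ⊠ idm (irr f) ⊠ idm (irr b))))
    (fun k => bracket_term_bilinl _ _ _ v w)).
by rewrite !tens_idm idl idr.
Qed.

(** Dinaturality in the left arc is the naturality of the canonical element of [A] that the bracket
    inserts. *)
Lemma bracket_dinatl A A' B c e f h (g : hom A A') (v : hom_in A B c e)
    (w : hom_out A' B f h) :
  tube_bracket ((g ⊠ idm (irr e) ⊠ idm B) ∘ v) w =
  tube_bracket v (w ∘ (g ⊠ idm (irr f) ⊠ idm B)).
Proof.
apply: eq_bigr => k _; apply: eq_bigr => s _.
rewrite exchange_big [RHS]exchange_big; apply: eq_bigr => q _ /=.
have E := dual_bases_nat g (bracket_term_bilinl k (bdual q) (bvec q) v w).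
under eq_bigr do rewrite compoA !tensM !idr.
by rewrite -E; apply: eq_bigr => p _; rewrite -compoA !tensM !idl.
Qed.

Lemma bracket_dinatr A B B' c e f h (g : hom B B') (v : hom_in A B c e)
    (w : hom_out A B' f h) :
  tube_bracket ((idm A ⊠ idm (irr e) ⊠ g) ∘ v) w =
  tube_bracket v (w ∘ (idm A ⊠ idm (irr f) ⊠ g)).
Proof.
apply: eq_bigr => k _; apply: eq_bigr => s _; apply: eq_bigr => p _.
have E := dual_bases_nat g (bracket_term_bilinr s (bdual p) (bvec p) v w).
under eq_bigr do rewrite compoA !tensM !idr.
by rewrite -E; apply: eq_bigr => q _; rewrite -compoA !tensM !idl.
Qed.

Lemma bracket_dinat A A' B B' c e f h (g : hom A A') (g' : hom B B')
    (v : hom_in A B c e) (w : hom_out A' B' f h) :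
  tube_bracket ((g ⊠ idm (irr e) ⊠ g') ∘ v) w =
  tube_bracket v (w ∘ (g ⊠ idm (irr f) ⊠ g')).
Proof.
have -> : (g ⊠ idm (irr e) ⊠ g') ∘ v =
    (g ⊠ idm (irr e) ⊠ idm B') ∘ ((idm A ⊠ idm (irr e) ⊠ g') ∘ v).
  by rewrite compoA !tensM !idl !idr.
by rewrite bracket_dinatl bracket_dinatr -compoA !tensM !idl !idr.
Qed.

(** The identities of [A] and [B] are resolved through simples next to [w]; dinaturality of [F]
    moves the dual halves over to [v], which leaves the tube elements that make up the bracket.
    Linearity of [F] in the second leg is enough for this. *)
Lemma bracket_univ (W : vectType C) c e f h (L : Tube D -> W)
    (F : forall A B, hom_in A B c e -> hom_out A B f h -> W) :
  linear L ->
  (forall A B v, linear (F A B v)) ->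
  (forall A A' B B' (g : hom A A') (g' : hom B B') v w,
    F _ _ ((g ⊠ idm (irr e) ⊠ g') ∘ v) w = F _ _ v (w ∘ (g ⊠ idm (irr f) ⊠ g'))) ->
  (forall a b v w, L (@tube_elt R D a b c e f h v w) = F _ _ v w) ->
  forall A B v w, L (@tube_bracket R D A B c e f h v w) = F A B v w.
Proof.
move=> lL lF Fnat LF A B v w.
transitivity (F A B v (w ∘ (idm A ⊠ idm (irr f) ⊠ idm B))); last first.
  by rewrite !tens_idm idr.
rewrite -(irr_decomp A) -(irr_decomp B) 2!tens_suml comp_sumr.
rewrite (lin_sum (lF _ _ _)) (lin_sum lL); apply: eq_bigr => k _.
rewrite exchange_big (lin_sum lL) 2!tens_suml comp_sumr (lin_sum (lF _ _ _)).
apply: eq_bigr => p _.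
rewrite tens_sumr comp_sumr (lin_sum (lF _ _ _)) (lin_sum lL).
apply: eq_bigr => s _.
rewrite tens_sumr comp_sumr (lin_sum (lF _ _ _)) (lin_sum lL).
by apply: eq_bigr => q _; rewrite LF Fnat -compoA !tensM idl.
Qed.

(** [comp_in] and [comp_out] are the two legs of the product in [tube_mul], for arbitrary arcs. *)
Definition comp_in A B A' B' c e c' e' (v : hom_in A B c e) (v' : hom_in A' B' c' e') :
    hom_in (A ⊗ A') (B' ⊗ B) c e' :=
  rebracket A A' (irr e') B' B ∘ (idm A ⊠ (v' ∘ irr_delta e c') ⊠ idm B) ∘ v.

Definition comp_out A B A' B' f h f' h' (w : hom_out A B f h) (w' : hom_out A' B' f' h') :
    hom_out (A ⊗ A') (B' ⊗ B) f' h :=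
  w ∘ (idm A ⊠ (irr_delta h' f ∘ w') ⊠ idm B) ∘ (rebracket A A' (irr f') B' B)^†.

Lemma comp_in_bilin A B A' B' c e c' e' : bilin (@comp_in A B A' B' c e c' e').
Proof.
split=> v k x y; rewrite /comp_in; last exact: comp_linearr.
by rewrite comp_linearl tens_linearr tens_linearl comp_linearr comp_linearl.
Qed.

Lemma comp_out_bilin A B A' B' f h f' h' : bilin (@comp_out A B A' B' f h f' h').
Proof.
split=> w k x y; rewrite /comp_out; last by rewrite !comp_linearl.
by rewrite comp_linearr tens_linearr tens_linearl comp_linearr comp_linearl.
Qed.

Lemma tube_mul_bilin : bilin (@tube_mul R D).
Proof.
split=> z; last exact: tube_lift_linear.
apply: tube_lift_param_linear => *; exact: tube_lift_linear.
Qed.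

Lemma tube_mul_elt a b c e f h a' b' c' e' f' h'
    (v : hom_in (irr a) (irr b) c e) (w : hom_out (irr a) (irr b) f h)
    (v' : hom_in (irr a') (irr b') c' e') (w' : hom_out (irr a') (irr b') f' h') :
  tube_mul (tube_elt v w) (tube_elt v' w') =
  tube_bracket (comp_in v v') (comp_out w w').
Proof.
rewrite /tube_mul tube_lift_elt.
  rewrite tube_lift_elt // => *.
  exact: bilin_comp (tube_bracket_bilin _ _ _ _ _ _) (bilinr (comp_in_bilin _ _ _ _ _ _ _ _) v)
    (bilinr (comp_out_bilin _ _ _ _ _ _ _ _) w).
move=> *; split=> z; apply: tube_lift_param_linear => *.
  exact: linear_comp (bilinr (tube_bracket_bilin _ _ _ _ _ _) _)
    (bilinl (comp_out_bilin _ _ _ _ _ _ _ _) _).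
exact: linear_comp (bilinl (tube_bracket_bilin _ _ _ _ _ _) _)
    (bilinl (comp_in_bilin _ _ _ _ _ _ _ _) _).
Qed.

Lemma comp_in_natl A B A1 B1 A' B' c e c' e' (g : hom A A1) (g' : hom B B1)
    (v : hom_in A B c e) (v' : hom_in A' B' c' e') :
  comp_in ((g ⊠ idm (irr e) ⊠ g') ∘ v) v' =
  (g ⊠ idm A' ⊠ idm (irr e') ⊠ (idm B' ⊠ g')) ∘ comp_in v v'.
Proof.
rewrite /comp_in compoA [RHS]compoA; congr (_ ∘ _).
rewrite -compoA [RHS]compoA -rebracket_nat -[RHS]compoA; congr (_ ∘ _).
by rewrite !tensM !tens_idm !idl !idr.
Qed.

Lemma comp_in_natr A B A' B' A1 B1 c e c' e' (g : hom A' A1) (g' : hom B' B1)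
    (v : hom_in A B c e) (v' : hom_in A' B' c' e') :
  comp_in v ((g ⊠ idm (irr e') ⊠ g') ∘ v') =
  (idm A ⊠ g ⊠ idm (irr e') ⊠ (g' ⊠ idm B)) ∘ comp_in v v'.
Proof.
rewrite /comp_in [RHS]compoA; congr (_ ∘ _).
rewrite [RHS]compoA -rebracket_nat -[RHS]compoA; congr (_ ∘ _).
by rewrite !tensM !idl compoA.
Qed.

Lemma dag_irr_delta a b : (irr_delta a b)^† = irr_delta b a :> hom (@irr R D b) _.
Proof.
have [->|ab] := eqVneq a b; first by rewrite irr_delta_id dag_idm.
by rewrite !irr_delta_neq ?dag0 // eq_sym.
Qed.

(** Transfers statements about lower legs to upper legs, so that many of them need only be proved
    for [comp_in]. *)
Lemma comp_out_dag A B A' B' f h f' h' (w : hom_out A B f h) (w' : hom_out A' B' f' h') :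
  comp_out w w' = (comp_in w^† w'^†)^†.
Proof.
rewrite /comp_in 2!dagM dag_dag !dag_tens [(_ ∘ irr_delta _ _)^†]dagM !dag_idm.
by rewrite dag_dag dag_irr_delta compoA.
Qed.

Lemma comp_out_natl A B A1 B1 A' B' f h f' h' (g : hom A A1) (g' : hom B B1)
    (w : hom_out A1 B1 f h) (w' : hom_out A' B' f' h') :
  comp_out (w ∘ (g ⊠ idm (irr f) ⊠ g')) w' =
  comp_out w w' ∘ (g ⊠ idm A' ⊠ idm (irr f') ⊠ (idm B' ⊠ g')).
Proof.
rewrite !comp_out_dag dagM !dag_tens dag_idm comp_in_natl dagM !dag_tens !dag_dag.
by rewrite !dag_idm.
Qed.

Lemma comp_out_natr A B A' B' A1 B1 f h f' h' (g : hom A' A1) (g' : hom B' B1)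
    (w : hom_out A B f h) (w' : hom_out A1 B1 f' h') :
  comp_out w (w' ∘ (g ⊠ idm (irr f') ⊠ g')) =
  comp_out w w' ∘ (idm A ⊠ g ⊠ idm (irr f') ⊠ (g' ⊠ idm B)).
Proof.
rewrite !comp_out_dag dagM !dag_tens dag_idm comp_in_natr dagM !dag_tens !dag_dag.
by rewrite !dag_idm.
Qed.

(** [bracket_univ] in each factor. It makes products iterable, since the arcs of a product are no
    longer simple. *)
Lemma tube_mul_bracket A B A' B' c e f h c' e' f' h' (v : hom_in A B c e)
    (w : hom_out A B f h) (v' : hom_in A' B' c' e') (w' : hom_out A' B' f' h') :
  tube_mul (tube_bracket v w) (tube_bracket v' w') =
  tube_bracket (comp_in v v') (comp_out w w').
Proof.
apply: (bracket_univ (L := fun x => tube_mul x _) (F := fun A B v w =>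
  tube_bracket (comp_in v v') (comp_out w w'))).
- exact: bilinl tube_mul_bilin _.
- move=> *; exact: linear_comp (bilinr (tube_bracket_bilin _ _ _ _ _ _) _)
    (bilinl (comp_out_bilin _ _ _ _ _ _ _ _) _).
- by move=> *; rewrite comp_in_natl bracket_dinat comp_out_natl.
move=> a b {}v {}w.
apply: (bracket_univ (L := tube_mul _) (F := fun A' B' v' w' =>
  tube_bracket (comp_in v v') (comp_out w w'))).
- exact: bilinr tube_mul_bilin _.
- move=> *; exact: linear_comp (bilinr (tube_bracket_bilin _ _ _ _ _ _) _)
    (bilinr (comp_out_bilin _ _ _ _ _ _ _ _) _).
- by move=> *; rewrite comp_in_natr bracket_dinat comp_out_natr.
by move=> *; apply: tube_mul_elt.
Qed.

End TubeSpace.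

(** * The weak bialgebra structure *)

Section TubeCoalgebra.
Variables (R : realType) (D : UMFC R).
Local Notation C := R[i].
Local Notation I := (Irr D).
Local Notation "1" := (unit_ob D).
Implicit Types (a b c e f h k s i : I) (A B : D).

Definition bracket_comul A B c e f h (v : hom_in A B c e) (w : hom_out A B f h) :
    tprod (Tube D) (Tube D) :=
  \sum_i \sum_k \sum_p
    tube_bracket (@bvec R D k (A ⊗ irr i ⊗ B) p : hom_in A B k i) w ⨂
    tube_bracket v (@bdual R D k (A ⊗ irr i ⊗ B) p : hom_out A B i k).

Lemma bracket_comul_bilin A B c e f h : bilin (@bracket_comul A B c e f h).
Proof.
do 2 apply: bilin_big => ?; apply: bilin_big => p.
apply: bilin_swap; apply: bilin_comp (tpure_bilin _ _) _ _.
  exact: bilinr (tube_bracket_bilin _ _ _ _ _ _) _.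
exact: bilinl (tube_bracket_bilin _ _ _ _ _ _) _.
Qed.

Lemma tube_comul_linear : linear (@tube_comul R D).
Proof. exact: tube_lift_linear. Qed.

Lemma tube_comul_elt a b c e f h (v : hom_in (irr a) (irr b) c e)
    (w : hom_out (irr a) (irr b) f h) :
  tube_comul (tube_elt v w) = bracket_comul v w.
Proof.
rewrite /tube_comul tube_lift_elt.
  do 2 (apply: eq_bigr => ? _); apply: eq_bigr => p _.
  by rewrite !tube_bracket_irr.
move=> *; do 2 apply: bilin_big => ?; apply: bilin_big => p.
apply: bilin_swap; apply: bilin_comp (tpure_bilin _ _) _ _.
  exact: bilinr (tube_elt_bilin _ _ _ _ _ _) _.
exact: bilinl (tube_elt_bilin _ _ _ _ _ _) _.
Qed.

Lemma tpure_bracket_bilin A B A' B' c e f h i k (v : hom_in A B c e) (w : hom_out A' B' f h) :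
  bilin (fun (x : hom_in A' B' k i) (y : hom_out A B i k) =>
    tube_bracket x w ⨂ tube_bracket v y).
Proof.
apply: bilin_comp (tpure_bilin _ _) _ _.
  exact: bilinl (tube_bracket_bilin _ _ _ _ _ _) _.
exact: bilinr (tube_bracket_bilin _ _ _ _ _ _) _.
Qed.

(** The right side is dinatural in the arcs because the canonical element of Hom(k, A i B) and Hom(A
    i B, k) is natural in [A] and [B]. *)
Lemma tube_comul_bracket A B c e f h (v : hom_in A B c e) (w : hom_out A B f h) :
  tube_comul (tube_bracket v w) = bracket_comul v w.
Proof.
apply: (bracket_univ (F := fun A B v w => bracket_comul v w)).
- exact: tube_comul_linear.
- by move=> *; apply: bilinr (bracket_comul_bilin _ _ _ _ _ _) _.
- move=> {}A A' {}B B' g g' {}v {}w.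
  apply: eq_bigr => i _; apply: eq_bigr => k _.
  have E := dual_bases_nat (g ⊠ idm (irr i) ⊠ g')
    (tpure_bracket_bilin i k v w).
  under eq_bigr do rewrite bracket_dinat.
  by rewrite -E; apply: eq_bigr => p _; rewrite bracket_dinat.
by move=> *; apply: tube_comul_elt.
Qed.

Definition bracket_counit A B c e f h (v : hom_in A B c e) (w : hom_out A B f h) : C :=
  irr_scalar (w ∘ (idm A ⊠ irr_delta e f ⊠ idm B) ∘ v ∘ irr_delta h c).

Lemma irr_scalar_lin k : linear (@irr_scalar R D k : _ -> C^o).
Proof. exact: irr_scalar_linear. Qed.

Lemma bracket_counit_bilin A B c e f h :
  bilin (@bracket_counit A B c e f h : _ -> _ -> C^o).
Proof.
split=> z x y u; rewrite /bracket_counit.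
  by rewrite !comp_linearl irr_scalar_lin.
by rewrite comp_linearr comp_linearl irr_scalar_lin.
Qed.

Lemma tube_counit_linear : scalar (@tube_counit R D).
Proof. exact: (tube_lift_linear (W := C^o)). Qed.

Lemma tube_counit_elt a b c e f h (v : hom_in (irr a) (irr b) c e)
    (w : hom_out (irr a) (irr b) f h) :
  tube_counit (tube_elt v w) = bracket_counit v w.
Proof.
rewrite /tube_counit tube_lift_elt // => *; exact: bracket_counit_bilin.
Qed.

Lemma tube_counit_bracket A B c e f h (v : hom_in A B c e) (w : hom_out A B f h) :
  tube_counit (tube_bracket v w) = bracket_counit v w.
Proof.
apply: (bracket_univ (W := C^o) (F := fun A B v w => bracket_counit v w)).
- exact: tube_counit_linear.
- by move=> *; apply: bilinr (bracket_counit_bilin _ _ _ _ _ _) _.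
- move=> *; rewrite /bracket_counit; congr (irr_scalar (_ ∘ _)).
  by rewrite !compoA; congr (_ ∘ _); rewrite -!compoA !tensM !idl !idr.
by move=> *; apply: tube_counit_elt.
Qed.

Lemma tlift_comul (W : vectType C) (F : Tube D -> Tube D -> W) A B c e f h
    (v : hom_in A B c e) (w : hom_out A B f h) : bilin F ->
  tlift F (bracket_comul v w) = \sum_i \sum_k \sum_p
    F (tube_bracket (@bvec R D k (A ⊗ irr i ⊗ B) p : hom_in A B k i) w)
      (tube_bracket v (@bdual R D k (A ⊗ irr i ⊗ B) p : hom_out A B i k)).
Proof.
move=> bF; rewrite (lin_sum (tlift_linear F)); apply: eq_bigr => i _.
rewrite (lin_sum (tlift_linear F)); apply: eq_bigr => k _.
exact: tlift_sum.
Qed.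

Lemma bracket_counit_neqef A B c e f h (v : hom_in A B c e) (w : hom_out A B f h) :
  e != f -> bracket_counit v w = 0.
Proof.
move=> ef; rewrite /bracket_counit (irr_delta_neq ef) tens0r tens0l comp0r !comp0l.
exact: irr_scalar0.
Qed.

Lemma bracket_counit_neqch A B c e f h (v : hom_in A B c e) (w : hom_out A B f h) :
  c != h -> bracket_counit v w = 0.
Proof.
by move=> ch; rewrite /bracket_counit [irr_delta h c]irr_delta_neq ?comp0r ?irr_scalar0 // eq_sym.
Qed.

Lemma bracket_counit_eq A B e h (v : hom_in A B h e) (w : hom_out A B e h) :
  bracket_counit v w = irr_scalar (w ∘ v).
Proof. by rewrite /bracket_counit !irr_delta_id !tens_idm !idr. Qed.

(** The counit keeps only [i = f] and [k = h], where its values are the coordinates of [w] in the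
    dual basis. *)
Lemma comul_counitl A B c e f h (v : hom_in A B c e) (w : hom_out A B f h) :
  tlift (fun x1 x2 => tube_counit x1 *: x2) (bracket_comul v w) = tube_bracket v w.
Proof.
rewrite tlift_comul; last exact: scale_bilin tube_counit_linear.
rewrite (sum_only1 (k := f)) => [|i ne]; last first.
  rewrite big1 // => k _; rewrite big1 // => p _.
  by rewrite tube_counit_bracket bracket_counit_neqef ?scale0r.
rewrite (sum_only1 (k := h)) => [|k ne]; last first.
  rewrite big1 // => p _.
  by rewrite tube_counit_bracket bracket_counit_neqch ?scale0r.
rewrite [w in RHS]bdual_expand (lin_sumZ (bilinr (tube_bracket_bilin _ _ _ _ _ _) v)).
by apply: eq_bigr => p _; rewrite tube_counit_bracket bracket_counit_eq.
Qed.

Lemma comul_counitr A B c e f h (v : hom_in A B c e) (w : hom_out A B f h) :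
  tlift (fun x1 x2 => tube_counit x2 *: x1) (bracket_comul v w) = tube_bracket v w.
Proof.
rewrite tlift_comul; last exact/bilin_swap/(scale_bilin _ tube_counit_linear).
rewrite (sum_only1 (k := e)) => [|i ne]; last first.
  rewrite big1 // => k _; rewrite big1 // => p _.
  by rewrite tube_counit_bracket bracket_counit_neqef ?scale0r // eq_sym.
rewrite (sum_only1 (k := c)) => [|k ne]; last first.
  rewrite big1 // => p _.
  by rewrite tube_counit_bracket bracket_counit_neqch ?scale0r // eq_sym.
rewrite [v in RHS]bvec_expand (lin_sumZ (bilinl (tube_bracket_bilin _ _ _ _ _ _) w)).
by apply: eq_bigr => p _; rewrite tube_counit_bracket bracket_counit_eq.
Qed.

(** Both sides insert two independent canonical elements between [w] and [v]; only the order of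
    summation differs. *)
Lemma comul_coassoc A B c e f h (v : hom_in A B c e) (w : hom_out A B f h) :
  Delta_id (@tube_comul R D) (bracket_comul v w) =
  tassoc (id_Delta (@tube_comul R D) (bracket_comul v w)).
Proof.
have bD : bilin (fun x y : Tube D => tube_comul x ⨂ y).
  exact: bilin_comp (tpure_bilin _ _) tube_comul_linear (@linear_id _ _).
have bD' : bilin (fun x y : Tube D => x ⨂ tube_comul y).
  exact: bilin_comp (tpure_bilin _ _) (@linear_id _ _) tube_comul_linear.
have lT := @tassoc_linear C (Tube D) (Tube D) (Tube D).
rewrite /Delta_id /id_Delta !tlift_comul //.
transitivity (\sum_i \sum_k \sum_(p < \dim {: hom (irr k) (A ⊗ irr i ⊗ B)})
    \sum_i' \sum_k' \sum_(p' < \dim {: hom (irr k') (A ⊗ irr i' ⊗ B)})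
      (tube_bracket (bvec p' : hom_in A B k' i') w ⨂
       tube_bracket (bvec p : hom_in A B k i) (bdual p' : hom_out A B i' k')) ⨂
      tube_bracket v (bdual p : hom_out A B i k)).
  do 2 (apply: eq_bigr => ? _); apply: eq_bigr => p _.
  rewrite tube_comul_bracket (lin_sum (bilinl (tpure_bilin _ _) _)).
  apply: eq_bigr => ? _; rewrite (lin_sum (bilinl (tpure_bilin _ _) _)).
  by apply: eq_bigr => ? _; rewrite (lin_sum (bilinl (tpure_bilin _ _) _)).
rewrite exchange_sum33 (lin_sum lT); apply: eq_bigr => i' _.
rewrite (lin_sum lT); apply: eq_bigr => k' _.
rewrite (lin_sum lT); apply: eq_bigr => p' _.
have lT' := linear_comp lT (bilinr (tpure_bilin _ _) (tube_bracket (bvec p' : hom_in A B k' i') w)).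
rewrite tube_comul_bracket (lin_sum lT'); apply: eq_bigr => i _.
rewrite (lin_sum lT'); apply: eq_bigr => k _.
rewrite (lin_sum lT'); apply: eq_bigr => p _.
by rewrite tassoc_pure.
Qed.

End TubeCoalgebra.

(** * The unit as a sum of orthogonal idempotents *)

Section TubeUnit.
Variables (R : realType) (D : UMFC R).
Local Notation C := R[i].
Local Notation I := (Irr D).
Local Notation "1" := (unit_ob D).
Local Notation U1 := (unit_ob D).
Implicit Types (a b c e f h k s i x y : I) (A B : D).

Lemma dag_unit_out (z : D) : (unit_out z)^† = unit_in z :> @hom R D _ _.
Proof. by rewrite -dag_unit_in dag_dag. Qed.

Lemma unit_inK (z : D) : unit_in z ∘ unit_out z = idm _ :> @hom R D _ _.
Proof. by rewrite -dag_unit_in; case: (unit_inU z). Qed.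

(** The arcs are the whole unit object rather than its simple summands, so that the unitors can act
    on them. *)
Definition unit_bracket y x : Tube D :=
  @tube_bracket R D 1 1 y y x x (unit_in (irr y)) (unit_out (irr x)).

Lemma unit_bracketE y x : unit_bracket y x =
  \sum_i \sum_j tube_elt
    (comp_proj i j (irr y) : hom_in (irr (unit_irr i)) (irr (unit_irr j)) y y)
    ((comp_proj i j (irr x))^† : hom_out (irr (unit_irr i)) (irr (unit_irr j)) x x).
Proof.
rewrite /unit_bracket -[unit_out _]idr -!tens_idm.
transitivity (@tube_bracket R D 1 1 y y x x (unit_in (irr y))
  (unit_out (irr x) ∘ (idm 1 ⊠ idm (irr x) ⊠ idm 1))); first by [].
rewrite -unit_inc_sum 2!tens_suml comp_sumr.
rewrite (lin_sum (bilinr (tube_bracket_bilin _ _ _ _ _ _) _)).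
apply: eq_bigr => i _.
rewrite tens_sumr comp_sumr (lin_sum (bilinr (tube_bracket_bilin _ _ _ _ _ _) _)).
apply: eq_bigr => j _.
rewrite -tube_bracket_irr /comp_proj dagM !dag_tens !dag_dag dag_idm dag_unit_in.
by rewrite bracket_dinat -compoA !tensM idl.
Qed.

Lemma tube_oneE : tube_one D = \sum_x \sum_y unit_bracket y x.
Proof.
under [RHS]eq_bigr => x _.
  under eq_bigr => y _ do rewrite unit_bracketE.
  rewrite exchange_big /=; under eq_bigr => i _ do rewrite exchange_big /=.
  over.
rewrite exchange_big /=; apply: eq_bigr => i _.
rewrite exchange_big /=; apply: eq_bigr => j _.
have proj0 x : ~~ `[< in_comp i j x >] -> comp_proj i j (@irr R D x) = 0.
  by move/asboolPn; apply: comp_proj_eq0; apply: irrS.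
rewrite big_mkcond /=; apply: eq_bigr => x _.
case: ifP => [_|/negbT/proj0 ->].
  rewrite big_mkcond /=; apply: eq_bigr => y _.
  case: ifP => [_|/negbT/proj0 ->].
    by rewrite /comp_proj dagM !dag_tens !dag_dag dag_idm dag_unit_in.
  by rewrite (lin_zero (bilinl (tube_elt_bilin _ _ _ _ _ _) _)).
rewrite big1 // => y _.
by rewrite dag0 (lin_zero (bilinr (tube_elt_bilin _ _ _ _ _ _) _)).
Qed.

Lemma comp_in_unitl A B c e (v : hom_in A B c e) :
  comp_in (unit_in (irr c) : hom_in U1 U1 c c) v =
  ((lunit A)^† ⊠ idm (irr e) ⊠ (runit B)^†) ∘ v.
Proof.
rewrite /comp_in irr_delta_id idr -compoA -unit_in_nat compoA; congr (_ ∘ _).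
have uU : unitary (lunit A ⊠ idm (irr e) ⊠ runit B).
  by do 2?apply: unitary_tens; [exact: lunitU|exact: unitary_idm|exact: runitU].
apply: (unitary_mono uU); rewrite compoA unit_in_rebracket.
by rewrite !tensM idl; case: (lunitU A) (runitU B) => _ -> [_ ->]; rewrite !tens_idm.
Qed.

Lemma comp_in_unitr A B c e (v : hom_in A B c e) :
  comp_in v (unit_in (irr e) : hom_in U1 U1 e e) =
  ((runit A)^† ⊠ idm (irr e) ⊠ (lunit B)^†) ∘ v.
Proof.
rewrite /comp_in irr_delta_id idr; congr (_ ∘ _).
have uU : unitary (runit A ⊠ idm (irr e) ⊠ lunit B).
  by do 2?apply: unitary_tens; [exact: runitU|exact: unitary_idm|exact: lunitU].
apply: (unitary_mono uU); rewrite compoA rebracket_unit_in.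
by rewrite !tensM idl; case: (runitU A) (lunitU B) => _ -> [_ ->]; rewrite !tens_idm.
Qed.

Lemma comp_out_unitl A B f h (w : hom_out A B f h) :
  comp_out (unit_out (irr h) : hom_out U1 U1 h h) w =
  w ∘ (lunit A ⊠ idm (irr f) ⊠ runit B).
Proof.
rewrite comp_out_dag dag_unit_out comp_in_unitl dagM !dag_tens !dag_dag.
by rewrite dag_idm.
Qed.

Lemma comp_out_unitr A B f h (w : hom_out A B f h) :
  comp_out w (unit_out (irr f) : hom_out U1 U1 f f) =
  w ∘ (runit A ⊠ idm (irr f) ⊠ lunit B).
Proof.
rewrite comp_out_dag dag_unit_out comp_in_unitr dagM !dag_tens !dag_dag.
by rewrite dag_idm.
Qed.

Lemma comp_in_neq A B A' B' c e c' e' (v : hom_in A B c e) (v' : hom_in A' B' c' e') :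
  e != c' -> comp_in v v' = 0.
Proof.
by move=> ne; rewrite /comp_in irr_delta_neq // !(comp0r, tens0r, tens0l, comp0l).
Qed.

Lemma comp_out_neq A B A' B' f h f' h' (w : hom_out A B f h) (w' : hom_out A' B' f' h') :
  f != h' -> comp_out w w' = 0.
Proof. by move=> ne; rewrite comp_out_dag comp_in_neq // dag0. Qed.

Lemma unit_bracket_mull A B c e f h (v : hom_in A B c e) (w : hom_out A B f h) y x :
  tube_mul (unit_bracket y x) (tube_bracket v w) =
  if (y == c) && (x == h) then tube_bracket v w else 0.
Proof.
rewrite tube_mul_bracket; have [->|yc] := eqVneq y c; last first.
  by rewrite comp_in_neq // (lin_zero (bilinl (tube_bracket_bilin _ _ _ _ _ _) _)).
have [->|xh] := eqVneq x h; last first.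
  by rewrite comp_out_neq // (lin_zero (bilinr (tube_bracket_bilin _ _ _ _ _ _) _)).
rewrite comp_in_unitl comp_out_unitl bracket_dinat -compoA !tensM idl.
by case: (lunitU A) (runitU B) => _ -> [_ ->]; rewrite !tens_idm idr.
Qed.

Lemma unit_bracket_mulr A B c e f h (v : hom_in A B c e) (w : hom_out A B f h) y x :
  tube_mul (tube_bracket v w) (unit_bracket y x) =
  if (y == e) && (x == f) then tube_bracket v w else 0.
Proof.
rewrite tube_mul_bracket; have [->|ye] := eqVneq y e; last first.
  rewrite comp_in_neq 1?eq_sym //.
  by rewrite (lin_zero (bilinl (tube_bracket_bilin _ _ _ _ _ _) _)).
have [->|xf] := eqVneq x f; last first.
  rewrite comp_out_neq 1?eq_sym //.
  by rewrite (lin_zero (bilinr (tube_bracket_bilin _ _ _ _ _ _) _)).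
rewrite comp_in_unitr comp_out_unitr bracket_dinat -compoA !tensM idl.
by case: (runitU A) (lunitU B) => _ -> [_ ->]; rewrite !tens_idm idr.
Qed.

(** With unit arcs, Hom(k, 1 i 1) is Hom(k, i) by [unit_in], and [canonical_irr] leaves the single
    term [k = i]. *)
Lemma unit_bracket_comul y x :
  tube_comul (unit_bracket y x) = \sum_i unit_bracket i x ⨂ unit_bracket y i.
Proof.
rewrite tube_comul_bracket; apply: eq_bigr => i _.
have bF k : bilin (fun (u : hom (irr k) (1 ⊗ irr i ⊗ 1)) (z : hom (irr i) (irr k)) =>
    tube_bracket (u : hom_in U1 U1 k i) (unit_out (irr x) : hom_out U1 U1 x x) ⨂
    tube_bracket (unit_in (irr y) : hom_in U1 U1 y y)
      (z ∘ unit_out (irr i) : hom_out U1 U1 i k)).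
  apply: bilin_comp (tpure_bilin _ _) _ _.
    exact: bilinl (tube_bracket_bilin _ _ _ _ _ _) _.
  by move=> c z z'; rewrite comp_linearl (bilinr (tube_bracket_bilin _ _ _ _ _ _) _).
have E k := dual_bases_nat (unit_in (irr i)) (bF k).
transitivity (\sum_k \sum_p tube_bracket (unit_in (irr i) ∘ bvec p : hom_in U1 U1 k i)
    (unit_out (irr x) : hom_out U1 U1 x x) ⨂
    tube_bracket (unit_in (irr y) : hom_in U1 U1 y y)
      (bdual p ∘ unit_out (irr i) : hom_out U1 U1 i k)).
  apply: eq_bigr => k _; rewrite E; apply: eq_bigr => p _.
  by rewrite -compoA unit_inK idr.
rewrite (canonical_irr (F := fun k (u : hom (irr k) (irr i)) u' =>
  tube_bracket (unit_in (irr i) ∘ u : hom_in U1 U1 k i)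
    (unit_out (irr x) : hom_out U1 U1 x x) ⨂
  tube_bracket (unit_in (irr y) : hom_in U1 U1 y y)
      (u' ∘ unit_out (irr i) : hom_out U1 U1 i k))) => [|k].
  by rewrite idr idl.
apply: (bilin_comp (f := fun u => unit_in (irr i) ∘ u) (g := id) (bF k)) => //.
exact: comp_linearr.
Qed.

End TubeUnit.

(** * Associativity, multiplicativity of the comultiplication, and the weak unit axiom *)

Section TubeWeakBialgebra.
Variables (R : realType) (D : UMFC R).
Local Notation C := R[i].
Local Notation I := (Irr D).
Implicit Types (a b c e f h k s i x y : I) (A B : D).

Lemma act_comp A B (x y z : D) (g : hom y z) (f : hom x y) :
  idm A ⊠ (g ∘ f) ⊠ idm B = (idm A ⊠ g ⊠ idm B) ∘ (idm A ⊠ f ⊠ idm B).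
Proof. by rewrite !tensM !idl. Qed.

Lemma comp_inA A B A' B' A'' B'' c e c' e' c'' e'' (v : hom_in A B c e)
    (v' : hom_in A' B' c' e') (v'' : hom_in A'' B'' c'' e'') :
  comp_in v (comp_in v' v'') =
  (assoc A A' A'' ⊠ idm (irr e'') ⊠ (assoc B'' B' B)^†) ∘ comp_in (comp_in v v') v''.
Proof.
have E1 := rebracketA A A' A'' (irr e'') B'' B' B.
have E2 := rebracket_nat (idm A) (idm A') (v'' ∘ irr_delta e' c'') (idm B') (idm B).
rewrite /comp_in; move: E1 E2; rewrite !tens_idm.
set X := v'' ∘ _; set Y := v' ∘ _.
set r1 := rebracket _ _ _ _ _; set r2 := rebracket _ _ _ _ _.
set r3 := rebracket _ _ _ _ _; set r4 := rebracket _ _ _ _ _.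
set r5 := rebracket _ _ _ _ _.
rewrite -[_ ∘ v' ∘ _]compoA -/Y.
(* The coherence isomorphisms are made opaque, so that reassociation leaves them whole. *)
move: r1 r2 r3 r4 r5 X Y => r1 r2 r3 r4 r5 X Y E1 E2.
rewrite !act_comp !compoA -E1; congr (_ ∘ _ ∘ _).
by rewrite -[_ ∘ r2 ∘ _]compoA E2 !compoA.
Qed.

Lemma comp_outA A B A' B' A'' B'' f h f' h' f'' h'' (w : hom_out A B f h)
    (w' : hom_out A' B' f' h') (w'' : hom_out A'' B'' f'' h'') :
  comp_out w (comp_out w' w'') =
  comp_out (comp_out w w') w'' ∘
    ((assoc A A' A'')^† ⊠ idm (irr f'') ⊠ assoc B'' B' B).
Proof.
rewrite !comp_out_dag !dag_dag comp_inA dagM !dag_tens !dag_dag dag_idm.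
by [].
Qed.

(** The two products differ by associators on the upper leg and by their inverses on the lower leg;
    dinaturality brings them together. *)
Lemma tube_mulA_bracket A B A' B' A'' B'' c e f h c' e' f' h' c'' e'' f'' h''
    (v : hom_in A B c e) (w : hom_out A B f h)
    (v' : hom_in A' B' c' e') (w' : hom_out A' B' f' h')
    (v'' : hom_in A'' B'' c'' e'') (w'' : hom_out A'' B'' f'' h'') :
  tube_mul (tube_bracket v w) (tube_mul (tube_bracket v' w') (tube_bracket v'' w'')) =
  tube_mul (tube_mul (tube_bracket v w) (tube_bracket v' w')) (tube_bracket v'' w'').
Proof.
rewrite !tube_mul_bracket comp_inA comp_outA bracket_dinat -compoA !tensM idl.
by case: (assocU A A' A'') (assocU B'' B' B) => -> _ [_ ->]; rewrite !tens_idm idr.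
Qed.

Lemma tube_mulA : associative (@tube_mul R D).
Proof.
have bM := @tube_mul_bilin R D.
move=> x y z; move: x; apply: tube_ext => [||a b c e f h v w].
- exact: bilinl bM _.
- exact: linear_comp (bilinl bM z) (bilinl bM y).
move: y; apply: tube_ext => [||a' b' c' e' f' h' v' w'].
- exact: linear_comp (bilinr bM _) (bilinl bM z).
- exact: linear_comp (bilinl bM z) (bilinr bM _).
move: z; apply: tube_ext => [||a'' b'' c'' e'' f'' h'' v'' w''].
- exact: linear_comp (bilinr bM _) (bilinr bM _).
- exact: bilinr bM _.
by rewrite -!tube_bracket_irr tube_mulA_bracket.
Qed.

Lemma tube_mul1 : left_id (tube_one D) (@tube_mul R D).
Proof.
have bM := @tube_mul_bilin R D.
apply: tube_ext => [||a b c e f h v w]; [exact: bilinr bM _|by []|].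
rewrite tube_oneE (lin_sum (bilinl bM _)) -tube_bracket_irr.
rewrite -[RHS](sum_if2 c h (fun _ _ => tube_bracket v w)).
apply: eq_bigr => x _; rewrite (lin_sum (bilinl bM _)); apply: eq_bigr => y _.
exact: unit_bracket_mull.
Qed.

Lemma tube_mulr1 : right_id (tube_one D) (@tube_mul R D).
Proof.
have bM := @tube_mul_bilin R D.
apply: tube_ext => [||a b c e f h v w]; [exact: bilinl bM _|by []|].
rewrite tube_oneE (lin_sum (bilinr bM _)) -tube_bracket_irr.
rewrite -[RHS](sum_if2 e f (fun _ _ => tube_bracket v w)).
apply: eq_bigr => x _; rewrite (lin_sum (bilinr bM _)); apply: eq_bigr => y _.
exact: unit_bracket_mulr.
Qed.

Lemma tube_algebra : is_algebra (@tube_mul R D) (tube_one D).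
Proof.
by split; [exact: tube_mul_bilin|exact: tube_mulA|exact: tube_mul1|exact: tube_mulr1].
Qed.

Lemma tube_coalgebra : is_coalgebra (@tube_comul R D) (@tube_counit R D).
Proof.
have lD := @tube_comul_linear R D; have le := @tube_counit_linear R D.
split=> //.
- apply: tube_ext => [||a b c e f h v w].
  + exact: linear_comp (tlift_linear _) lD.
  + exact: linear_comp (@tassoc_linear _ _ _ _) (linear_comp (tlift_linear _) lD).
  by rewrite -tube_bracket_irr tube_comul_bracket comul_coassoc.
- apply: tube_ext => [||a b c e f h v w]; [exact: linear_comp (tlift_linear _) lD|by []|].
  by rewrite -tube_bracket_irr tube_comul_bracket comul_counitl.
apply: tube_ext => [||a b c e f h v w]; [exact: linear_comp (tlift_linear _) lD|by []|].
by rewrite -tube_bracket_irr tube_comul_bracket comul_counitr.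
Qed.

(** The inner basis vector passes from the upper leg to the lower one by [dual_bases_nat] and meets
    its dual there; summed over [k'] and [p'], the pair is the identity of [A' ⊗ irr i' ⊗ B']. *)
Lemma comp_canonical (W : vectType C) A B A' B' i' k
    (F : hom_in (A ⊗ A') (B' ⊗ B) k i' -> hom_out (A ⊗ A') (B' ⊗ B) i' k -> W) :
  bilin F ->
  \sum_i \sum_k' \sum_p' \sum_p
    F (comp_in (@bvec R D k (A ⊗ irr i ⊗ B) p : hom_in A B k i)
         (@bvec R D k' (A' ⊗ irr i' ⊗ B') p' : hom_in A' B' k' i'))
      (comp_out (@bdual R D k (A ⊗ irr i ⊗ B) p : hom_out A B i k)
         (@bdual R D k' (A' ⊗ irr i' ⊗ B') p' : hom_out A' B' i' k')) =
  \sum_q F (bvec q) (bdual q).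
Proof.
move=> bF; rewrite exchange_big /=.
transitivity (\sum_k' \sum_(p' < \dim {: hom (irr k') (A' ⊗ irr i' ⊗ B')})
    \sum_(q < \dim {: hom (irr k) ((A ⊗ A') ⊗ irr i' ⊗ (B' ⊗ B))})
  F (bvec q) (bdual q ∘ (rebracket A A' (irr i') B' B ∘
    (idm A ⊠ (bvec p' ∘ bdual p') ⊠ idm B) ∘
    (rebracket A A' (irr i') B' B)^†))).
  apply: eq_bigr => k' _; rewrite (sum_only1 (k := k')) => [|i ik]; last first.
    rewrite big1 // => p' _; rewrite big1 // => p _.
    by rewrite comp_in_neq // (lin_zero (bilinl bF _)).
  apply: eq_bigr => p' _.
  have bF' : bilin (fun (u : hom (irr k) ((A ⊗ A') ⊗ irr i' ⊗ (B' ⊗ B)))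
      (z : hom (A ⊗ irr k' ⊗ B) (irr k)) =>
      F u (z ∘ (idm A ⊠ bdual p' ⊠ idm B) ∘ (rebracket A A' (irr i') B' B)^†)).
    split=> z t u u'; first by rewrite !comp_linearl (bilinr bF).
    exact: (bilinl bF).
  (* Replaces the basis of Hom(k, A k' B) by that of Hom(k, (A A') i' (B' B)). *)
  have := dual_bases_nat (rebracket A A' (irr i') B' B ∘ (idm A ⊠ bvec p' ⊠ idm B)) bF'.
  rewrite /comp_in /comp_out; under eq_bigr do rewrite ?irr_delta_id ?idl ?idr.
  move=> ->; apply: eq_bigr => q _; congr (F _ _); rewrite act_comp.
  by move: (rebracket _ _ _ _ _) => r; rewrite !compoA.
transitivity (\sum_k' \sum_(q < \dim {: hom (irr k) ((A ⊗ A') ⊗ irr i' ⊗ (B' ⊗ B))})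
    \sum_(p' < \dim {: hom (irr k') (A' ⊗ irr i' ⊗ B')})
  F (bvec q) (bdual q ∘ (rebracket A A' (irr i') B' B ∘
    (idm A ⊠ (bvec p' ∘ bdual p') ⊠ idm B) ∘
    (rebracket A A' (irr i') B' B)^†))).
  by apply: eq_bigr => k' _; apply: exchange_big.
rewrite exchange_big /=; apply: eq_bigr => q _.
have lL : linear (fun z : hom (A' ⊗ irr i' ⊗ B') (A' ⊗ irr i' ⊗ B') =>
    F (bvec q) (bdual q ∘ (rebracket A A' (irr i') B' B ∘ (idm A ⊠ z ⊠ idm B) ∘
    (rebracket A A' (irr i') B' B)^†))).
  move=> t z z'; rewrite tens_linearr tens_linearl comp_linearr comp_linearl.
  by rewrite comp_linearr (bilinr bF).
transitivity (F (bvec q) (bdual q ∘ (rebracket A A' (irr i') B' B ∘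
    (idm A ⊠ idm (A' ⊗ irr i' ⊗ B') ⊠ idm B) ∘ (rebracket A A' (irr i') B' B)^†))).
  rewrite -(irr_decomp (A' ⊗ irr i' ⊗ B')) (lin_sum lL); apply: eq_bigr => k' _.
  by rewrite (lin_sum lL).
rewrite !tens_idm idr; have [_ ->] := rebracketU A A' (irr i') B' B.
by rewrite idr.
Qed.

(** Filling the hole of a product with [g] nests the inner diagram in the outer one: [g] is slid
    through the rebracketing, which then meets its inverse. *)
Lemma comp_mid A B A' B' c e f h c' e' f' h' (v : hom_in A B c e) (w : hom_out A B f h)
    (v' : hom_in A' B' c' e') (w' : hom_out A' B' f' h') (g : hom (irr e') (irr f')) :
  comp_out w w' ∘ (idm (A ⊗ A') ⊠ g ⊠ idm (B' ⊗ B)) ∘ comp_in v v' =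
  w ∘ (idm A ⊠ (irr_delta h' f ∘ w' ∘ (idm A' ⊠ g ⊠ idm B') ∘ v' ∘ irr_delta e c') ⊠ idm B) ∘ v.
Proof.
have E := rebracket_nat (idm A) (idm A') g (idm B') (idm B).
have U1 := rebracketU A A' (irr e') B' B.
have U2 := rebracketU A A' (irr f') B' B.
rewrite /comp_in /comp_out -[_ ∘ v' ∘ irr_delta e c']compoA.
move: U1 U2 E; rewrite !tens_idm.
set X := v' ∘ _; set Y := _ ∘ w'.
set r1 := rebracket _ _ _ _ _; set r2 := rebracket _ _ _ _ _.
move: r1 r2 X Y => r1 r2 X Y U1 U2 E.
by rewrite !act_comp !compoA -[_ ∘ _ ∘ r1]compoA -E -[_ ∘ r2^† ∘ _]compoA compKU //.
Qed.

Definition bracket_mid A B c e f h e' f' (v : hom_in A B c e) (w : hom_out A B f h) :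
    hom (irr e') (irr f') :=
  irr_delta h f' ∘ w ∘ (idm A ⊠ irr_delta e f ⊠ idm B) ∘ v ∘ irr_delta e' c.

Lemma counit_mul A B A' B' c e f h c' e' f' h' (v : hom_in A B c e) (w : hom_out A B f h)
    (v' : hom_in A' B' c' e') (w' : hom_out A' B' f' h') :
  tube_counit (tube_mul (tube_bracket v w) (tube_bracket v' w')) =
  irr_scalar (w ∘ (idm A ⊠ bracket_mid e f v' w' ⊠ idm B) ∘ v ∘ irr_delta h c).
Proof. by rewrite tube_mul_bracket tube_counit_bracket /bracket_counit comp_mid. Qed.

Lemma comul_mul A B A' B' c e f h c' e' f' h' (v : hom_in A B c e) (w : hom_out A B f h)
    (v' : hom_in A' B' c' e') (w' : hom_out A' B' f' h') :
  bracket_comul (comp_in v v') (comp_out w w') =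
  tmul (@tube_mul R D) (@tube_mul R D) (bracket_comul v w) (bracket_comul v' w').
Proof.
have bM := @tube_mul_bilin R D.
have bT := @tmul_bilin _ (Tube D) (Tube D) (@tube_mul R D) (@tube_mul R D).
symmetry; transitivity (\sum_i \sum_k \sum_(p < \dim {: hom (irr k) (A ⊗ irr i ⊗ B)})
  \sum_i' \sum_k' \sum_(p' < \dim {: hom (irr k') (A' ⊗ irr i' ⊗ B')})
  tube_bracket (comp_in (bvec p : hom_in A B k i) (bvec p' : hom_in A' B' k' i'))
    (comp_out w w') ⨂
  tube_bracket (comp_in v v')
    (comp_out (bdual p : hom_out A B i k) (bdual p' : hom_out A' B' i' k'))).
  do 3 (rewrite (lin_sum (bilinl bT _)); apply: eq_bigr => ? _).
  do 3 (rewrite (lin_sum (bilinr bT _)); apply: eq_bigr => ? _).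
  by rewrite tmul_pure // !tube_mul_bracket.
transitivity (\sum_i' \sum_k \sum_i \sum_k'
  \sum_(p' < \dim {: hom (irr k') (A' ⊗ irr i' ⊗ B')})
  \sum_(p < \dim {: hom (irr k) (A ⊗ irr i ⊗ B)})
  tube_bracket (comp_in (bvec p : hom_in A B k i) (bvec p' : hom_in A' B' k' i'))
    (comp_out w w') ⨂
  tube_bracket (comp_in v v')
    (comp_out (bdual p : hom_out A B i k) (bdual p' : hom_out A' B' i' k'))).
  rewrite exchange_big /= [RHS]exchange_big /=; apply: eq_bigr => k _.
  rewrite [RHS]exchange_big /=; apply: eq_bigr => i _.
  exact: exchange_sum3.
apply: eq_bigr => i' _; apply: eq_bigr => k _.
exact: (comp_canonical (tpure_bracket_bilin i' k (comp_in v v') (comp_out w w'))).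
Qed.

Lemma tube_comulM (x y : Tube D) :
  tube_comul (tube_mul x y) = tmul (@tube_mul R D) (@tube_mul R D) (tube_comul x) (tube_comul y).
Proof.
have bM := @tube_mul_bilin R D; have lD := @tube_comul_linear R D.
have bT := @tmul_bilin _ (Tube D) (Tube D) (@tube_mul R D) (@tube_mul R D).
move: x; apply: tube_ext => [||a b c e f h v w].
- exact: linear_comp lD (bilinl bM y).
- exact: linear_comp (bilinl bT _) lD.
move: y; apply: tube_ext => [||a' b' c' e' f' h' v' w'].
- exact: linear_comp lD (bilinr bM _).
- exact: linear_comp (bilinr bT _) lD.
by rewrite -!tube_bracket_irr tube_mul_bracket !tube_comul_bracket comul_mul.
Qed.

Lemma tube_comul_one :
  tube_comul (tube_one D) = \sum_x \sum_y \sum_i unit_bracket i x ⨂ unit_bracket y i.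
Proof.
have lD := @tube_comul_linear R D.
rewrite tube_oneE (lin_sum lD); apply: eq_bigr => x _.
by rewrite (lin_sum lD); apply: eq_bigr => y _; rewrite unit_bracket_comul.
Qed.

Lemma Delta_id_comul_one : Delta_id (@tube_comul R D) (tube_comul (tube_one D)) =
  \sum_x \sum_i \sum_y \sum_j
    (unit_bracket i x ⨂ unit_bracket j i) ⨂ unit_bracket y j.
Proof.
have bD : bilin (fun x y : Tube D => tube_comul x ⨂ y).
  exact: bilin_comp (tpure_bilin _ _) (@tube_comul_linear R D) (@linear_id _ _).
have lD := tlift_linear (fun x y : Tube D => tube_comul x ⨂ y).
rewrite tube_comul_one /Delta_id (lin_sum lD); apply: eq_bigr => x _.
rewrite (lin_sum lD) [RHS]exchange_big; apply: eq_bigr => y _ /=.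
rewrite (lin_sum lD) [RHS]exchange_big; apply: eq_bigr => j _ /=.
rewrite tlift_pure // unit_bracket_comul.
by rewrite (lin_sum (bilinl (tpure_bilin _ _) _)).
Qed.

Lemma comul_one_pure1 : tube_comul (tube_one D) ⨂ tube_one D =
  \sum_x \sum_y \sum_i (unit_bracket i x ⨂ unit_bracket y i) ⨂ tube_one D.
Proof.
have lT := bilinl (tpure_bilin (tprod (Tube D) (Tube D)) (Tube D)) (tube_one D).
rewrite tube_comul_one; do 2 (rewrite (lin_sum lT); apply: eq_bigr => ? _).
by rewrite (lin_sum lT).
Qed.

Lemma tassoc_pure1_comul_one : tassoc (tube_one D ⨂ tube_comul (tube_one D)) =
  \sum_x \sum_y \sum_i (tube_one D ⨂ unit_bracket i x) ⨂ unit_bracket y i.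
Proof.
have lT := linear_comp (@tassoc_linear _ (Tube D) (Tube D) (Tube D))
  (bilinr (tpure_bilin (Tube D) (tprod (Tube D) (Tube D))) (tube_one D)).
rewrite tube_comul_one; do 2 (rewrite (lin_sum lT); apply: eq_bigr => ? _).
by rewrite (lin_sum lT); apply: eq_bigr => ? _; apply: tassoc_pure.
Qed.

Lemma unit_bracketM y x y' x' :
  tube_mul (unit_bracket y x) (unit_bracket y' x') =
  if (y == y') && (x == x') then @unit_bracket R D y x else 0.
Proof.
rewrite unit_bracket_mull; case: andP => // -[/eqP -> /eqP ->].
by [].
Qed.

(** Only the middle tensor factor multiplies two idempotents, and their orthogonality contracts six
    indices to four. In [tube_comul_one21] the same idempotents are multiplied in the other
    order. *)
Lemma tube_comul_one12 : Delta_id (@tube_comul R D) (tube_comul (tube_one D)) =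
  mul3 (@tube_mul R D) (tube_comul (tube_one D) ⨂ tube_one D)
    (tassoc (tube_one D ⨂ tube_comul (tube_one D))).
Proof.
have bM := @tube_mul_bilin R D.
have bT := @tmul_bilin _ _ _ (@tube_mul R D) (@tube_mul R D).
have bT3 := @tmul_bilin _ _ _ (tmul (@tube_mul R D) (@tube_mul R D)) (@tube_mul R D).
rewrite /mul3 Delta_id_comul_one comul_one_pure1 tassoc_pure1_comul_one -sum_if_contract.
do 3 (rewrite (lin_sum (bilinl bT3 _)); apply: eq_bigr => ? _).
do 3 (rewrite (lin_sum (bilinr bT3 _)); apply: eq_bigr => ? _).
rewrite !tmul_pure // tube_mul1 tube_mulr1 unit_bracketM.
case: ifP => [/andP[/eqP -> //]|_].
by rewrite (lin_zero (bilinr (tpure_bilin _ _) _)) (lin_zero (bilinl (tpure_bilin _ _) _)).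
Qed.

Lemma tube_comul_one21 : Delta_id (@tube_comul R D) (tube_comul (tube_one D)) =
  mul3 (@tube_mul R D) (tassoc (tube_one D ⨂ tube_comul (tube_one D)))
    (tube_comul (tube_one D) ⨂ tube_one D).
Proof.
have bM := @tube_mul_bilin R D.
have bT := @tmul_bilin _ _ _ (@tube_mul R D) (@tube_mul R D).
have bT3 := @tmul_bilin _ _ _ (tmul (@tube_mul R D) (@tube_mul R D)) (@tube_mul R D).
rewrite /mul3 Delta_id_comul_one comul_one_pure1 tassoc_pure1_comul_one -sum_if_contract.
do 3 (rewrite (lin_sum (bilinr bT3 _)); apply: eq_bigr => ? _).
do 3 (rewrite (lin_sum (bilinl bT3 _)); apply: eq_bigr => ? _).
rewrite !tmul_pure // tube_mul1 tube_mulr1 unit_bracketM eq_sym [X in _ && X]eq_sym.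
case: ifP => [/andP[/eqP -> /eqP -> //]|_].
by rewrite (lin_zero (bilinr (tpure_bilin _ _) _)) (lin_zero (bilinl (tpure_bilin _ _) _)).
Qed.

End TubeWeakBialgebra.

(** * The weak multiplicativity of the counit *)

Section TubeCounit.
Variables (R : realType) (D : UMFC R).
Local Notation C := R[i].
Local Notation I := (Irr D).
Implicit Types (a b c e f h k s i : I) (A B : D).

Lemma bracket_mid_neqef A B c e f h e' f' (v : hom_in A B c e) (w : hom_out A B f h) :
  e != f -> bracket_mid e' f' v w = 0.
Proof.
move=> ne; rewrite /bracket_mid (irr_delta_neq ne) tens0r tens0l.
by rewrite comp0r !comp0l.
Qed.

Lemma bracket_mid_neqc A B c e f h e' f' (v : hom_in A B c e) (w : hom_out A B f h) :
  e' != c -> bracket_mid e' f' v w = 0.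
Proof. by move=> ne; rewrite /bracket_mid (irr_delta_neq ne) comp0r. Qed.

Lemma bracket_mid_neqh A B c e f h e' f' (v : hom_in A B c e) (w : hom_out A B f h) :
  h != f' -> bracket_mid e' f' v w = 0.
Proof. by move=> ne; rewrite /bracket_mid (irr_delta_neq ne) !comp0l. Qed.

Lemma irr_scalar_deltaC k s (g : hom (@irr R D k) (irr s)) :
  irr_scalar (g ∘ irr_delta s k) = irr_scalar (irr_delta s k ∘ g).
Proof.
have [E|ne] := eqVneq s k; first by move: g; rewrite E => g; rewrite irr_delta_id idl idr.
by rewrite irr_delta_neq // comp0l comp0r !irr_scalar0.
Qed.

Section CounitBracket.
Variables (A B A' B' A'' B'' : D) (c e f h c' e' f' h' c'' e'' f'' h'' : I).
Variables (v : hom_in A B c e) (w : hom_out A B f h).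
Variables (v' : hom_in A' B' c' e') (w' : hom_out A' B' f' h').
Variables (v'' : hom_in A'' B'' c'' e'') (w'' : hom_out A'' B'' f'' h'').

Let G (t : hom (irr e) (irr f)) : C :=
  irr_scalar (w ∘ (idm A ⊠ t ⊠ idm B) ∘ v ∘ irr_delta h c).

Let G_linear : linear (G : _ -> C^o).
Proof.
move=> z t u; rewrite /G tens_linearr tens_linearl comp_linearr !comp_linearl.
exact: irr_scalar_lin.
Qed.

Let G0 : G 0 = 0.
Proof. exact: lin_zero G_linear. Qed.

(** Three nested diagrams; [G] closes the outer one around a morphism from [irr e] to [irr f]. *)
Lemma counit_mul3 :
  tube_counit (tube_mul (tube_mul (tube_bracket v w) (tube_bracket v' w'))
    (tube_bracket v'' w'')) =
  G (irr_delta h' f ∘ w' ∘ (idm A' ⊠ bracket_mid e' f' v'' w'' ⊠ idm B') ∘ v' ∘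
     irr_delta e c').
Proof.
rewrite -tube_mulA [tube_mul (tube_bracket v' w') _]tube_mul_bracket counit_mul.
rewrite -/(G _); congr G; rewrite /bracket_mid -comp_mid; congr (_ ∘ _ ∘ _ ∘ _).
rewrite /comp_out; move: (rebracket _ _ _ _ _) => r.
by rewrite !compoA.
Qed.

(** The morphism from [irr e] to [A' ⊗ irr f' ⊗ B'] given by the innermost diagram and [v'] is
    expanded in the basis inserted by the comultiplication. The deltas select [i = f'] and
    [k = e]. *)
Lemma counit12_bracket :
  tube_counit (tube_mul (tube_mul (tube_bracket v w) (tube_bracket v' w'))
    (tube_bracket v'' w'')) =
  tlift (fun y1 y2 => tube_counit (tube_mul (tube_bracket v w) y1) *
     tube_counit (tube_mul y2 (tube_bracket v'' w'')) : C^o)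
    (tube_comul (tube_bracket v' w')).
Proof.
have bM := @tube_mul_bilin R D; have le := @tube_counit_linear R D.
rewrite counit_mul3 tube_comul_bracket tlift_comul; last first.
  apply: scalar_mul_bilin => z u u'; first by rewrite (bilinr bM) le.
  by rewrite (bilinl bM) le.
rewrite (sum_only1 (k := f')) => [|i ne]; last first.
  rewrite big1 // => k _; rewrite big1 // => p _.
  by rewrite counit_mul -/(G _) bracket_mid_neqef // G0 mul0r.
rewrite (sum_only1 (k := e)) => [|k ne]; last first.
  rewrite big1 // => p _.
  by rewrite counit_mul -/(G _) bracket_mid_neqc 1?eq_sym // G0 mul0r.
rewrite -2!compoA [X in _ ∘ X]bvec_expand comp_sumr (lin_sum G_linear).
apply: eq_bigr => p _; rewrite compZr (lin_scale G_linear) [RHS]mulrC !counit_mul.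
congr (_ * _); first by rewrite 2!compoA.
by rewrite -/(G _) {1}/bracket_mid !irr_delta_id !tens_idm !idr.
Qed.

(** Here it is the innermost diagram followed by [w'], a morphism to [irr f], that is expanded, in
    the dual basis; the deltas select [i = e'] and [k = f]. *)
Lemma counit21_bracket :
  tube_counit (tube_mul (tube_mul (tube_bracket v w) (tube_bracket v' w'))
    (tube_bracket v'' w'')) =
  tlift (fun y1 y2 => tube_counit (tube_mul (tube_bracket v w) y2) *
     tube_counit (tube_mul y1 (tube_bracket v'' w'')) : C^o)
    (tube_comul (tube_bracket v' w')).
Proof.
have bM := @tube_mul_bilin R D; have le := @tube_counit_linear R D.
rewrite counit_mul3 tube_comul_bracket tlift_comul; last first.
  apply: bilin_swap; apply: scalar_mul_bilin => z u u'; first by rewrite (bilinr bM) le.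
  by rewrite (bilinl bM) le.
rewrite (sum_only1 (k := e')) => [|i ne]; last first.
  rewrite big1 // => k _; rewrite big1 // => p _.
  by rewrite counit_mul -/(G _) bracket_mid_neqef 1?eq_sym // G0 mul0r.
rewrite (sum_only1 (k := f)) => [|k ne]; last first.
  rewrite big1 // => p _.
  by rewrite counit_mul -/(G _) bracket_mid_neqh // G0 mul0r.
set N := _ ∘ w' ∘ _.
rewrite [N]bdual_expand !comp_suml (lin_sum G_linear).
apply: eq_bigr => p _; rewrite !compZl (lin_scale G_linear) [RHS]mulrC !counit_mul.
congr (_ * _); first by rewrite irr_scalar_deltaC !compoA.
by rewrite -/(G _) {1}/bracket_mid !irr_delta_id !tens_idm idl idr.
Qed.

End CounitBracket.

Lemma tube_counit_trilinear (F G : Tube D -> Tube D -> Tube D -> C^o) :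
  (forall x y, linear (F x y)) -> (forall x z, linear (fun y => F x y z)) ->
  (forall y z, linear (fun x => F x y z)) ->
  (forall x y, linear (G x y)) -> (forall x z, linear (fun y => G x y z)) ->
  (forall y z, linear (fun x => G x y z)) ->
  (forall a b c e f h (v : hom_in (irr a) (irr b) c e) (w : hom_out (irr a) (irr b) f h)
      a' b' c' e' f' h' (v' : hom_in (irr a') (irr b') c' e')
      (w' : hom_out (irr a') (irr b') f' h')
      a'' b'' c'' e'' f'' h'' (v'' : hom_in (irr a'') (irr b'') c'' e'')
      (w'' : hom_out (irr a'') (irr b'') f'' h''),
    F (tube_bracket v w) (tube_bracket v' w') (tube_bracket v'' w'') =
    G (tube_bracket v w) (tube_bracket v' w') (tube_bracket v'' w'')) ->
  forall x y z, F x y z = G x y z.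
Proof.
move=> F3 F2 F1 G3 G2 G1 FG x y z.
move: x; apply: (tube_ext (F1 y z) (G1 y z)) => a b c e f h v w.
move: y; apply: (tube_ext (F2 _ z) (G2 _ z)) => a' b' c' e' f' h' v' w'.
move: z; apply: (tube_ext (F3 _ _) (G3 _ _)) => a'' b'' c'' e'' f'' h'' v'' w''.
by rewrite -!tube_bracket_irr.
Qed.

Lemma tube_counitM12 (x y z : Tube D) : tube_counit (tube_mul (tube_mul x y) z) =
  tlift (fun y1 y2 => tube_counit (tube_mul x y1) * tube_counit (tube_mul y2 z) : C^o)
    (tube_comul y).
Proof.
have bM := @tube_mul_bilin R D.
have le : linear (@tube_counit R D : _ -> C^o) by exact: tube_counit_linear.
move: x y z; apply: tube_counit_trilinear => [x y|x z|y z|x y|x z|y z|].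
- exact: linear_comp le (bilinr bM _).
- exact: linear_comp le (linear_comp (bilinl bM z) (bilinr bM x)).
- exact: linear_comp le (linear_comp (bilinl bM z) (bilinl bM y)).
- apply: tlift_param_linear => y1 y2.
  by apply: (linear_scaler (V := C^o)); apply: linear_comp le (bilinr bM _).
- exact: linear_comp (tlift_linear _) (@tube_comul_linear R D).
- apply: tlift_param_linear => y1 y2.
  by apply: (linear_scalel (V := C^o)); apply: linear_comp le (bilinl bM _).
by move=> *; apply: counit12_bracket.
Qed.

Lemma tube_counitM21 (x y z : Tube D) : tube_counit (tube_mul (tube_mul x y) z) =
  tlift (fun y1 y2 => tube_counit (tube_mul x y2) * tube_counit (tube_mul y1 z) : C^o)
    (tube_comul y).
Proof.
have bM := @tube_mul_bilin R D.
have le : linear (@tube_counit R D : _ -> C^o) by exact: tube_counit_linear.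
move: x y z; apply: tube_counit_trilinear => [x y|x z|y z|x y|x z|y z|].
- exact: linear_comp le (bilinr bM _).
- exact: linear_comp le (linear_comp (bilinl bM z) (bilinr bM x)).
- exact: linear_comp le (linear_comp (bilinl bM z) (bilinl bM y)).
- apply: tlift_param_linear => y1 y2.
  by apply: (linear_scaler (V := C^o)); apply: linear_comp le (bilinr bM _).
- exact: linear_comp (tlift_linear _) (@tube_comul_linear R D).
- apply: tlift_param_linear => y1 y2.
  by apply: (linear_scalel (V := C^o)); apply: linear_comp le (bilinl bM _).
by move=> *; apply: counit21_bracket.
Qed.

Lemma tube_weak_bialgebra : is_weak_bialgebra (@tube_mul R D) (tube_one D)
  (@tube_comul R D) (@tube_counit R D).
Proof.
split; [exact: tube_algebra|exact: tube_coalgebra|exact: tube_comulM| | | |].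
- exact: tube_comul_one12.
- exact: tube_comul_one21.
- exact: tube_counitM12.
- exact: tube_counitM21.
Qed.

End TubeCounit.

(** * The antipode *)

Section TubeAntipode.
Variables (R : realType) (D : UMFC R).
Local Notation C := R[i].
Local Notation I := (Irr D).
Implicit Types (a b c e f h k s i : I) (A B : D).
Local Notation d x := ((qdim (irr x))%:C)%C.

Lemma flatE A B f h (w : hom_out A B f h) :
  flat w = (idm (bar A) ⊠ w ⊠ idm (bar B)) ∘ (zig A B (irr f))^†.
Proof.
rewrite /zig 2!dagM !dag_tens dag_dag dag_idm -dag_unit_in dag_dag /flat.
by rewrite -!compoA.
Qed.

Lemma sharpE A B c e (v : hom_in A B c e) :
  sharp v = zig A B (irr e) ∘ (idm (bar A) ⊠ v ⊠ idm (bar B)).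
Proof. by []. Qed.

Lemma flat_linear A B f h : linear (@flat R D A B f h).
Proof. by move=> z t u; rewrite !flatE tens_linearr tens_linearl comp_linearl. Qed.

Lemma sharp_linear A B c e : linear (@sharp R D A B c e).
Proof. by move=> z t u; rewrite !sharpE tens_linearr tens_linearl comp_linearr. Qed.

Lemma qdim_neq0 k : d k != 0 :> C.
Proof.
have := umfc_qdim_gt0 (irrS k); rewrite -ltcR => /lt0r_neq0.
by [].
Qed.

Lemma qdim_ratio i k : ((qdim (@irr R D i) / qdim (irr k))%:C)%C = d i / d k :> C.
Proof. by rewrite rmorphM fmorphV. Qed.

Lemma antipode_term_bilin A B c e f h :
  bilin (fun (v : hom_in A B c e) (w : hom_out A B f h) =>
    ((qdim (irr f) / qdim (irr h))%:C)%C *: tube_bracket (flat w) (sharp v)).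
Proof.
apply: linear_bilin; last by apply: linear_scaler.
apply: bilin_swap; apply: bilin_comp (tube_bracket_bilin _ _ _ _ _ _) _ _.
  exact: flat_linear.
exact: sharp_linear.
Qed.

Lemma tube_antipode_linear : linear (@tube_antipode R D).
Proof. exact: tube_lift_linear. Qed.

Lemma tube_antipode_elt a b c e f h (v : hom_in (irr a) (irr b) c e)
    (w : hom_out (irr a) (irr b) f h) :
  tube_antipode (tube_elt v w) = (d f / d h) *: tube_bracket (flat w) (sharp v).
Proof.
rewrite /tube_antipode tube_lift_elt ?qdim_ratio // => *.
exact: antipode_term_bilin.
Qed.

Lemma cozig_nat A B (x y : D) (f : hom x y) :
  (idm A ⊠ (idm (bar A) ⊠ f ⊠ idm (bar B)) ⊠ idm B) ∘ cozig A B x = cozig A B y ∘ f.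
Proof.
apply: str_inj => n; rewrite /cozig /unit_in !strE /= !simplE.
rewrite -compoA -wh_nat !compoA; congr (_ ∘ _).
by rewrite (@str_coev_nat _ _ (sleaf A)).
Qed.

(** [trace_zig] for the transpose of [u], which a triangle identity transposes back. Transposition
    thus preserves the composition pairing up to the ratio of dimensions. *)
Lemma trace_flat A B k i (u : hom (bar A ⊗ irr k ⊗ bar B) (irr i))
    (w : hom (A ⊗ irr i ⊗ B) (irr k)) :
  d i * irr_scalar (u ∘ (flat w : hom_in _ _ i k)) =
  d k * irr_scalar (w ∘ ((idm A ⊠ u ⊠ idm B) ∘ cozig A B (irr k))).
Proof.
rewrite -[RHS]trace_zig act_comp flatE; congr (_ * irr_scalar _).
rewrite [LHS]compoA; congr (_ ∘ _); rewrite [RHS]compoA; congr (_ ∘ _).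
by rewrite act_comp compoA zig_nat -compoA cozig_zig idr.
Qed.

(** The weights [d i / d k] in the antipode are those for which transposing the dual basis yields a
    canonical element again, here that of [bar A ⊗ irr k ⊗ bar B] composed with [cozig]. *)
Lemma sum_flat_bdual A B k :
  \sum_i \sum_(p < \dim {: hom (irr k) (A ⊗ irr i ⊗ B)})
    (d i / d k) *: ((idm A ⊠ (flat (bdual p : hom_out A B i k)) ⊠ idm B) ∘ bvec p) =
  cozig A B (irr k).
Proof.
transitivity ((idm A ⊠ idm (bar A ⊗ irr k ⊗ bar B) ⊠ idm B) ∘ cozig A B (irr k));
  last by rewrite !tens_idm idl.
rewrite -(irr_decomp (bar A ⊗ irr k ⊗ bar B)) tens_sumr tens_suml comp_suml.
apply: eq_bigr => i _; rewrite tens_sumr tens_suml comp_suml.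
transitivity (\sum_(p < \dim {: hom (irr k) (A ⊗ irr i ⊗ B)})
  \sum_(q < \dim {: hom (irr i) (bar A ⊗ irr k ⊗ bar B)})
  (d i / d k * irr_scalar (bdual q ∘ (flat (bdual p : hom_out A B i k) : hom_in _ _ i k)))
    *: ((idm A ⊠ bvec q ⊠ idm B) ∘ bvec p)).
  apply: eq_bigr => p _; rewrite {1}[flat _]bvec_expand tens_sumr tens_suml comp_suml.
  rewrite scaler_sumr; apply: eq_bigr => q _.
  by rewrite tensZr tensZl compZl scalerA.
rewrite exchange_big; apply: eq_bigr => q _ /=.
(* The coordinates of the transpose of [bdual q] are compared, by [trace_flat], with those of
   [flat (bdual p)]. *)
rewrite act_comp -compoA [X in _ ∘ X]bvec_expand comp_sumr.
apply: eq_bigr => p _; rewrite compZr; congr (_ *: _).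
by rewrite mulrAC trace_flat mulrAC divff ?mul1r // qdim_neq0.
Qed.

Lemma comp_out_sharp A B c e f h (v : hom_in A B c e) (w : hom_out A B f h) :
  comp_out w (sharp v) ∘ (coev A ⊠ idm (irr c) ⊠ (ev B)^†) =
  w ∘ (idm A ⊠ irr_delta e f ⊠ idm B) ∘ v ∘ unit_out (irr c).
Proof.
have E : (rebracket A (bar A) (irr c) (bar B) B)^† ∘ (coev A ⊠ idm (irr c) ⊠ (ev B)^†) =
    cozig A B (irr c) ∘ unit_out (irr c).
  by rewrite /cozig -[RHS]compoA unit_inK idr.
rewrite /comp_out -compoA E sharpE.
move: (cozig_nat A B v) (zig_cozig A B (irr e)).
move: (cozig _ _ _) (cozig _ _ _) (zig _ _ _) (unit_out _) => z1 z2 z3 u Ev Ez.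
rewrite !act_comp -!compoA; congr (_ ∘ (_ ∘ _)).
rewrite [(idm _ ⊠ (idm _ ⊠ v ⊠ _) ⊠ _) ∘ _]compoA Ev -compoA compoA Ez.
by rewrite idl.
Qed.

(** [sum_flat_bdual] evaluates the upper legs to a pair of cups. Moved to the lower leg by
    dinaturality, these straighten the bent legs of [sharp v], and what remains is [w ∘ v], a
    scalar. *)
Lemma antipode_target A B c e f h (v : hom_in A B c e) (w : hom_out A B f h) k :
  \sum_i \sum_p (d i / d k) *:
    tube_bracket (comp_in (bvec p : hom_in A B k i) (flat (bdual p : hom_out A B i k)))
      (comp_out w (sharp v)) =
  bracket_counit v w *: unit_bracket k c.
Proof.
have lB := bilinl (tube_bracket_bilin (A ⊗ bar A) (bar B ⊗ B) k k c h) (comp_out w (sharp v)).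
transitivity (tube_bracket
    (rebracket A (bar A) (irr k) (bar B) B ∘ cozig A B (irr k) : hom_in _ _ k k)
    (comp_out w (sharp v))).
  rewrite -sum_flat_bdual comp_sumr (lin_sum lB); apply: eq_bigr => i _.
  rewrite comp_sumr (lin_sum lB); apply: eq_bigr => p _.
  rewrite compZr (lin_scale lB); congr (_ *: tube_bracket _ _).
  by rewrite /comp_in irr_delta_id idr -compoA.
have [_ rr] := rebracketU A (bar A) (irr k) (bar B) B.
have -> : rebracket A (bar A) (irr k) (bar B) B ∘ cozig A B (irr k) =
    (coev A ⊠ idm (irr k) ⊠ (ev B)^†) ∘ unit_in (irr k).
  by rewrite /cozig -[_ ∘ _ ∘ unit_in _]compoA compoA rr idl.
rewrite bracket_dinat comp_out_sharp /bracket_counit.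
set t := w ∘ _ ∘ v; have bB := @tube_bracket_bilin R D.
have [ch|ch] := eqVneq c h; last first.
  rewrite [t]schur // !comp0l irr_scalar0 scale0r.
  exact: lin_zero (bilinr (bB _ _ _ _ _ _) _).
move: t; rewrite -{}ch => t; rewrite irr_delta_id idr {1}[t]irr_scalarE compZl idl.
exact: lin_scale (bilinr (bB _ _ _ _ _ _) _) _ _.
Qed.

Lemma comp_in_flat A B c e f h (v : hom_in A B c e) (w : hom_out A B f h) :
  (ev A ⊠ idm (irr e) ⊠ (coev B)^†) ∘ comp_in (flat w) v =
  unit_in (irr e) ∘ (zig A B (irr e) ∘
    (idm (bar A) ⊠ ((v ∘ irr_delta h c) ∘ w) ⊠ idm (bar B)) ∘ (zig A B (irr f))^†).
Proof.
have E : (ev A ⊠ idm (irr e) ⊠ (coev B)^†) ∘ rebracket (bar A) A (irr e) B (bar B) =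
    unit_in (irr e) ∘ zig A B (irr e).
  by rewrite /zig -compoA [RHS]compoA unit_inK idl.
rewrite /comp_in flatE; move: E.
move: (rebracket _ _ _ _ _) (zig _ _ (irr e)) (zig _ _ _)^† (unit_in _) (v ∘ _).
move=> r z z' u v' E.
by rewrite [in RHS]act_comp !compoA E.
Qed.

(** The weight is constant in the sum here. The lower legs resolve an identity and become a pair of
    caps; on the upper leg these close the composite of [v] and [w] into a bubble, whose value by
    [trace_zig] cancels the weight. *)
Lemma antipode_source A B c e f h (v : hom_in A B c e) (w : hom_out A B f h) i :
  (d f / d h) *: \sum_k \sum_p
    tube_bracket (comp_in (flat w) v)
      (comp_out (sharp (bvec p : hom_in A B k i)) (bdual p : hom_out A B i k)) =
  bracket_counit v w *: unit_bracket f i.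
Proof.
have bB := @tube_bracket_bilin R D.
have lB := bilinr (bB (bar A ⊗ A) (B ⊗ bar B) f e i i) (comp_in (flat w) v).
(* Summed over [k] and [p], the basis and its dual compose to the identity of [A ⊗ irr i ⊗ B], which
   leaves [zig]. *)
have E : \sum_k \sum_p
    comp_out (sharp (bvec p : hom_in A B k i)) (bdual p : hom_out A B i k) =
    unit_out (irr i) ∘ (ev A ⊠ idm (irr i) ⊠ (coev B)^†).
  transitivity (zig A B (irr i) ∘ (rebracket (bar A) A (irr i) B (bar B))^†).
    transitivity (zig A B (irr i) ∘ (idm (bar A) ⊠ idm (A ⊗ irr i ⊗ B) ⊠ idm (bar B))
      ∘ (rebracket (bar A) A (irr i) B (bar B))^†); last by rewrite !tens_idm idr.
    rewrite -(irr_decomp (A ⊗ irr i ⊗ B)) tens_sumr tens_suml comp_sumr comp_suml.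
    apply: eq_bigr => k _; rewrite tens_sumr tens_suml comp_sumr comp_suml.
    apply: eq_bigr => p _; rewrite /comp_out irr_delta_id idl sharpE act_comp.
    by rewrite compoA.
  by rewrite /zig compUK //; apply: rebracketU.
transitivity ((d f / d h) *: tube_bracket (comp_in (flat w) v)
    (unit_out (irr i) ∘ (ev A ⊠ idm (irr i) ⊠ (coev B)^†) : hom_out _ _ i i)).
  congr (_ *: _); rewrite -E (lin_sum lB); apply: eq_bigr => k _.
  by rewrite (lin_sum lB).
rewrite -bracket_dinat comp_in_flat.
set t := _ ∘ _ ∘ (zig A B (irr f))^†.
have [ef|ef] := eqVneq e f; last first.
  rewrite bracket_counit_neqef // scale0r [t]schur 1?eq_sym // comp0r.
  by rewrite (lin_zero (bilinl (bB _ _ _ _ _ _) _)) scaler0.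
rewrite /t {t lB}; move: v; rewrite ef => v'.
set t := _ ∘ _ ∘ (zig A B (irr f))^†.
rewrite [t]irr_scalarE compZr idr (lin_scale (bilinl (bB _ _ _ _ _ _) _)) scalerA.
congr (_ *: _); rewrite mulrAC trace_zig mulrAC divff ?qdim_neq0 // mul1r.
by rewrite /bracket_counit irr_delta_id !tens_idm idr compoA.
Qed.

End TubeAntipode.

(** * The antipode axioms *)

Section TubeWeakHopf.
Variables (R : realType) (D : UMFC R).
Local Notation C := R[i].
Local Notation I := (Irr D).
Implicit Types (a b c e f h k s i : I) (A B : D).
Local Notation d x := ((qdim (irr x))%:C)%C.

(** Simple arcs suffice: the comultiplication keeps the arcs, so the axioms apply the antipode to no
    other brackets. *)
Lemma tube_antipode_bracket a b c e f h (v : hom_in (irr a) (irr b) c e)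
    (w : hom_out (irr a) (irr b) f h) :
  tube_antipode (tube_bracket v w) = (d f / d h) *: tube_bracket (flat w) (sharp v).
Proof. by rewrite tube_bracket_irr tube_antipode_elt. Qed.

Lemma counit_target A B c e f h (v : hom_in A B c e) (w : hom_out A B f h) :
  tlift (fun u1 u2 => tube_counit (tube_mul u1 (tube_bracket v w)) *: u2)
    (tube_comul (tube_one D)) =
  \sum_k bracket_counit v w *: unit_bracket k c.
Proof.
have le : linear (@tube_counit R D : _ -> C^o) by exact: tube_counit_linear.
set F := fun u1 u2 => _.
have bF : bilin F.
  apply: (@scale_bilin _ _ _ (fun u => tube_counit (tube_mul u (tube_bracket v w)))).
  exact: linear_comp le (bilinl (@tube_mul_bilin R D) _).
rewrite tube_comul_one exchange_big (lin_sum (tlift_linear F)); apply: eq_bigr => k _.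
rewrite (lin_sum (tlift_linear F)).
rewrite -[RHS](sum_if2 c h (fun _ i => bracket_counit v w *: unit_bracket k i)).
apply: eq_bigr => x _; rewrite (lin_sum (tlift_linear F)); apply: eq_bigr => i _.
rewrite tlift_pure // /F unit_bracket_mull; case: ifP => _.
  by rewrite tube_counit_bracket.
by rewrite (lin_zero le) scale0r.
Qed.

Lemma counit_source A B c e f h (v : hom_in A B c e) (w : hom_out A B f h) :
  tlift (fun u1 u2 => tube_counit (tube_mul (tube_bracket v w) u2) *: u1)
    (tube_comul (tube_one D)) =
  \sum_i bracket_counit v w *: unit_bracket f i.
Proof.
have le : linear (@tube_counit R D : _ -> C^o) by exact: tube_counit_linear.
set F := fun u1 u2 => _.
have bF : bilin F.
  apply: bilin_swap.
  apply: (@scale_bilin _ _ _ (fun u => tube_counit (tube_mul (tube_bracket v w) u))).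
  exact: linear_comp le (bilinr (@tube_mul_bilin R D) _).
rewrite tube_comul_one (lin_sum (tlift_linear F)); apply: eq_bigr => i _.
rewrite -[RHS](sum_if2 e f (fun x _ => bracket_counit v w *: unit_bracket x i)).
rewrite (lin_sum (tlift_linear F)) [RHS]exchange_big; apply: eq_bigr => y _ /=.
rewrite (lin_sum (tlift_linear F)); apply: eq_bigr => j _.
rewrite tlift_pure // /F unit_bracket_mulr; case: ifP => _.
  by rewrite tube_counit_bracket.
by rewrite (lin_zero le) scale0r.
Qed.

Lemma tube_target (x : Tube D) :
  tlift (fun x1 x2 => tube_mul x1 (tube_antipode x2)) (tube_comul x) =
  tlift (fun u1 u2 => tube_counit (tube_mul u1 x) *: u2) (tube_comul (tube_one D)).
Proof.
have bM := @tube_mul_bilin R D; have lS := @tube_antipode_linear R D.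
have le : linear (@tube_counit R D : _ -> C^o) by exact: tube_counit_linear.
move: x; apply: tube_ext => [||a b c e f h v w].
- exact: linear_comp (tlift_linear _) (@tube_comul_linear R D).
- apply: tlift_param_linear => u1 u2; apply: linear_scalel.
  exact: linear_comp le (bilinr bM _).
rewrite -tube_bracket_irr counit_target tube_comul_bracket tlift_comul; last first.
  exact: bilin_comp bM (@linear_id _ _) lS.
rewrite exchange_big /=; apply: eq_bigr => k _.
rewrite -antipode_target; apply: eq_bigr => i _; apply: eq_bigr => p _.
by rewrite tube_antipode_bracket (lin_scale (bilinr bM _)) tube_mul_bracket.
Qed.

Lemma tube_source_bracket a b c e f h (v : hom_in (irr a) (irr b) c e)
    (w : hom_out (irr a) (irr b) f h) :
  tlift (fun x1 x2 => tube_mul (tube_antipode x1) x2) (tube_comul (tube_bracket v w)) =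
  \sum_i bracket_counit v w *: unit_bracket f i.
Proof.
have bM := @tube_mul_bilin R D; have lS := @tube_antipode_linear R D.
rewrite tube_comul_bracket tlift_comul; last first.
  exact: bilin_comp bM lS (@linear_id _ _).
apply: eq_bigr => i _; rewrite -antipode_source scaler_sumr; apply: eq_bigr => k _.
rewrite scaler_sumr; apply: eq_bigr => p _.
by rewrite tube_antipode_bracket (lin_scale (bilinl bM _)) tube_mul_bracket.
Qed.

Lemma tube_source (x : Tube D) :
  tlift (fun x1 x2 => tube_mul (tube_antipode x1) x2) (tube_comul x) =
  tlift (fun u1 u2 => tube_counit (tube_mul x u2) *: u1) (tube_comul (tube_one D)).
Proof.
have bM := @tube_mul_bilin R D.
have le : linear (@tube_counit R D : _ -> C^o) by exact: tube_counit_linear.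
move: x; apply: tube_ext => [||a b c e f h v w].
- exact: linear_comp (tlift_linear _) (@tube_comul_linear R D).
- apply: tlift_param_linear => u1 u2; apply: linear_scalel.
  exact: linear_comp le (bilinl bM _).
by rewrite -tube_bracket_irr counit_source tube_source_bracket.
Qed.

(** By [tube_source_bracket], the first two factors give a counit value times idempotents
    [unit_bracket f x], of which only [x = e] acts on the remaining antipode term, and by the
    identity. The counit values then recombine the dual basis into [w]. *)
Lemma tube_antipode_axiom (x : Tube D) :
  tlift (fun x12 x3 =>
    tlift (fun x1 x2 => tube_mul (tube_mul (tube_antipode x1) x2) (tube_antipode x3)) x12)
    (Delta_id (@tube_comul R D) (tube_comul x)) = tube_antipode x.
Proof.
have bM := @tube_mul_bilin R D; have lS := @tube_antipode_linear R D.
have lD := @tube_comul_linear R D.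
move: x; apply: tube_ext => [||a b c e f h v w].
- exact: linear_comp (tlift_linear _) (linear_comp (tlift_linear _) lD).
- exact: lS.
set F := fun x12 x3 => _.
(* Groups the triple product so that the source identity applies to the first two factors. *)
have FE x12 x3 : F x12 x3 =
    tube_mul (tlift (fun x1 x2 => tube_mul (tube_antipode x1) x2) x12) (tube_antipode x3).
  by rewrite (linear_tlift _ _ (bilinl bM (tube_antipode x3))).
have bF : bilin F.
  have := bilin_comp bM
    (tlift_linear (fun x1 x2 => tube_mul (tube_antipode x1) x2)) lS.
  by case=> H1 H2; split=> z k x y; rewrite !FE ?H1 ?H2.
have bD : bilin (fun x y : Tube D => tube_comul x ⨂ y).
  exact: bilin_comp (tpure_bilin _ _) lD (@linear_id _ _).
have bFD : bilin (fun x y => F (tube_comul x) y).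
  exact: bilin_comp bF lD (@linear_id _ _).
rewrite -tube_bracket_irr tube_comul_bracket /Delta_id.
rewrite (linear_tlift _ _ (tlift_linear F)).
transitivity (tlift (fun x y => F (tube_comul x) y) (bracket_comul v w)).
  rewrite /tlift; apply: eq_bigr => i _; apply: eq_bigr => j _; congr (_ *: _).
  exact: tlift_pure.
rewrite tlift_comul // tube_antipode_bracket.
have FbE i k (u : hom_in (irr a) (irr b) k i) (z : hom_out (irr a) (irr b) i k) :
    F (tube_comul (tube_bracket u w)) (tube_bracket v z) =
    bracket_counit u w *: tube_mul (\sum_x unit_bracket f x)
      ((d i / d k) *: tube_bracket (flat z) (sharp v)).
  rewrite FE tube_source_bracket -scaler_sumr (lin_scale (bilinl bM _)).
  by rewrite tube_antipode_bracket.
rewrite (sum_only1 (k := f)) => [|i ne]; last first.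
  rewrite big1 // => k _; rewrite big1 // => p _.
  by rewrite FbE bracket_counit_neqef // scale0r.
rewrite (sum_only1 (k := h)) => [|k ne]; last first.
  by rewrite big1 // => p _; rewrite FbE bracket_counit_neqch // scale0r.
have lR := bilinl (tube_bracket_bilin (bar (irr a)) (bar (irr b)) f h c e) (sharp v).
have lRf := linear_scaler (d f / d h) (linear_comp lR (@flat_linear _ _ _ _ _ _)).
rewrite [w in RHS]bdual_expand (lin_sumZ lRf); apply: eq_bigr => p _.
rewrite FbE bracket_counit_eq; congr (_ *: _).
rewrite (lin_scale (bilinr bM _)); congr (_ *: _).
rewrite (lin_sum (bilinl bM _)) (sum_only1 (k := e)) => [|x /negPf ne].
  by rewrite unit_bracket_mull !eqxx.
by rewrite unit_bracket_mull ne andbF.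
Qed.

End TubeWeakHopf.

Theorem proposition9 (R : realType) (D : UMFC R) :
  is_weak_Hopf_algebra (@tube_mul R D) (@tube_one R D) (@tube_comul R D)
    (@tube_counit R D) (@tube_antipode R D).
Proof.
split.
- exact: tube_weak_bialgebra.
- exact: tube_antipode_linear.
- exact: tube_target.
- exact: tube_source.
- exact: tube_antipode_axiom.
Qed.
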